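(* Let $\Sigma$ be a finite alphabet and let $L\subseteq\Sigma^\star$ be a language definable in the logic $\mathsf{FO}[\Sigma,<]$. Then there exists a data structure that, for a given word $w\in\Sigma^\star$ which can be updated over time by replacing single symbols, maintains whether $w\in L$. It can be initialized on a given word $w$ in time $\mathcal{O}(n)$, where $n=|w|$, and then every update takes worst-case time $\mathcal{O}(\log\log n)$.
   Context: $\mathsf{FO}[\Sigma,<]$ is first-order logic over words: variables range over positions of the word; atomic formulas are $x=y$, $a(x)$ for $a\in\Sigma$ (position $x$ carries symbol $a$), and $x<y$; formulas are built with boolean connectives and existential/universal quantification over positions. A language is $\mathsf{FO}$-definable if it is the set of words satisfying some sentence (formula without free variables) of this logic. The hidden constants may depend on $L$. The model of computation is the word-RAM. *)

(* Defs.v *)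
From mathcomp Require Import all_boot.
From Stdlib Require Import PeanoNat.

Set Implicit Arguments.
Unset Strict Implicit.
Unset Printing Implicit Defensive.

Inductive fo_formula (S : Type) : Type :=
  | FEq  of nat & nat
  | FSym of S & nat
  | FLt  of nat & nat
  | FTrue
  | FNot of fo_formula S
  | FAnd of fo_formula S & fo_formula S
  | FOr  of fo_formula S & fo_formula S
  | FEx  of nat & fo_formula S
  | FAll of nat & fo_formula S.

Arguments FTrue {S}.

Fixpoint fo_free (S : Type) (phi : fo_formula S) : seq nat :=
  match phi with
  | FEq x y => [:: x; y]
  | FSym _ x => [:: x]
  | FLt x y => [:: x; y]
  | FTrue => [::]
  | FNot f => fo_free f
  | FAnd f g => fo_free f ++ fo_free g
  | FOr f g => fo_free f ++ fo_free g
  | FEx x f => filter (fun y => y != x) (fo_free f)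
  | FAll x f => filter (fun y => y != x) (fo_free f)
  end.

Definition fo_sentence (S : Type) (phi : fo_formula S) : Prop :=
  fo_free phi = [::].

Definition assign_upd (nu : nat -> nat) (x i : nat) : nat -> nat :=
  fun y => if y == x then i else nu y.

Fixpoint fo_sat (S : Type) (w : seq S) (nu : nat -> nat) (phi : fo_formula S)
  : Prop :=
  match phi with
  | FEq x y => nu x = nu y
  | FSym a x => onth w (nu x) = Some a
  | FLt x y => nu x < nu y
  | FTrue => True
  | FNot f => ~ fo_sat w nu f
  | FAnd f g => fo_sat w nu f /\ fo_sat w nu g
  | FOr f g => fo_sat w nu f \/ fo_sat w nu g
  | FEx x f => exists i, i < size w /\ fo_sat w (assign_upd nu x i) f
  | FAll x f => forall i, i < size w -> fo_sat w (assign_upd nu x i) f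
  end.

Definition FO_definable (S : Type) (L : seq S -> Prop) : Prop :=
  exists phi : fo_formula S,
    fo_sentence phi /\ forall w, L w <-> fo_sat w (fun _ => 0) phi.

(* Word-RAM with word size W.  Memory: cells indexed by nat, each     *)
(* holding a W-bit word; all arithmetic is modulo 2^W.  Addresses are *)
(* word values (indirect addressing via Load/Store), cells named in   *)
(* instructions are program constants.  Unit cost per instruction.    *)

Inductive instr : Type :=
  | IConst of nat & nat
  | IAdd of nat & nat & nat
  | ISub of nat & nat & nat
  | IMul of nat & nat & nat
  | IDiv of nat & nat & nat      (* M[i] := M[j] / M[k]  (0 if M[k]=0)*)
  | IMod of nat & nat & nat      (* M[i] := M[j] mod M[k] (M[j] if 0) *)
  | IAnd of nat & nat & nat
  | IOr  of nat & nat & nat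
  | IXor of nat & nat & nat
  | IShl of nat & nat & nat
  | IShr of nat & nat & nat
  | ILt  of nat & nat & nat
  | ILoad of nat & nat
  | IStore of nat & nat
  | IJz of nat & nat
  | IHalt.

Definition program := seq instr.
Definition memory := nat -> nat.

Definition mem_upd (m : memory) (a v : nat) : memory :=
  fun x => if x == a then v else m x.

Definition fetch (p : program) (pc : nat) : instr := nth IHalt p pc.

Definition is_halted (p : program) (pc : nat) : bool :=
  if fetch p pc is IHalt then true else false.

Definition ram_step (W : nat) (p : program) (st : nat * memory) : nat * memory :=
  let: (pc, m) := st in
  let md x := x %% 2 ^ W in
  let nxt i v := (pc.+1, mem_upd m i (md v)) in
  match fetch p pc with
  | IConst i c => nxt i c
  | IAdd i j k => nxt i (m j + m k)
  | ISub i j k => nxt i (m j + (2 ^ W - md (m k)))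
  | IMul i j k => nxt i (m j * m k)
  | IDiv i j k => nxt i (m j %/ m k)
  | IMod i j k => nxt i (m j %% m k)
  | IAnd i j k => nxt i (Nat.land (m j) (m k))
  | IOr i j k => nxt i (Nat.lor (m j) (m k))
  | IXor i j k => nxt i (Nat.lxor (m j) (m k))
  | IShl i j k => nxt i (m j * 2 ^ (m k))
  | IShr i j k => nxt i (m j %/ 2 ^ (m k))
  | ILt i j k => nxt i (m j < m k)
  | ILoad i j => nxt i (m (m j))
  | IStore i j => (pc.+1, mem_upd m (m i) (md (m j)))
  | IJz i l => if m i == 0 then (l, m) else (pc.+1, m)
  | IHalt => (pc, m)
  end.

Definition halts_within (W : nat) (p : program) (m : memory) (t : nat)
  (m' : memory) : Prop :=
  exists s, s <= t /\
    let: (pc, mf) := iter s (ram_step W p) (0, m) in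
    is_halted p pc /\ mf = m'.

Definition sym_code (S : finType) (a : S) : nat := enum_rank a.

Definition init_mem (S : finType) (w : seq S) : memory :=
  fun x =>
    if x == 0 then size w
    else if (3 <= x) && (x < 3 + size w) then
      (if onth w (x - 3) is Some a then sym_code a else 0)
    else 0.

Definition upd_mem (S : finType) (m : memory) (i : nat) (a : S) : memory :=
  mem_upd (mem_upd m 0 i) 1 (sym_code a).

Definition answers (S : Type) (L : seq S -> Prop) (w : seq S) (m : memory)
  : Prop := (L w -> m 2 = 1) /\ (~ L w -> m 2 = 0).

Definition loglog (n : nat) : nat := trunc_log 2 (trunc_log 2 n).

Fixpoint updates_ok (S : finType) (L : seq S -> Prop) (W : nat)
  (Pupd : program) (tu : nat) (w : seq S) (m : memory)
  (us : seq (nat * S)) : Prop :=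
  match us with
  | [::] => True
  | (i, a) :: us' =>
      let w' := set_nth a w i a in
      exists m', halts_within W Pupd (upd_mem m i a) tu m' /\
                 answers L w' m' /\
                 updates_ok L W Pupd tu w' m' us'
  end.

(* Main.v *)
(* Words are classified by the rank-[k] Ehrenfeucht-Fraisse equivalence, whose classes form a finite aperiodic monoid recognising [L]; so it suffices to maintain infix products of a sequence over such a monoid under point updates.
   This is done by induction on the monoid. Fix a letter [c] and cut the sequence at its occurrences. The pieces in between avoid [c] and are handled with one letter less. The product from one occurrence of [c] to the next lies in the local divisor of the monoid at [c], that is, in the set of elements divisible by [c] on both sides with product [xc . cy = xcy], which aperiodicity makes strictly smaller. An update touches two of these products, and finding them is a predecessor search among the occurrences of [c], which a van Emde Boas tree does in [O(log log n)] steps.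
   For linear initialisation the word is cut into blocks of length about [log log n], whose products are recomputed from scratch. The programs are written in a small structured language over arrays and translated to the word-RAM. *)

(* Nothing is renumbered in the induction: every derived sequence lives on the same positions and
   carries the unit of its own monoid where it has nothing to record. So no ranks have to be
   maintained, and an update at a position stays an update at that position. The induction is
   lexicographic, on the size of the monoid and then of the alphabet. One operation makes boundedly
   many calls to the two smaller structures, so the recursion affects only the constant, and the
   programs are fixed before the length is known. The universe is rounded up to $U = 2^{2^H}$, the
   least such number above $n$: bit widths then halve exactly and $H$ is about $\log\log n$. Table
   addresses are polynomial in $n$, as the word size permits, and zeroed memory already represents
   empty sets and constant unit sequences, so large tables cost nothing to set up. Setting one
   position costs $O(H)$. With blocks of length $H + 2$ about $n / H$ positions are set initially,
   which is linear in total, and recomputing a block is no dearer than a predecessor search. *)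
Require Import Defs.
From mathcomp Require Import all_boot zify.
From Stdlib Require Import ClassicalEpsilon FunctionalExtensionality.

Set Implicit Arguments.
Unset Strict Implicit.
Unset Printing Implicit Defensive.

(** * First-order logic and aperiodic monoids *)

(* In each round a position splits both words, and the game goes on separately on the two sides. *)
Fixpoint eqv (A : Type) (k : nat) (u v : seq A) : Prop :=
  if k is k'.+1 then
    (forall u1 a u2, u = u1 ++ a :: u2 ->
       exists v1 v2, [/\ v = v1 ++ a :: v2, eqv k' u1 v1 & eqv k' u2 v2]) /\
    (forall v1 a v2, v = v1 ++ a :: v2 ->
       exists u1 u2, [/\ u = u1 ++ a :: u2, eqv k' u1 v1 & eqv k' u2 v2])
  else True.

Lemma cat_cons_inv (A : Type) (u v w1 w2 : seq A) a :
  u ++ v = w1 ++ a :: w2 ->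
  (exists2 u2, u = w1 ++ a :: u2 & w2 = u2 ++ v) \/
  (exists2 v1, w1 = u ++ v1 & v = v1 ++ a :: w2).
Proof.
elim: u w1 => [|x u IH] w1 /=; first by right; exists w1.
case: w1 => [|y w1] /= [<- e]; first by left; exists u.
by case: (IH _ e) => -[z -> ->]; [left | right]; exists z.
Qed.

Section Eqv.
Variable A : Type.
Implicit Types u v w : seq A.

Lemma eqv_refl k u : eqv k u u.
Proof.
elim: k u => //= k IH u.
by split=> u1 a u2 ->; exists u1, u2; split=> //; apply: IH.
Qed.

Lemma eqv_sym k u v : eqv k u v -> eqv k v u.
Proof.
elim: k u v => //= k IH u v [H1 H2]; split=> u1 a u2 e.
  by have [v1 [v2 [-> e1 e2]]] := H2 _ _ _ e; exists v1, v2; split=> //; apply: IH.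
by have [v1 [v2 [-> e1 e2]]] := H1 _ _ _ e; exists v1, v2; split=> //; apply: IH.
Qed.

Lemma eqvW k u v : eqv k.+1 u v -> eqv k u v.
Proof.
elim: k u v => // k IH u v [H1 H2]; split=> u1 a u2 e.
  by have [v1 [v2 [-> e1 e2]]] := H1 _ _ _ e; exists v1, v2; split=> //; apply: IH.
by have [v1 [v2 [-> e1 e2]]] := H2 _ _ _ e; exists v1, v2; split=> //; apply: IH.
Qed.

(** A split of a concatenation falls into one of the two factors and is answered there. The other
    factor stays whole and is glued to a remainder of lower rank, whence [eqvW]. *)
Lemma eqv_cat k u u' v v' : eqv k u u' -> eqv k v v' -> eqv k (u ++ v) (u' ++ v').
Proof.
elim: k u u' v v' => // k IH u u' v v' hu hv.
have [uW vW] := (eqvW hu, eqvW hv); case: hu hv => [hu1 hu2] [hv1 hv2].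
split=> w1 a w2 ew; have [[z e ->]|[z -> e]] := cat_cons_inv ew.
- have [x1 [x2 [-> e1 e2]]] := hu1 _ _ _ e.
  by exists x1, (x2 ++ v'); rewrite -catA; split=> //; apply: IH.
- have [x1 [x2 [-> e1 e2]]] := hv1 _ _ _ e.
  by exists (u' ++ x1), x2; rewrite -catA; split=> //; apply: IH.
- have [x1 [x2 [-> e1 e2]]] := hu2 _ _ _ e.
  by exists x1, (x2 ++ v); rewrite -catA; split=> //; apply: IH.
have [x1 [x2 [-> e1 e2]]] := hv2 _ _ _ e.
by exists (u ++ x1), x2; rewrite -catA; split=> //; apply: IH.
Qed.

Lemma eqv_cons k a u v : eqv k u v -> eqv k (a :: u) (a :: v).
Proof. by move=> h; apply: (@eqv_cat _ [:: a] [:: a]) => //; apply: eqv_refl. Qed.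

Definition wpow u n := flatten (nseq n u).

Lemma wpow_split u n w1 a w2 : wpow u n = w1 ++ a :: w2 ->
  exists i j u1 u2, [/\ n = (i + j).+1, u = u1 ++ a :: u2,
    w1 = wpow u i ++ u1 & w2 = u2 ++ wpow u j].
Proof.
elim: n w1 => [|n IH] w1 /=; first by case: w1.
move=> ew; have [[z eu ->]|[z -> ez]] := cat_cons_inv ew; last first.
  have [i [j [u1 [u2 [-> eu -> ->]]]]] := IH _ ez.
  by exists i.+1, j, u1, u2; split=> //; rewrite /wpow /= catA.
by exists 0, n, w1, z.
Qed.

Lemma wpow_join u i j u1 a u2 : u = u1 ++ a :: u2 ->
  wpow u (i + j).+1 = (wpow u i ++ u1) ++ a :: (u2 ++ wpow u j).
Proof.
move=> eu; rewrite -addnS /wpow nseqD flatten_cat /= {2}eu.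
by rewrite -!catA.
Qed.

(** A split inside one copy of [u] leaves [i] copies on the left and [j] on the right. Since
    [(i + 1) + (j + 1) = n + 1] is at least [2 * 2 ^ k'] for rank [k' + 1], one side is long enough
    to absorb the extra copy at rank [k']. *)
Lemma eqv_wpow k u n : 2 ^ k <= n.+1 -> eqv k (wpow u n) (wpow u n.+1).
Proof.
elim: k n => // k IH n; rewrite expnS => hn.
have aux i j u1 u2 i' j' : eqv k (wpow u i) (wpow u i') ->
    eqv k (wpow u j) (wpow u j') ->
    eqv k (wpow u i ++ u1) (wpow u i' ++ u1) /\
    eqv k (u2 ++ wpow u j) (u2 ++ wpow u j').
  by move=> hi hj; split; apply: eqv_cat => //; apply: eqv_refl.
split=> w1 a w2 ew; have [i [j [u1 [u2 [en eu -> ->]]]]] := wpow_split ew.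
  have [hi|hi] := leqP (2 ^ k) i.+1.
    exists (wpow u i.+1 ++ u1), (u2 ++ wpow u j).
    have [] := aux i j u1 u2 i.+1 j (IH _ hi) (eqv_refl _ _).
    by split=> //; rewrite en -addSn; apply: wpow_join.
  exists (wpow u i ++ u1), (u2 ++ wpow u j.+1).
  have hj : 2 ^ k <= j.+1 by lia.
  have [] := aux i j u1 u2 i j.+1 (eqv_refl _ _) (IH _ hj).
  by split=> //; rewrite en -addnS; apply: wpow_join.
(* Now the split is in the longer power, so [i + j = n]; one of [i] and [j] is at least [2 ^ k] and
   can give up a copy. *)
have [hi|hi] := leqP (2 ^ k) i.
  case: i hi en => [|i] hi en; first by have := expn_gt0 2 k; lia.
  exists (wpow u i ++ u1), (u2 ++ wpow u j).
  have [] := aux i j u1 u2 i.+1 j (IH _ hi) (eqv_refl _ _).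
  split=> //; rewrite (_ : n = (i + j).+1); [exact: wpow_join | lia].
case: j en => [|j] en; first by lia.
exists (wpow u i ++ u1), (u2 ++ wpow u j).
have hj : 2 ^ k <= j.+1 by lia.
have [] := aux i j u1 u2 i j.+1 (eqv_refl _ _) (IH _ hj).
split=> //; rewrite (_ : n = (i + j).+1); [exact: wpow_join | lia].
Qed.

End Eqv.

Lemma map_cat_cons_inv (A B : Type) (f : A -> B) u v1 b v2 :
  map f u = v1 ++ b :: v2 ->
  exists u1 a u2, [/\ u = u1 ++ a :: u2, v1 = map f u1, b = f a & v2 = map f u2].
Proof.
elim: u v1 => [|x u IH] [|y v1] //= [<- e].
  by exists [::], x, u.
have [u1 [a [u2 [-> -> -> ->]]]] := IH _ e.
by exists (x :: u1), a, u2.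
Qed.

Lemma eqv_map (A B : Type) (f : A -> B) k u v :
  eqv k u v -> eqv k (map f u) (map f v).
Proof.
elim: k u v => //= k IH u v [H1 H2].
split=> v1 b v2 ew; have [u1 [a [u2 [e -> -> ->]]]] := map_cat_cons_inv ew.
  have [x1 [x2 [-> e1 e2]]] := H1 _ _ _ e.
  by exists (map f x1), (map f x2); rewrite map_cat; split=> //; apply: IH.
have [x1 [x2 [-> e1 e2]]] := H2 _ _ _ e.
by exists (map f x1), (map f x2); rewrite map_cat; split=> //; apply: IH.
Qed.

(* The letter at position [i] also records which variables [nu] sends to [i], so that a quantifier only relabels letters. *)
Fixpoint mark (A : Type) (w : seq A) (i : nat) (nu : nat -> nat)
  : seq (A * (nat -> bool)) :=
  if w is a :: w' then (a, fun x => nu x == i) :: mark w' i.+1 nu else [::].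

(** Atoms have rank 2 because of the order: one round reaches the position of [y], a second one
    finds [x] in the prefix before it. *)
Fixpoint fo_rank (A : Type) (phi : fo_formula A) : nat :=
  match phi with
  | FNot f => fo_rank f
  | FAnd f g | FOr f g => maxn (fo_rank f) (fo_rank g)
  | FEx _ f | FAll _ f => (fo_rank f).+1
  | _ => 2
  end.

Section Mark.
Variable A : Type.
Implicit Types (w u v : seq A) (nu : nat -> nat).

Lemma mark_cat u v i nu : mark (u ++ v) i nu = mark u i nu ++ mark v (i + size u) nu.
Proof.
elim: u i => [|a u IH] i /=; first by rewrite addn0.
by rewrite IH addSnnS.
Qed.

Lemma mark_split w i nu s1 c s2 : mark w i nu = s1 ++ c :: s2 ->
  exists w1 a w2, [/\ w = w1 ++ a :: w2, s1 = mark w1 i nu,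
   c = (a, fun x => nu x == i + size w1) & s2 = mark w2 (i + size w1).+1 nu].
Proof.
elim: w i s1 => [|a w IH] i [|y s1] //= [<- e].
  by exists [::], a, w; rewrite addn0.
have [w1 [b [w2 [-> -> -> ->]]]] := IH _ _ e.
by exists (a :: w1), b, w2; rewrite /= addnS.
Qed.

Lemma mark_take_drop w nu j : j < size w -> exists w1 a w2,
  [/\ w = w1 ++ a :: w2, size w1 = j &
   mark w 0 nu = mark w1 0 nu ++ (a, fun x => nu x == j) :: mark w2 j.+1 nu].
Proof.
move=> hj; have [a _] : exists a : A, True by case: w hj => // a; exists a.
exists (take j w), (nth a w j), (drop j.+1 w).
have e : w = take j w ++ nth a w j :: drop j.+1 w.
  by rewrite -drop_nth // cat_take_drop.
have ej : size (take j w) = j by rewrite size_takel // ltnW.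
by split=> //; rewrite {1}e mark_cat /= add0n ej.
Qed.

Definition remark (x : nat) (b : bool) (c : A * (nat -> bool)) :=
  (c.1, fun y => if y == x then b else c.2 y).

Lemma mark_upd w i nu x j : (j < i) || (i + size w <= j) ->
  mark w i (assign_upd nu x j) = map (remark x false) (mark w i nu).
Proof.
elim: w i => //= a w IH i hj; rewrite IH; last by lia.
congr (_ :: _); rewrite /remark /=; congr pair.
apply: functional_extensionality => y; rewrite /assign_upd.
case: (y == x) => //; apply/eqP => ej; move: hj; rewrite ej ltnn /=; lia.
Qed.

Lemma mark_assign w1 a w2 nu x :
  mark (w1 ++ a :: w2) 0 (assign_upd nu x (size w1)) =
  map (remark x false) (mark w1 0 nu) ++
  remark x true (a, fun y => nu y == size w1) ::
  map (remark x false) (mark w2 (size w1).+1 nu).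
Proof.
rewrite mark_cat /= add0n mark_upd ?add0n ?leqnn ?orbT // mark_upd ?ltnSn //.
congr (_ ++ _ :: _); rewrite /remark /=; congr pair.
apply: functional_extensionality => y; rewrite /assign_upd.
by case: (y == x); rewrite ?eqxx.
Qed.

(** A quantifier costs one round. The chosen position splits both words; on the two sides only the
    flag of [x] is erased, a relabelling that preserves equivalence, and the pieces are glued
    again. *)
Lemma eqv_exists k w nu w' nu' x i : eqv k.+1 (mark w 0 nu) (mark w' 0 nu') ->
  i < size w -> exists2 i', i' < size w' &
  eqv k (mark w 0 (assign_upd nu x i)) (mark w' 0 (assign_upd nu' x i')).
Proof.
case=> H _ hi; have [w1 [a [w2 [ew ei em]]]] := mark_take_drop nu hi; subst i.
have [v1 [v2 [ev h1 h2]]] := H _ _ _ em.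
have [w1' [a' [w2' [ew' e1 e2 e3]]]] := mark_split ev.
exists (size w1'); first by rewrite ew' size_cat /= addnS ltnS leq_addr.
rewrite ew ew' !mark_assign; apply: eqv_cat.
  by apply: eqv_map; rewrite -e1.
rewrite add0n in e2; rewrite -e2; apply/eqv_cons/eqv_map.
by move: h2; rewrite e3 add0n.
Qed.

(** Splitting at [nu x] is answered by a position with the same marked letter. That letter carries
    the flag of [x], so the answer can only be [nu' x]; any property of the letter and its flags is
    transported, and one round less remains for the prefixes. *)
Lemma mark_letter k w nu w' nu' x (P : A -> (nat -> bool) -> Prop) :
  eqv k.+1 (mark w 0 nu) (mark w' 0 nu') -> nu x < size w ->
  (forall w1 a w2, w = w1 ++ a :: w2 -> size w1 = nu x ->
     P a (fun y => nu y == nu x)) ->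
  exists w1 a w2, [/\ w' = w1 ++ a :: w2, nu' x = size w1 &
    P a (fun y => nu' y == nu' x)] /\
    eqv k (mark (take (nu x) w) 0 nu) (mark w1 0 nu').
Proof.
case=> H _ hx hP; have [w1 [a [w2 [ew ei em]]]] := mark_take_drop nu hx.
have [v1 [v2 [ev h1 h2]]] := H _ _ _ em.
have [w1' [a' [w2' [ew' e1 e2 e3]]]] := mark_split ev.
have ex : nu' x = size w1'.
  by apply/eqP; case: e2 => _ /(congr1 (fun f => f x)); rewrite eqxx add0n.
exists w1', a, w2'; split; last by rewrite ew -ei take_size_cat // -e1.
case: e2 => ea em'; split=> //; first by rewrite ew' ea.
have := hP _ _ _ ew ei; rewrite em' ex; congr (P _ _).
Qed.

Lemma fo_eqv phi k w nu w' nu' : fo_rank phi <= k ->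
  (forall x, x \in fo_free phi -> nu x < size w) ->
  (forall x, x \in fo_free phi -> nu' x < size w') ->
  eqv k (mark w 0 nu) (mark w' 0 nu') ->
  fo_sat w nu phi <-> fo_sat w' nu' phi.
Proof.
have letter2 k' w0 nu0 w0' nu0' x : eqv k'.+2 (mark w0 0 nu0) (mark w0' 0 nu0') ->
    nu0 x < size w0 -> exists w1, nu0' x = size w1 /\
     eqv k'.+1 (mark (take (nu0 x) w0) 0 nu0) (mark w1 0 nu0').
  move=> h hx; have [|w1 [a [w2 [[_ ex _] h']]]] :=
    mark_letter (P := fun _ _ => True) h hx; first by [].
  by exists w1.
elim: phi k w nu w' nu' => /=.
- move=> x y [|k] // w nu w' nu' _ h h' he.
  have aux v mu v' mu' : eqv k.+1 (mark v 0 mu) (mark v' 0 mu') -> mu x < size v ->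
      mu x = mu y -> mu' x = mu' y.
    move=> e hx exy; have [|w1 [a [w2 [[_ _ /eqP ->] _]]]] :=
      mark_letter (P := fun _ f => f y) e hx; last by [].
    by move=> *; rewrite exy.
  split; first by apply: aux he _; rewrite h ?inE ?eqxx.
  by apply: aux (eqv_sym he) _; rewrite h' ?inE ?eqxx.
- move=> b x [|k] // w nu w' nu' _ h h' he.
  have aux v mu v' mu' : eqv k.+1 (mark v 0 mu) (mark v' 0 mu') -> mu x < size v ->
      onth v (mu x) = Some b -> onth v' (mu' x) = Some b.
    move=> e hx exy; have [|w1 [a [w2 [[-> -> ->] _]]]] :=
      mark_letter (P := fun a _ => a = b) e hx; last first.
      by rewrite onth_cat ltnn subnn.
    by move=> w1 a w2 ev ex; move: exy; rewrite -ex ev onth_cat ltnn subnn /= => -[].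
  split; first by apply: aux he _; rewrite h ?inE ?eqxx.
  by apply: aux (eqv_sym he) _; rewrite h' ?inE ?eqxx.
(* [x < y] says that [x] is a position of the prefix cut off at [y], hence the two rounds. *)
- move=> x y [|[|k]] // w nu w' nu' _ h h' he.
  have aux v mu v' mu' : eqv k.+2 (mark v 0 mu) (mark v' 0 mu') ->
      mu y < size v -> mu x < mu y -> mu' x < mu' y.
    move=> e hy exy; have [w1 [-> e1]] := letter2 _ _ _ _ _ _ e hy.
    have hx : mu x < size (take (mu y) v) by rewrite size_takel // ltnW.
    have [|u1 [a [u2 [[-> -> _] _]]]] :=
      mark_letter (P := fun _ _ => True) e1 hx; first by [].
    by rewrite size_cat /= addnS ltnS leq_addr.
  split; first by apply: aux he _; rewrite h ?inE ?eqxx ?orbT.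
  by apply: aux (eqv_sym he) _; rewrite h' ?inE ?eqxx ?orbT.
- by [].
- by move=> f IH k w nu w' nu' hk h h' he; rewrite (IH k w nu w' nu').
- move=> f IHf g IHg k w nu w' nu'; rewrite geq_max => /andP[hf hg] h h' he.
  rewrite (IHf k w nu w' nu') ?(IHg k w nu w' nu') // => x hx.
  + by apply: h; rewrite mem_cat hx orbT.
  + by apply: h'; rewrite mem_cat hx orbT.
  + by apply: h; rewrite mem_cat hx.
  + by apply: h'; rewrite mem_cat hx.
- move=> f IHf g IHg k w nu w' nu'; rewrite geq_max => /andP[hf hg] h h' he.
  rewrite (IHf k w nu w' nu') ?(IHg k w nu w' nu') // => x hx.
  + by apply: h; rewrite mem_cat hx orbT.
  + by apply: h'; rewrite mem_cat hx orbT.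
  + by apply: h; rewrite mem_cat hx.
  + by apply: h'; rewrite mem_cat hx.
- move=> x f IH [|k] // w nu w' nu' hk h h' he.
  have free v mu i : (forall y, y \in [seq y <- fo_free f | y != x] -> mu y < size v) ->
      i < size v -> forall y, y \in fo_free f -> assign_upd mu x i y < size v.
    move=> hm hi y hy; rewrite /assign_upd; case: eqP => // /eqP ne.
    by apply: hm; rewrite mem_filter ne.
  split=> -[i [hi hs]].
    have [i' hi' e] := @eqv_exists k _ _ _ _ x _ he hi; exists i'; split=> //.
    by apply/(IH k _ _ _ _ hk (free _ _ _ h hi) (free _ _ _ h' hi') e).
  have [i' hi' e] := @eqv_exists k _ _ _ _ x _ (eqv_sym he) hi; exists i'; split=> //.
  by apply/(IH k _ _ _ _ hk (free _ _ _ h' hi) (free _ _ _ h hi') e).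
move=> x f IH [|k] // w nu w' nu' hk h h' he.
have free v mu i : (forall y, y \in [seq y <- fo_free f | y != x] -> mu y < size v) ->
    i < size v -> forall y, y \in fo_free f -> assign_upd mu x i y < size v.
  move=> hm hi y hy; rewrite /assign_upd; case: eqP => // /eqP ne.
  by apply: hm; rewrite mem_filter ne.
split=> hs i hi.
  have [i' hi' e] := @eqv_exists k _ _ _ _ x _ (eqv_sym he) hi.
  by apply/(IH k _ _ _ _ hk (free _ _ _ h' hi) (free _ _ _ h hi') e)/hs.
have [i' hi' e] := @eqv_exists k _ _ _ _ x _ he hi.
by apply/(IH k _ _ _ _ hk (free _ _ _ h hi) (free _ _ _ h' hi') e)/hs.
Qed.

End Mark.

(** The laws are relative to a subset [E] of an ambient finite type, so that a local divisor is
    again a structure on the same type and the induction changes only [E], [op] and [e]. *)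
Record aperiodic_monoid (T : finType) (E : {set T}) (op : T -> T -> T) (e : T)
  : Prop := AperiodicMonoid {
  am_one : e \in E;
  am_mul : forall x y, x \in E -> y \in E -> op x y \in E;
  am_assoc : forall x y z, x \in E -> y \in E -> z \in E ->
    op x (op y z) = op (op x y) z;
  am_mul1l : forall x, x \in E -> op e x = x;
  am_mul1r : forall x, x \in E -> op x e = x;
  am_aperiodic : forall x, x \in E -> exists n, iter n.+1 (op x) e = iter n (op x) e
}.

Lemma fo_sat_free (A : Type) (phi : fo_formula A) w nu nu' :
  {in fo_free phi, nu =1 nu'} -> fo_sat w nu phi <-> fo_sat w nu' phi.
Proof.
have upd f x i mu mu' : {in [seq y <- f | y != x], mu =1 mu'} ->
    {in f, assign_upd mu x i =1 assign_upd mu' x i}.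
  move=> h y hy; rewrite /assign_upd; case: eqP => // /eqP ne.
  by apply: h; rewrite mem_filter ne.
elim: phi nu nu' => /=.
- by move=> x y nu nu' h; rewrite !h ?inE ?eqxx ?orbT.
- by move=> a x nu nu' h; rewrite !h ?inE ?eqxx ?orbT.
- by move=> x y nu nu' h; rewrite !h ?inE ?eqxx ?orbT.
- by [].
- by move=> f IH nu nu' /IH ->.
- move=> f IHf g IHg nu nu' h; rewrite (IHf nu nu') ?(IHg nu nu') // => x hx;
    by apply: h; rewrite mem_cat hx ?orbT.
- move=> f IHf g IHg nu nu' h; rewrite (IHf nu nu') ?(IHg nu nu') // => x hx;
    by apply: h; rewrite mem_cat hx ?orbT.
- by move=> x f IH nu nu' /upd h; split=> -[i [hi hs]]; exists i; split=> //;
    [apply/(IH _ _ (h i)) | apply/(IH _ _ (h i))].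
by move=> x f IH nu nu' /upd h; split=> hs i hi; apply/(IH _ _ (h i))/hs.
Qed.

(** * Finitely many types of each rank, and the aperiodic monoid they form *)

Section Types.
Variable A : finType.

Fixpoint splits (w : seq A) : seq (seq A * A * seq A) :=
  if w is a :: w' then
    ([::], a, w') :: [seq (a :: p.1.1, p.1.2, p.2) | p <- splits w']
  else [::].

Lemma splitsP w u a v : ((u, a, v) \in splits w) = (w == u ++ a :: v).
Proof.
elim: w u a v => [|b w IH] u a v; first by case: u.
rewrite /= inE; apply/idP/eqP => [/orP[/eqP[-> -> ->]|/mapP[[[u' a'] v']]]|] //.
  by rewrite IH => /eqP -> [-> -> ->].
case: u => [|c u] [-> ew]; first by rewrite ew eqxx.
by apply/orP; right; apply/mapP; exists (u, a, v); rewrite // IH ew.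
Qed.

(** Hintikka types: a type of rank [k + 1] is the set of triples of left type, letter and right type
    over all splits. This makes finiteness of the number of classes immediate. *)
Fixpoint wtype (k : nat) : finType :=
  if k is k'.+1 then {set wtype k' * A * wtype k'} : finType else unit.

Fixpoint tp (k : nat) : seq A -> wtype k :=
  if k is k'.+1 return seq A -> wtype k then
    fun w => [set x in [seq (tp k' p.1.1, p.1.2, tp k' p.2) | p <- splits w]]
  else fun=> tt.

Lemma tp_eqv k u v : tp k u = tp k v <-> eqv k u v.
Proof.
elim: k u v => [|k IH] u v //.
have mem w x : (x \in tp k.+1 w) <-> exists u a v,
    w = u ++ a :: v /\ x = (tp k u, a, tp k v).
  rewrite inE; split=> [/mapP[[[u1 a] u2]]|[u1 [a [u2 [ew ->]]]]].
    by rewrite splitsP => /eqP ew ->; exists u1, a, u2.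
  by apply/mapP; exists (u1, a, u2); rewrite // splitsP ew.
split=> [h|[h1 h2]].
  split=> u1 a u2 e.
    have : (tp k u1, a, tp k u2) \in tp k.+1 v by rewrite -h; apply/mem; exists u1, a, u2.
    case/mem=> v1 [b [v2 [-> [/IH e1 -> /IH e2]]]].
    by exists v1, v2; split.
  have : (tp k u1, a, tp k u2) \in tp k.+1 u by rewrite h; apply/mem; exists u1, a, u2.
  case/mem=> v1 [b [v2 [-> [/IH e1 -> /IH e2]]]].
  by exists v1, v2; split=> //; apply: eqv_sym.
apply/setP=> x; apply/idP/idP => /mem [u1 [a [u2 [e ->]]]]; apply/mem.
  by have [v1 [v2 [-> /IH -> /IH ->]]] := h1 _ _ _ e; exists v1, a, v2.
by have [v1 [v2 [-> /IH <- /IH <-]]] := h2 _ _ _ e; exists v1, a, v2.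
Qed.

(** Classical decidability is enough here: it only selects finite sets, and membership in them
    reaches the programs as constants written into a table. *)
Definition dec (P : Prop) : bool := if excluded_middle_informative P then true else false.

Lemma decP (P : Prop) : reflect P (dec P).
Proof. by rewrite /dec; case: excluded_middle_informative => h; constructor. Qed.

(** A representative picked by choice. It is arbitrary on types that no word has, which is why the
    monoid consists of the [realized] types only. *)
Definition word_of k (t : wtype k) : seq A :=
  epsilon (inhabits [::]) (fun w => tp k w = t).

Lemma tp_word_of k w : tp k (word_of (tp k w)) = tp k w.
Proof.
by apply: (@epsilon_spec _ _ (fun v => tp k v = tp k w)); exists w.
Qed.

Definition tp_mul k (s t : wtype k) : wtype k := tp k (word_of s ++ word_of t).

Lemma tp_cat k u v : tp_mul (tp k u) (tp k v) = tp k (u ++ v).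
Proof.
by apply: (proj2 (tp_eqv _ _ _)); apply: eqv_cat;
  apply: (proj1 (tp_eqv _ _ _)); apply: tp_word_of.
Qed.

Definition realized k : {set wtype k} := [set t | dec (exists w, tp k w = t)].

Lemma realizedP k t : reflect (exists w, tp k w = t) (t \in realized k).
Proof. by rewrite inE; apply: decP. Qed.

(** All laws are inherited from concatenation through [tp_cat]. Powers of a type are types of word
    powers, so [eqv_wpow] with exponent [2 ^ k] yields aperiodicity. *)
Lemma tp_monoid k : aperiodic_monoid (realized k) (@tp_mul k) (tp k [::]).
Proof.
split.
- by apply/realizedP; exists [::].
- move=> _ _ /realizedP[u <-] /realizedP[v <-]; rewrite tp_cat.
  by apply/realizedP; exists (u ++ v).
- move=> _ _ _ /realizedP[u <-] /realizedP[v <-] /realizedP[w <-].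
  by rewrite !tp_cat catA.
- by move=> _ /realizedP[u <-]; rewrite tp_cat.
- by move=> _ /realizedP[u <-]; rewrite tp_cat cats0.
move=> _ /realizedP[u <-].
have it n : iter n (tp_mul (tp k u)) (tp k [::]) = tp k (wpow u n).
  by elim: n => //= n ->; rewrite tp_cat.
exists (2 ^ k); rewrite !it; apply/esym/tp_eqv/eqv_wpow; exact: leqnSn.
Qed.

End Types.

Lemma FO_recognized (A : finType) (L : seq A -> Prop) : FO_definable L ->
  exists (T : finType) (E : {set T}) (op : T -> T -> T) (e : T) (h : A -> T)
    (F : {set T}),
  [/\ aperiodic_monoid E op e, (forall a, h a \in E) &
      forall w, L w <-> foldr (fun a t => op (h a) t) e w \in F].
Proof.
case=> phi [phi0 hL]; pose k := fo_rank phi.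
exists (wtype A k), (realized A k), (@tp_mul A k), (tp k [::]), (fun a => tp k [:: a]).
exists [set t | dec (exists2 w, tp k w = t & L w)]; split.
- exact: tp_monoid.
- by move=> a; apply/realizedP; exists [:: a].
move=> w; rewrite inE.
have -> : foldr (fun a t => tp_mul (tp k [:: a]) t) (tp k [::]) w = tp k w.
  by elim: w => //= a w ->; rewrite tp_cat.
split=> [Lw|]; first by apply/decP; exists w.
case/decP=> v /tp_eqv e; rewrite !hL.
(* [size u] is no position of [u], so no letter is flagged and equivalence of the words lifts to the
   marked words. For a sentence the assignment may be exchanged freely. *)
pose N u := fun _ : nat => size u.
have mk u : mark u 0 (N A u) = map (fun b => (b, fun=> false)) u.
  have: forall i j, i + size u <= j -> mark u i (fun=> j) = map (fun b => (b, fun=> false)) u.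
    elim: u => //= b u IH i j h; rewrite IH; last by lia.
    by congr ((_, _) :: _); apply: functional_extensionality => _; apply/eqP; lia.
  by apply; lia.
rewrite (@fo_sat_free _ phi v _ (N A v)) ?(@fo_sat_free _ phi w _ (N A w)) ?phi0 //.
have [] // := @fo_eqv _ phi k v (N A v) w (N A w).
- by rewrite phi0.
- by rewrite phi0.
by rewrite !mk; apply: eqv_map.
Qed.

(** * Van Emde Boas trees *)

Definition upd2 (f : nat -> nat -> nat) b p v : nat -> nat -> nat :=
  fun b' p' => if (b' == b) && (p' == p) then v else f b' p'.

(** The widths are 0, 1, 2, 4, and so on. Integer halving goes down exactly one level, also from 1
    to 0, so the programs need only the width and stop when it is 0. *)
Definition width (j : nat) := if j is j'.+1 then 2 ^ j' else 0.

Lemma width_half j : 0 < j -> width j.+1 = width j + width j.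
Proof. by case: j => // j _; rewrite /= expnS mul2n addnn. Qed.

Lemma width_gt j : width j < width j.+1.
Proof.
by case: j => // j; rewrite /= expnS; have := expn_gt0 2 j; lia.
Qed.

Lemma width_pos j : 0 < j -> 0 < width j.
Proof. by case: j => // j _; rewrite /= expn_gt0. Qed.

Lemma div_width j X : X %/ 2 ^ width j.+2 = X %/ 2 ^ width j.+1 %/ 2 ^ width j.+1.
Proof. by rewrite width_half // expnD divnMA. Qed.

(* Addresses [(b', p')] belonging to the sub-tree rooted at the node [(b, p)]. *)
Definition subkey b p b' p' :=
  0 < b' /\ exists m, m + b' <= b /\ p' %/ 2 ^ m = p.

Section Rep.
Implicit Types (mn mx : nat -> nat -> nat) (S : nat -> Prop).

Definition interior S m M X := [/\ S X, X <> m & X <> M].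

(* The node [(b, p)] of bit width [b] represents a set of numbers with leading part [p], namely [X %/ 2 ^ b = p]. Its minimum and maximum (0 if it is empty, numbers being positive thanks to a leading bit 1) are removed from its sub-trees: the clusters are the nodes [(b/2, Y)], and the set of nonempty clusters is the node [(b/2, p)]. *)
Fixpoint Rep mn mx j p S : Prop :=
  if j is j'.+1 then
    let b := width j in let c := width j' in
    let I := interior S (mn b p) (mx b p) in
    [/\ forall X, S X -> X %/ 2 ^ b = p,
        [/\ mn b p = 0, mx b p = 0 & forall X, ~ S X] \/
        [/\ S (mn b p), S (mx b p) & forall X, S X -> mn b p <= X <= mx b p],
        Rep mn mx j' p (fun Y => exists2 X, I X & X %/ 2 ^ c = Y) &
        forall Y, Y %/ 2 ^ c = p -> Rep mn mx j' Y (fun X => I X /\ X %/ 2 ^ c = Y)]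
  else forall X, ~ S X.

Lemma Rep_ext mn mx j p S S' : (forall X, S X <-> S' X) ->
  Rep mn mx j p S -> Rep mn mx j p S'.
Proof.
elim: j p S S' => [|j IH] p S S' e /=; first by move=> h X /e; apply: h.
have eI X : interior S (mn (2 ^ j) p) (mx (2 ^ j) p) X <->
            interior S' (mn (2 ^ j) p) (mx (2 ^ j) p) X.
  by split=> -[/e].
case=> h1 h2 h3 h4; split.
- by move=> X /e; apply: h1.
- case: h2 => [[-> -> h2]|[a1 a2 a3]]; [left | right]; split=> //.
  + by move=> X /e; apply: h2.
  + exact/e.
  + exact/e.
  + by move=> X /e; apply: a3.
- by apply: IH h3 => Y; split=> -[X /eI hX <-]; exists X.
move=> Y /h4; apply: IH => X; split=> -[/eI hX <-]; by split.
Qed.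

Lemma subkey_sum j p b' p' : subkey (width j) p b' p' -> subkey (width j.+1) p b' p'.
Proof.
case=> h [m [hm e]]; split=> //; exists m; split=> //.
by apply: leq_trans hm _; apply/ltnW/width_gt.
Qed.

Lemma subkey_clu j p Y b' p' : 0 < j -> Y %/ 2 ^ width j = p ->
  subkey (width j) Y b' p' -> subkey (width j.+1) p b' p'.
Proof.
move=> j0 eY [h [m [hm e]]]; split=> //; exists (m + width j); split.
  by rewrite width_half //; lia.
by rewrite expnD divnMA e.
Qed.

Lemma subkey_top j p : 0 < j -> subkey (width j) p (width j) p.
Proof.
by move=> j0; split; [apply: width_pos | exists 0; rewrite add0n divn1].
Qed.

Lemma Rep_frame mn mx mn' mx' j p S :
  (forall b' p', subkey (width j) p b' p' -> mn' b' p' = mn b' p' /\ mx' b' p' = mx b' p') ->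
  Rep mn mx j p S -> Rep mn' mx' j p S.
Proof.
elim: j p S => // j IH p S e.
have [e1 e2] := e _ _ (@subkey_top j.+1 p isT).
move=> [h1 h2 h3 h4]; split=> //; rewrite ?e1 ?e2 //.
- by apply: IH h3 => b' p' /subkey_sum; apply: e.
- move=> Y hY; apply: IH (h4 Y hY) => b' p' h.
  case: j hY h {e1 e2 h1 h2 h3 h4} e => [|j] hY h e.
    by case: h => h [m []]; rewrite /=; lia.
  by apply: e; apply: subkey_clu h.
Qed.

Lemma subkey_le b p b' p' : subkey b p b' p' -> b' <= b.
Proof. by case=> _ [m [h _]]; lia. Qed.

(** Dropping further bits strictly decreases a positive number, so a positive prefix of [X]
    determines its own length. This is what keeps the sub-trees of a node at disjoint addresses
    although they share two tables. *)
Lemma lead_uniq m m' X : X %/ 2 ^ m = X %/ 2 ^ (m + m') -> 0 < X %/ 2 ^ m -> m' = 0.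
Proof.
rewrite expnD divnMA; set Y := X %/ _ => e h.
case: m' e => // m' e; have h2 : 1 < 2 ^ m'.+1 by rewrite -{1}(expn0 2) ltn_exp2l.
by have := ltn_Pdiv h2 h; rewrite -e ltnn.
Qed.

(** Seen from the summary, [p'] extends [p] by at most [width j - b'] bits; seen from a cluster, by
    at least [width j] bits. The number of bits is unique as [p] is positive, which contradicts
    [0 < b']. *)
Lemma subkey_sum_clu j p Y b' p' : 0 < j -> 0 < p -> Y %/ 2 ^ width j = p ->
  subkey (width j) p b' p' -> subkey (width j) Y b' p' -> False.
Proof.
move=> j0 p0 eY [b0 [m [hm e]]] [_ [m' [hm' e']]].
have e2 : p' %/ 2 ^ (m' + width j) = p by rewrite expnD divnMA e'.
have [h|h] := leqP m (m' + width j).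
  have ed := subnKC h; rewrite -ed -e in e2.
  have := lead_uniq (esym e2); rewrite e => /(_ p0); lia.
have ed := subnKC (ltnW h); rewrite -ed -e2 in e.
have := lead_uniq (esym e); rewrite e2 => /(_ p0); lia.
Qed.

(** The number of bits by which [p'] extends [p] is unique, hence so is its prefix of the length of
    [Y] and [Y']. *)
Lemma subkey_clu_clu j p Y Y' b' p' : 0 < p ->
  Y %/ 2 ^ width j = p -> Y' %/ 2 ^ width j = p ->
  subkey (width j) Y b' p' -> subkey (width j) Y' b' p' -> Y = Y'.
Proof.
move=> p0 eY eY' [b0 [m [hm e]]] [_ [m' [hm' e']]].
suff : m = m' by move=> em; rewrite -e -e' em.
have e1 : p' %/ 2 ^ (m + width j) = p by rewrite expnD divnMA e.
have e2 : p' %/ 2 ^ (m' + width j) = p by rewrite expnD divnMA e'.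
have aux m1 m2 : m1 <= m2 -> p' %/ 2 ^ m1 = p -> p' %/ 2 ^ m2 = p -> m1 = m2.
  move=> h a1 a2; have ed := subnKC h; rewrite -ed -a1 in a2.
  by have := lead_uniq (esym a2); rewrite a1 => /(_ p0) e0; rewrite -ed e0 addn0.
have [h|h] := leqP (m + width j) (m' + width j).
  exact: addIn (aux _ _ h e1 e2).
exact: esym (addIn (aux _ _ (ltnW h) e2 e1)).
Qed.

Lemma Rep_pos mn mx j p S X : 0 < p -> Rep mn mx j p S -> S X -> 0 < X.
Proof.
case: j => [|j] p0; first by move=> /= h /h.
case=> h _ _ _ /h e; case: X e => // e; move: p0; by rewrite -e div0n.
Qed.

Lemma Rep_empty mn mx j p S : 0 < p -> 0 < j -> Rep mn mx j p S ->
  mn (width j) p = 0 -> forall X, ~ S X.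
Proof.
case: j => // j p0 _ hR e; have := hR; case=> _ [[_ _ //]|[h _ _]] _ _.
by have := Rep_pos p0 hR h; rewrite e.
Qed.

Lemma Rep_nonempty mn mx j p S : 0 < j -> Rep mn mx j p S ->
  mn (width j) p != 0 -> [/\ S (mn (width j) p), S (mx (width j) p) &
    forall X, S X -> mn (width j) p <= X <= mx (width j) p].
Proof. by case: j => // j _ [_ [[-> //]|h]]. Qed.

Definition changed_in (K : nat -> nat -> Prop) (mn mx mn' mx' : nat -> nat -> nat) :=
  forall b p, (mn' b p = mn b p /\ mx' b p = mx b p) \/ K b p.

(** The part of [Rep] strictly below the root, for an arbitrary interior. Updates first rearrange
    the extrema at the root and then change the interior by one recursive call, so the two parts are
    treated apart. *)
Definition RepI mn mx j p (I : nat -> Prop) :=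
  Rep mn mx j p (fun Y => exists2 X, I X & X %/ 2 ^ width j = Y) /\
  forall Y, Y %/ 2 ^ width j = p -> Rep mn mx j Y (fun X => I X /\ X %/ 2 ^ width j = Y).

Lemma RepI_ext mn mx j p (I I' : nat -> Prop) : (forall X, I X <-> I' X) ->
  RepI mn mx j p I -> RepI mn mx j p I'.
Proof.
move=> e [h1 h2]; split.
  by apply: Rep_ext h1 => Y; split=> -[X /e hX <-]; exists X.
by move=> Y hY; apply: Rep_ext (h2 Y hY) => X; split=> -[/e hX <-].
Qed.

Lemma RepI_frame mn mx mn' mx' j p I :
  (forall b' p', b' <= width j -> mn' b' p' = mn b' p' /\ mx' b' p' = mx b' p') ->
  RepI mn mx j p I -> RepI mn' mx' j p I.
Proof.
move=> e [h1 h2]; split.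
  by apply: Rep_frame h1 => b' p' /subkey_le; apply: e.
by move=> Y hY; apply: Rep_frame (h2 Y hY) => b' p' /subkey_le; apply: e.
Qed.

Lemma RepS mn mx j p S (m := mn (width j.+1) p) (M := mx (width j.+1) p) :
  Rep mn mx j.+1 p S <->
  [/\ forall X, S X -> X %/ 2 ^ width j.+1 = p,
      [/\ m = 0, M = 0 & forall X, ~ S X] \/
      [/\ S m, S M & forall X, S X -> m <= X <= M] &
      RepI mn mx j p (interior S m M)].
Proof. by split=> [[h1 h2 h3 h4]|[h1 h2 [h3 h4]]]. Qed.

Lemma Rep_single mn mx j p X : 0 < p -> X %/ 2 ^ width j.+1 = p ->
  Rep mn mx j.+1 p (fun _ => False) ->
  Rep (upd2 mn (width j.+1) p X) (upd2 mx (width j.+1) p X) j.+1 p (eq X).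
Proof.
move=> p0 hX /RepS[_ _ hI]; apply/RepS; rewrite /upd2 !eqxx /=; split.
- by move=> _ <-.
- by right; split=> // _ <-; rewrite leqnn.
apply: RepI_frame (RepI_ext _ hI); last first.
  by move=> Z; split=> [[]|[<- /(_ erefl)]].
by move=> b' p' /leq_ltn_trans/(_ (width_gt j)); case: eqP => // ->; rewrite ltnn.
Qed.

Lemma Rep_clear mn mx j p X : 0 < p ->
  Rep mn mx j.+1 p (eq X) ->
  Rep (upd2 mn (width j.+1) p 0) (upd2 mx (width j.+1) p 0) j.+1 p (fun _ => False).
Proof.
move=> p0 /RepS[_ hm hI]; apply/RepS; rewrite /upd2 !eqxx /=; split; first by [].
  by left; split=> // X0.
apply: RepI_frame (RepI_ext _ hI); last first.
  move=> Z; split=> [[eX h1 h2]|[] //]; case: hm => [[_ _ /(_ X)]|[e1 e2 _]] //.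
  by case: h1; rewrite -e1.
by move=> b' p' /leq_ltn_trans/(_ (width_gt j)); case: eqP => // ->; rewrite ltnn.
Qed.

(* There is a single recursive call: inserting into an empty cluster takes constant time, so the recursion then goes into the summary. *)
Fixpoint vins j p X (mn mx : nat -> nat -> nat) :=
  if j is j'.+1 then
    let b := width j in let c := width j' in
    let go X mn mx :=
      let Y := X %/ 2 ^ c in
      if mn c Y == 0 then vins j' p Y (upd2 mn c Y X) (upd2 mx c Y X)
      else vins j' Y X mn mx in
    if mn b p == 0 then (upd2 mn b p X, upd2 mx b p X)
    else if mn b p == mx b p then
      if X < mn b p then (upd2 mn b p X, mx) else (mn, upd2 mx b p X)
    else if X < mn b p then go (mn b p) (upd2 mn b p X) mx
    else if mx b p < X then go (mx b p) mn (upd2 mx b p X)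
    else go X mn mx
  else (mn, mx).

Definition vins_ok j := forall p X mn mx S, 0 < p -> Rep mn mx j p S ->
  X %/ 2 ^ width j = p -> ~ S X ->
  let r := vins j p X mn mx in
  Rep r.1 r.2 j p (fun Z => S Z \/ Z = X) /\
  changed_in (subkey (width j) p) mn mx r.1 r.2.

Definition below j p b' p' := b' <= width j /\ subkey (width j.+1) p b' p'.

(** The content is a frame argument. The recursive call writes inside one sub-tree, summary or
    cluster, and the sub-trees are disjoint, so the others keep their invariant. If the cluster
    already had a member, the summary is correct as it stands. *)
Lemma vins_go j p X mn mx I : 0 < j -> vins_ok j -> 0 < p -> RepI mn mx j p I ->
  X %/ 2 ^ width j.+1 = p -> ~ I X ->
  let Y := X %/ 2 ^ width j in
  let r := if mn (width j) Y == 0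
    then vins j p Y (upd2 mn (width j) Y X) (upd2 mx (width j) Y X)
    else vins j Y X mn mx in
  RepI r.1 r.2 j p (fun Z => I Z \/ Z = X) /\ changed_in (below j p) mn mx r.1 r.2.
Proof.
move=> j0 IH p0 [hs hc] eX nX Y.
have eY : Y %/ 2 ^ width j = p.
  by rewrite /Y -eX; case: j j0 {IH hs hc Y eX} => // j _; rewrite div_width.
have Y0 : 0 < Y by case: Y eY p0 => // <-; rewrite div0n.
have hcY := hc _ eY.
case: eqP => [e0|/eqP e0].
  have emp := Rep_empty Y0 j0 hcY e0.
  case: j j0 IH hs hc eX @Y eY Y0 hcY e0 emp => // j _ IH hs hc eX Y eY Y0 hcY e0 emp.
  set mn1 := upd2 mn _ Y X; set mx1 := upd2 mx _ Y X.
  have ag b' p' : (b' == width j.+1) && (p' == Y) = false ->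
      mn1 b' p' = mn b' p' /\ mx1 b' p' = mx b' p'.
    by rewrite /mn1 /mx1 /upd2 => ->.
  have hs1 : Rep mn1 mx1 j.+1 p (fun Y0 => exists2 X0, I X0 & X0 %/ 2 ^ width j.+1 = Y0).
    apply: Rep_frame hs => b' p' hb; apply: ag; apply/negbTE/andP => -[/eqP eb /eqP ep].
    by case: (subkey_sum_clu _ p0 eY hb) => //; rewrite eb ep; apply: subkey_top.
  have [|h1 h2] := IH p Y mn1 mx1 _ p0 hs1 eY.
    by case=> Z IZ eZ; apply: (emp Z).
  set r := vins _ _ _ _ _ in h1 h2 *; split; first split.
  - apply: Rep_ext h1 => W; split=> [[[Z IZ <-]|->]|[Z [IZ|->] <-]].
    + by exists Z => //; left.
    + by exists X => //; right.
    + by left; exists Z.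
    + by right.
  - move=> Y' eY'.
    have fr q : q %/ 2 ^ width j.+1 = p -> forall b' p', subkey (width j.+1) q b' p' ->
        r.1 b' p' = mn1 b' p' /\ r.2 b' p' = mx1 b' p'.
      move=> eq b' p' hb; case: (h2 b' p') => // hb'.
      by case: (subkey_sum_clu _ p0 eq hb' hb).
    apply: Rep_frame (fr _ eY') _.
    have [eYY|neY] := eqVneq Y' Y.
      rewrite eYY; apply: Rep_ext (Rep_single Y0 _ (Rep_ext _ hcY)) => //.
        by move=> Z; split=> [<-|[[IZ|->] eZ]] //; [split=> //; right | case: (emp Z)].
      by move=> Z; split=> // /emp.
    have := hc _ eY'; move/Rep_ext; move/(_ (fun Z => (I Z \/ Z = X) /\ Z %/ 2 ^ width j.+1 = Y')).
    move=> hR; apply: Rep_frame (hR _).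
      move=> b' p' hb; apply: ag; apply/negbTE/andP => -[/eqP eb /eqP ep].
      case/eqP: neY; apply: (subkey_clu_clu p0 eY' eY hb).
      by rewrite eb ep; apply: subkey_top.
    move=> Z; split=> [[IZ eZ]|[[IZ|-> eZ]]] //; first by split=> //; left.
    by case/eqP: neY; rewrite -eZ.
  move=> b' p'; case: (h2 b' p') => [[-> ->]|h]; last first.
    by right; split; [apply: subkey_le h | apply: subkey_sum h].
  case hb: ((b' == width j.+1) && (p' == Y)); last by left; apply: ag.
  case/andP: hb => /eqP -> /eqP ->; right; split=> //.
  by apply: subkey_clu eY _ => //; apply: subkey_top.
have [a1 a2 a3] := Rep_nonempty j0 hcY e0.
have [|h1 h2] := IH Y X mn mx _ Y0 hcY erefl; first by case.
set r := vins _ _ _ _ _ in h1 h2 *; split; first split.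
- apply: (@Rep_frame mn mx).
    move=> b' p' hb; case: (h2 b' p') => // hb'.
    by case: (subkey_sum_clu j0 p0 eY hb hb').
  apply: Rep_ext hs => W; split=> [[Z IZ <-]|[Z [IZ|->] <-]].
  + by exists Z => //; left.
  + by exists Z.
  + by case: a1 => IZ eZ; exists (mn (width j) Y).
- move=> Y' eY'; have [eYY|neY] := eqVneq Y' Y.
    rewrite eYY; apply: Rep_ext h1 => Z; split=> [[[IZ eZ]|->]|[[IZ|->] eZ]].
    + by split=> //; left.
    + by split=> //; right.
    + by left.
    + by right.
  apply: (@Rep_frame mn mx).
    move=> b' p' hb; case: (h2 b' p') => // hb'.
    by case/eqP: neY; apply: (subkey_clu_clu p0 eY' eY hb hb').
  apply: Rep_ext (hc _ eY') => Z; split=> [[IZ eZ]|[[IZ|-> eZ]]] //; first by split=> //; left.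
  by case/eqP: neY; rewrite -eZ.
move=> b' p'; case: (h2 b' p') => [|h]; [by left | right].
by split; [apply: subkey_le h | apply: subkey_clu eY h].
Qed.

End Rep.

Lemma below_top j p b' p' : below j p b' p' -> (b' == width j.+1) = false.
Proof. by case=> h _; have := width_gt j; case: eqP => //; lia. Qed.

Lemma changed_top j p mn mx mn' mx' q : changed_in (below j p) mn mx mn' mx' ->
  mn' (width j.+1) q = mn (width j.+1) q /\ mx' (width j.+1) q = mx (width j.+1) q.
Proof. by move/(_ (width j.+1) q) => [] // /below_top; rewrite eqxx. Qed.

Lemma width_pair b p q Z : b = 1 -> p %/ 2 ^ b = Z -> q %/ 2 ^ b = Z -> p < q -> q = p.+1 /\ ~~ odd p.
Proof.
move=> ->; rewrite expn1 !divn2 => e1 e2 h.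
have := odd_double_half p; have := odd_double_half q; rewrite e1 e2 -addnn.
by case: (odd p); case: (odd q) => //=; lia.
Qed.

(** A node of width 1 has room for two numbers only, so both are extrema and its interior is empty.
    Hence no recursion below level 1 ever takes place. *)
Lemma level1_two p S m M X : (forall X, S X -> X %/ 2 ^ width 1 = p) -> S m -> S M ->
  m < M -> X %/ 2 ^ width 1 = p -> X = m \/ X = M.
Proof.
move=> h /h em /h eM hm eX; have [e _] := width_pair erefl em eM hm.
move: em eM eX; rewrite /= expn1 !divn2.
have := odd_double_half X; have := odd_double_half m; have := odd_double_half M.
rewrite -!addnn; case: (odd X); case: (odd m); case: (odd M) => /=; lia.
Qed.

Lemma RepI_upd_root (mn mx mn' mx' : nat -> nat -> nat) j q I :
  (forall b' p' : nat, b' != width j.+1 -> mn' b' p' = mn b' p' /\ mx' b' p' = mx b' p') ->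
  RepI mn mx j q I -> RepI mn' mx' j q I.
Proof.
move=> e; apply: RepI_frame => b' p' h; apply: e.
by have := width_gt j; case: eqP => //; lia.
Qed.

Lemma upd2_root f b p v b' p' : b' != b -> upd2 f b p v b' p' = f b' p'.
Proof. by rewrite /upd2 => /negbTE ->. Qed.

Lemma upd2_at f b p v : upd2 f b p v b p = v.
Proof. by rewrite /upd2 !eqxx. Qed.

Lemma vinsP j : 0 < j -> vins_ok j.
Proof.
elim: j => // j IH _ p X mn mx S p0 hR eX nX.
have [h1 h2 hI] := (RepS _ _ _ _ _).1 hR.
set b := width j.+1 in h1 h2 hI *; set m := mn b p in h2 hI *; set M := mx b p in h2 hI *.
have chroot f g u v : changed_in (subkey b p) f g (if u is Some u then upd2 f b p u else f)
    (if v is Some v then upd2 g b p v else g).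
  move=> b' p'; case e: ((b' == b) && (p' == p)).
    by case/andP: e => /eqP -> /eqP ->; right; apply: (@subkey_top j.+1).
  by left; case: u v => [u|] [v|]; rewrite /upd2 ?e.
rewrite /vins_ok /= -/(width j.+1) -/b -/m -/M.
case: eqP => [e0|n0].
  have emp := (Rep_empty p0 (ltn0Sn j) hR e0).
  split; last exact: (chroot _ _ (Some X) (Some X)).
  apply: Rep_ext (Rep_single p0 eX _) => [Z|]; last first.
    by apply: Rep_ext hR => Z; split=> // /emp.
  by split=> [->|[/emp|]]; [right | |].
have {h2} [Sm SM hS] : [/\ S m, S M & forall X, S X -> m <= X <= M].
  by case: h2 => [[]|].
have Xm : X <> m by move=> e; apply: nX; rewrite e.
have XM : X <> M by move=> e; apply: nX; rewrite e.
case: eqP => [emM|nmM].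
  have one Z : S Z -> Z = m by move/hS; lia.
  case: ltnP => hX.
    split; last exact: (chroot _ _ (Some X) None).
    apply/RepS; cbn [fst snd]; rewrite -/b ?upd2_at -/M; split.
    + by move=> Z [/h1|->].
    + right; split; [by right | by left | move=> Z [/one ->|->]; lia].
    apply: (@RepI_upd_root mn mx) => [b' p' hb|].
      by rewrite upd2_root.
    apply: RepI_ext hI => Z; split=> [[SZ Zm ZM]|[[SZ|->] ZX ZM]] //.
      by have := one _ SZ.
    by case: ZM; rewrite -emM; apply: one.
  split; last exact: (chroot _ _ None (Some X)).
  apply/RepS; cbn [fst snd]; rewrite -/b ?upd2_at -/m; split.
  + by move=> Z [/h1|->].
  + by right; split; [left | right | move=> Z [/one ->|->]; lia].
  apply: (@RepI_upd_root mn mx) => [b' p' hb|].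
    by rewrite upd2_root.
  apply: RepI_ext hI => Z; split=> [[SZ Zm ZM]|[[SZ|->] ZX ZM]] //.
    by have := one _ SZ.
  by have := one _ SZ.
have ltmM : m < M by have := hS _ SM; lia.
have j0 : 0 < j.
  by case: j @b @m @M {IH hR} h1 eX ltmM Sm SM Xm XM {chroot hI hS n0 nmM} => // b m M h1 eX h Sm SM Xm XM;
    case: (level1_two h1 Sm SM h eX).
(* The remaining cases differ only in the number [X'] that is passed down, either [X] or an extremum
   displaced by it; [f] and [g] are the tables after the root has been rewritten. *)
have gen X' f g : RepI f g j p (interior S m M) -> X' %/ 2 ^ b = p ->
    ~ interior S m M X' ->
    (f b p <= X' <= g b p) -> X' != f b p -> X' != g b p ->
    (forall Z, S Z \/ Z = X <-> [\/ interior S m M Z, Z = X', Z = f b p | Z = g b p]) ->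
    (forall Z, interior S m M Z -> f b p < Z < g b p) ->
    changed_in (subkey b p) mn mx f g ->
    let r := if f (width j) (X' %/ 2 ^ width j) == 0 then
      vins j p (X' %/ 2 ^ width j) (upd2 f (width j) (X' %/ 2 ^ width j) X')
         (upd2 g (width j) (X' %/ 2 ^ width j) X') else
      vins j (X' %/ 2 ^ width j) X' f g in
    Rep r.1 r.2 j.+1 p (fun Z => S Z \/ Z = X) /\ changed_in (subkey b p) mn mx r.1 r.2.
  move=> hI' eX' nI' bX' nf ng hS' hIb hch.
  have [k1 k2] := vins_go j0 (IH j0) p0 hI' eX' nI'.
  set r := if _ then _ else _ in k1 k2 *; move=> r'; rewrite {}/r'.
  split; last first.
    move=> b' p'; case: (hch b' p') => [[<- <-]|]; last by right.
    by case: (k2 b' p') => [|[]]; [left | right].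
  have [e1 e2] := changed_top p k2.
  apply/RepS; rewrite -/b e1 e2; split.
  - by move=> Z [/h1|->].
  - right; split.
    + by apply/hS'; constructor 3.
    + by apply/hS'; constructor 4.
    + case/andP: (bX') => b1 b2 Z /hS' [/hIb/andP[c1 c2]|->|->|->].
      * by rewrite (ltnW c1) (ltnW c2).
      * by rewrite b1 b2.
      * by rewrite leqnn (leq_trans b1 b2).
      * by rewrite leqnn (leq_trans b1 b2).
  apply: RepI_ext k1 => Z; split=> [[IZ|->]|[/hS' [IZ|->|//|//] ? ?]].
  - case/andP: (hIb _ IZ) => c1 c2; split; first by apply/hS'; constructor 1.
      by move=> eZ; rewrite eZ ltnn in c1.
    by move=> eZ; rewrite eZ ltnn in c2.
  - by split; [apply/hS'; constructor 2 | apply/eqP | apply/eqP].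
  - by left.
  - by right.
have Ib Z : interior S m M Z -> m < Z < M by case=> /hS; lia.
have Sdec Z : S Z -> [\/ interior S m M Z, Z = m | Z = M].
  move=> SZ; have [->|/eqP] := eqVneq Z m; first by constructor 2.
  by have [->|/eqP] := eqVneq Z M; [constructor 3 | constructor 1].
case: ltnP => hX.
  apply: gen; rewrite ?upd2_at -/M.
  - by apply: (@RepI_upd_root mn mx) => // b' p' hb; rewrite upd2_root.
  - exact: h1.
  - by case.
  - lia.
  - lia.
  - by apply/eqP.
  - move=> Z; split=> [[/Sdec|->]|]; last 2 first.
    + by constructor 3.
    + by case=> [[]|->|->|->]; [left | left | right | left].
    + by case=> [||]; [constructor 1 | constructor 2 | constructor 4].
  - by move=> Z /Ib; lia.
  - exact: (chroot _ _ (Some X) None).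
case: ltnP => hX2.
  apply: gen; rewrite ?upd2_at -/m.
  - by apply: (@RepI_upd_root mn mx) => // b' p' hb; rewrite upd2_root.
  - exact: h1.
  - by case.
  - lia.
  - lia.
  - lia.
  - move=> Z; split=> [[/Sdec|->]|]; last 2 first.
    + by constructor 4.
    + by case=> [[]|->|->|->]; [left | left | left | right].
    + by case=> [||]; [constructor 1 | constructor 3 | constructor 2].
  - by move=> Z /Ib; lia.
  - exact: (chroot _ _ None (Some X)).
apply: gen; rewrite -/m -/M //.
- by case.
- lia.
- by apply/eqP.
- by apply/eqP.
- move=> Z; split=> [[/Sdec|->]|]; last 2 first.
  + by constructor 2.
  + by case=> [[]|->|->|->]; [left | right | left | left].
  + by case=> [||]; [constructor 1 | constructor 3 | constructor 4].
- exact: (chroot _ _ None None).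
Qed.

(* Only a cluster that becomes empty, which takes constant time, requires a deletion from the summary. *)
Fixpoint vdel j p X (mn mx : nat -> nat -> nat) :=
  if j is j'.+1 then
    let b := width j in let c := width j' in
    let go X mn mx :=
      let Y := X %/ 2 ^ c in
      if mn c Y == mx c Y then vdel j' p Y (upd2 mn c Y 0) (upd2 mx c Y 0)
      else vdel j' Y X mn mx in
    if mn b p == mx b p then (upd2 mn b p 0, upd2 mx b p 0)
    else if X == mn b p then
      if mn c p == 0 then (upd2 mn b p (mx b p), mx)
      else let X' := mn c (mn c p) in go X' (upd2 mn b p X') mx
    else if X == mx b p then
      if mn c p == 0 then (mn, upd2 mx b p (mn b p))
      else let X' := mx c (mx c p) in go X' mn (upd2 mx b p X')
    else go X mn mx
  else (mn, mx).

(** The condition on width 0 serves level 1: the summary of a node of width 1 has width 0, and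
    reading 0 there must signal that it is empty. *)
Definition vdel_ok j := forall p X mn mx S, 0 < p -> (forall q, mn 0 q = 0) -> Rep mn mx j p S -> S X ->
  let r := vdel j p X mn mx in
  Rep r.1 r.2 j p (fun Z => S Z /\ Z <> X) /\
  changed_in (subkey (width j) p) mn mx r.1 r.2.

Lemma vdel_go j p X mn mx I : 0 < j -> vdel_ok j -> 0 < p ->
  (forall q, mn 0 q = 0) -> RepI mn mx j p I ->
  X %/ 2 ^ width j.+1 = p -> I X ->
  let Y := X %/ 2 ^ width j in
  let r := if mn (width j) Y == mx (width j) Y
    then vdel j p Y (upd2 mn (width j) Y 0) (upd2 mx (width j) Y 0)
    else vdel j Y X mn mx in
  RepI r.1 r.2 j p (fun Z => I Z /\ Z <> X) /\ changed_in (below j p) mn mx r.1 r.2.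
Proof.
move=> j0 IH p0 hz [hs hc] eX IX Y.
have eY : Y %/ 2 ^ width j = p.
  by rewrite /Y -eX; case: j j0 {IH hs hc Y eX} => // j _; rewrite div_width.
have Y0 : 0 < Y by case: Y eY p0 => // <-; rewrite div0n.
have hcY := hc _ eY.
have [a1 a2 a3] : [/\ I (mn (width j) Y) /\ mn (width j) Y %/ 2 ^ width j = Y,
   I (mx (width j) Y) /\ mx (width j) Y %/ 2 ^ width j = Y &
   forall X, I X /\ X %/ 2 ^ width j = Y -> mn (width j) Y <= X <= mx (width j) Y].
  apply: (Rep_nonempty j0 hcY); apply/eqP => e0.
  exact: (Rep_empty Y0 j0 hcY e0 (conj IX (erefl Y))).
case: eqP => [e0|/eqP n0].
  have one Z : I Z -> Z %/ 2 ^ width j = Y -> Z = X.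
    move=> IZ eZ; have := a3 _ (conj IZ eZ); have := a3 _ (conj IX (erefl Y)).
    by rewrite -e0 -!eqn_leq => /eqP <- /eqP <-.
  case: j j0 IH hs hc eX @Y eY Y0 hcY e0 one a1 a2 a3 => // j _ IH hs hc eX Y eY Y0 hcY e0 one a1 a2 a3.
  set mn1 := upd2 mn _ Y 0; set mx1 := upd2 mx _ Y 0.
  have ag b' p' : (b' == width j.+1) && (p' == Y) = false ->
      mn1 b' p' = mn b' p' /\ mx1 b' p' = mx b' p'.
    by rewrite /mn1 /mx1 /upd2 => ->.
  have hs1 : Rep mn1 mx1 j.+1 p (fun Y0 => exists2 X0, I X0 & X0 %/ 2 ^ width j.+1 = Y0).
    apply: Rep_frame hs => b' p' hb; apply: ag; apply/negbTE/andP => -[/eqP eb /eqP ep].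
    by case: (subkey_sum_clu _ p0 eY hb) => //; rewrite eb ep; apply: subkey_top.
  have hz1 q : mn1 0 q = 0.
    by rewrite /mn1 /upd2; case: ifP.
  have [|h1 h2] := IH p Y mn1 mx1 _ p0 hz1 hs1; first by exists X.
  set r := vdel _ _ _ _ _ in h1 h2 *; split; first split.
  - apply: Rep_ext h1 => W; split=> [[[Z IZ <-] nY]|[Z [IZ nZ] <-]].
    + by exists Z => //; split=> // eZ; apply: nY; rewrite eZ.
    + by split; [exists Z | move=> eZ; apply: nZ; apply: one].
  - move=> Y' eY'.
    have fr q : q %/ 2 ^ width j.+1 = p -> forall b' p', subkey (width j.+1) q b' p' ->
        r.1 b' p' = mn1 b' p' /\ r.2 b' p' = mx1 b' p'.
      move=> eq b' p' hb; case: (h2 b' p') => // hb'.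
      by case: (subkey_sum_clu _ p0 eq hb' hb).
    apply: Rep_frame (fr _ eY') _.
    have [eYY|neY] := eqVneq Y' Y.
      rewrite eYY; have hR : Rep mn mx j.+1 Y (eq X).
        by apply: Rep_ext hcY => Z; split=> [[IZ eZ]|<-] //; rewrite (one _ IZ eZ).
      apply: Rep_ext (Rep_clear Y0 hR) => Z.
      by split=> // -[[IZ nZ] eZ]; apply: nZ; apply: one.
    apply: (@Rep_frame mn mx).
      move=> b' p' hb; apply: ag; apply/negbTE/andP => -[/eqP eb /eqP ep].
      case/eqP: neY; apply: (subkey_clu_clu p0 eY' eY hb).
      by rewrite eb ep; apply: subkey_top.
    apply: Rep_ext (hc _ eY') => Z; split=> [[IZ eZ]|[[IZ _] eZ]] //.
    by split=> //; split=> // eZX; case/eqP: neY; rewrite -eZ eZX.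
  move=> b' p'; case: (h2 b' p') => [[-> ->]|h]; last first.
    by right; split; [apply: subkey_le h | apply: subkey_sum h].
  case hb: ((b' == width j.+1) && (p' == Y)); last by left; apply: ag.
  case/andP: hb => /eqP -> /eqP ->; right; split=> //.
  by apply: subkey_clu eY _ => //; apply: subkey_top.
have [h1 h2] := IH Y X mn mx _ Y0 hz hcY (conj IX erefl).
set r := vdel _ _ _ _ _ in h1 h2 *; split; first split.
- apply: (@Rep_frame mn mx).
    move=> b' p' hb; case: (h2 b' p') => // hb'.
    by case: (subkey_sum_clu j0 p0 eY hb hb').
  apply: Rep_ext hs => W; split=> [[Z IZ <-]|[Z [IZ _] <-]]; last by exists Z.
  (* The cluster of [X] has two distinct extrema, so one of them differs from [X] and witnesses that
     [Y] stays in the summary. *)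
  have [eZX|nZX] := eqVneq Z X; last by exists Z => //; split=> //; apply/eqP.
  have [em|/eqP nm] := eqVneq (mn (width j) Y) X; last first.
    by case: a1 => b1 b2; exists (mn (width j) Y); rewrite ?eZX.
  case: a2 => b1 b2; exists (mx (width j) Y); rewrite ?eZX //; split=> //.
  by move=> e; case/eqP: n0; rewrite em e.
- move=> Y' eY'; have [eYY|neY] := eqVneq Y' Y.
    rewrite eYY; apply: Rep_ext h1 => Z; by split=> [[[IZ eZ] nZ]|[[IZ nZ] eZ]].
  apply: (@Rep_frame mn mx).
    move=> b' p' hb; case: (h2 b' p') => // hb'.
    by case/eqP: neY; apply: (subkey_clu_clu p0 eY' eY hb hb').
  apply: Rep_ext (hc _ eY') => Z; split=> [[IZ eZ]|[[IZ _] eZ]] //.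
  by split=> //; split=> // eZX; case/eqP: neY; rewrite -eZ eZX.
move=> b' p'; case: (h2 b' p') => [|h]; [by left | right].
by split; [apply: subkey_le h | apply: subkey_clu eY h].
Qed.

(* The interior is empty exactly when the summary is; its extrema are found through those of the summary. *)
Lemma RepI_min mn mx j p I : 0 < j -> 0 < p -> RepI mn mx j p I ->
  (forall X, I X -> X %/ 2 ^ width j %/ 2 ^ width j = p) ->
  if mn (width j) p == 0 then forall X, ~ I X else
  let X := mn (width j) (mn (width j) p) in
  I X /\ forall Z, I Z -> X <= Z.
Proof.
move=> j0 p0 [hs hc] hp; case: eqP => [e0 X IX|/eqP n0].
  by apply: (Rep_empty p0 j0 hs e0); exists X.
have [[Z0 IZ0 eZ0] _ a3] := Rep_nonempty j0 hs n0.
set q := mn (width j) p in n0 eZ0 a3 *.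
have eq : q %/ 2 ^ width j = p by rewrite -eZ0; apply: hp.
have q0 : 0 < q by rewrite lt0n.
have hcq := hc _ eq.
have [[b1 b2] _ b3] : [/\ I (mn (width j) q) /\ mn (width j) q %/ 2 ^ width j = q,
   I (mx (width j) q) /\ mx (width j) q %/ 2 ^ width j = q &
   forall X, I X /\ X %/ 2 ^ width j = q -> mn (width j) q <= X <= mx (width j) q].
  apply: (Rep_nonempty j0 hcq); apply/eqP => e0.
  exact: (Rep_empty q0 j0 hcq e0 (conj IZ0 eZ0)).
split=> // Z IZ.
have /andP[] : q <= Z %/ 2 ^ width j <= mx (width j) p by apply: a3; exists Z.
rewrite leq_eqVlt => /orP[/eqP eZ _|hlt _].
  by case/andP: (b3 Z (conj IZ (esym eZ))).
rewrite leqNgt; apply/negP => hgt; move: hlt.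
by rewrite ltnNge -b2 leq_div2r // ltnW.
Qed.

Lemma RepI_max mn mx j p I : 0 < j -> 0 < p -> RepI mn mx j p I ->
  (forall X, I X -> X %/ 2 ^ width j %/ 2 ^ width j = p) ->
  mn (width j) p != 0 ->
  let X := mx (width j) (mx (width j) p) in
  I X /\ forall Z, I Z -> Z <= X.
Proof.
move=> j0 p0 [hs hc] hp n0.
have [_ [Z0 IZ0 eZ0] a3] := Rep_nonempty j0 hs n0.
set q := mx (width j) p in eZ0 a3 *.
have eq : q %/ 2 ^ width j = p by rewrite -eZ0; apply: hp.
have q0 : 0 < q by case: q eq {eZ0 a3} p0 => // <-; rewrite div0n.
have hcq := hc _ eq.
have [_ [b1 b2] b3] : [/\ I (mn (width j) q) /\ mn (width j) q %/ 2 ^ width j = q,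
   I (mx (width j) q) /\ mx (width j) q %/ 2 ^ width j = q &
   forall X, I X /\ X %/ 2 ^ width j = q -> mn (width j) q <= X <= mx (width j) q].
  apply: (Rep_nonempty j0 hcq); apply/eqP => e0.
  exact: (Rep_empty q0 j0 hcq e0 (conj IZ0 eZ0)).
split=> // Z IZ.
have /andP[_] : mn (width j) p <= Z %/ 2 ^ width j <= q by apply: a3; exists Z.
rewrite leq_eqVlt => /orP[/eqP eZ|hlt].
  by case/andP: (b3 Z (conj IZ eZ)).
rewrite leqNgt; apply/negP => hgt; move: hlt.
by rewrite ltnNge -b2 leq_div2r // ltnW.
Qed.

Lemma vdelP j : vdel_ok j.
Proof.
elim: j => [|j IH] p X mn mx S p0 hz hR SX; first by case: (hR X).
have [h1 h2 hI] := (RepS _ _ _ _ _).1 hR.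
set b := width j.+1 in h1 h2 hI *; set m := mn b p in h2 hI *; set M := mx b p in h2 hI *.
have chroot f g u v : changed_in (subkey b p) f g (if u is Some u then upd2 f b p u else f)
    (if v is Some v then upd2 g b p v else g).
  move=> b' p'; case e: ((b' == b) && (p' == p)).
    by case/andP: e => /eqP -> /eqP ->; right; apply: (@subkey_top j.+1).
  by left; case: u v => [u|] [v|]; rewrite /upd2 ?e.
rewrite /= -/(width j.+1) -/b -/m -/M.
have {h2} [Sm SM hS] : [/\ S m, S M & forall X, S X -> m <= X <= M].
  by case: h2 => [[_ _ /(_ X)]|].
have b0 : b != 0 by rewrite -lt0n; apply: width_pos.
case: eqP => [emM|nmM].
  have one Z : S Z -> Z = m.
    by move/hS; rewrite -emM -eqn_leq => /eqP.
  split; last exact: (chroot _ _ (Some 0) (Some 0)).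
  apply/RepS; cbn [fst snd]; rewrite -/b !upd2_at; split.
  - by move=> Z [/h1].
  - left; split=> // Z [/one -> nX]; apply: nX; apply/esym; exact: one.
  apply: (@RepI_upd_root mn mx) => [b' p' hb|]; first by rewrite !upd2_root.
  apply: RepI_ext hI => Z; split=> [[/one -> //]|[[SZ nX] _ _]].
  by case: nX; rewrite (one _ SZ) (one _ SX).
have ltmM : m < M by rewrite ltn_neqAle; case/andP: (hS _ SM) => -> _; rewrite andbT; apply/eqP.
have three Z : interior S m M Z -> 0 < j.
  case: j @b @m @M {IH hR b0} h1 ltmM Sm SM {chroot hI hS nmM} => // b m M h1 hlt Sm SM [SZ Zm ZM].
  by case: (level1_two h1 Sm SM hlt (h1 _ SZ)).
have hp Z : 0 < j -> interior S m M Z -> Z %/ 2 ^ width j %/ 2 ^ width j = p.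
  by move=> j0 [/h1 <- _ _]; rewrite /b; case: (j) j0 => // j' _; rewrite div_width.
have Ib Z : interior S m M Z -> m < Z < M.
  case=> /hS/andP[z1 z2] /eqP z3 /eqP z4.
  by rewrite !ltn_neqAle z1 z2 (eq_sym m) z3 z4.
have Sdec Z : S Z -> [\/ interior S m M Z, Z = m | Z = M].
  move=> SZ; have [->|/eqP] := eqVneq Z m; first by constructor 2.
  by have [->|/eqP] := eqVneq Z M; [constructor 3 | constructor 1].
(* When an extremum is deleted, its neighbour [X'] in the interior replaces it at the root, and it
   is [X'] that is deleted below; otherwise [X'] is [X] itself. *)
have gen X' f g : 0 < j -> RepI f g j p (interior S m M) -> interior S m M X' ->
    (forall q, f 0 q = 0) ->
    (forall Z, S Z /\ Z <> X <-> [\/ interior S m M Z /\ Z <> X', Z = f b p | Z = g b p]) ->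
    (forall Z, interior S m M Z /\ Z <> X' -> f b p < Z < g b p) ->
    f b p <= g b p ->
    changed_in (subkey b p) mn mx f g ->
    let r := if f (width j) (X' %/ 2 ^ width j) == g (width j) (X' %/ 2 ^ width j) then
      vdel j p (X' %/ 2 ^ width j) (upd2 f (width j) (X' %/ 2 ^ width j) 0)
         (upd2 g (width j) (X' %/ 2 ^ width j) 0) else
      vdel j (X' %/ 2 ^ width j) X' f g in
    Rep r.1 r.2 j.+1 p (fun Z => S Z /\ Z <> X) /\ changed_in (subkey b p) mn mx r.1 r.2.
  move=> j0 hI' IX' hz' hS' hIb hfg hch.
  have eX' : X' %/ 2 ^ b = p by case: IX' => /h1.
  have [k1 k2] := vdel_go j0 IH p0 hz' hI' eX' IX'.
  set r := if _ then _ else _ in k1 k2 *; move=> r'; rewrite {}/r'.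
  split; last first.
    move=> b' p'; case: (hch b' p') => [[<- <-]|]; last by right.
    by case: (k2 b' p') => [|[]]; [left | right].
  have [e1 e2] := changed_top p k2.
  apply/RepS; rewrite -/b e1 e2; split.
  - by move=> Z [/h1].
  - right; split.
    + by apply/hS'; constructor 2.
    + by apply/hS'; constructor 3.
    + move=> Z /hS' [/hIb/andP[c1 c2]|->|->].
      * by rewrite (ltnW c1) (ltnW c2).
      * by rewrite leqnn hfg.
      * by rewrite leqnn hfg.
  apply: RepI_ext k1 => Z; split=> [IZ|[/hS' [//|//|//] ? ?]].
  case/andP: (hIb _ IZ) => c1 c2; split; first by apply/hS'; constructor 1.
    by move=> eZ; rewrite eZ ltnn in c1.
  by move=> eZ; rewrite eZ ltnn in c2.
have hzr v q : upd2 mn b p v 0 q = 0.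
  by rewrite upd2_root // eq_sym.
(* At level 1 the summary reads as 0, so a nonempty summary certifies that there are sub-trees to
   descend into. *)
have mnX : mn (width j) p != 0 -> 0 < j.
  by case: (j) => //=; rewrite hz.
case: eqP => [eX|nX].
  case: eqP => [e0|/eqP n0].
    split; last exact: (chroot _ _ (Some M) None).
    have emp Z : ~ interior S m M Z.
      move=> hZ; have j0 := three _ hZ.
      by have := RepI_min j0 p0 hI (fun Z => hp Z j0); rewrite e0 eqxx => /(_ Z hZ).
    apply/RepS; cbn [fst snd]; rewrite -/b upd2_at -/M; split.
    - by move=> Z [/h1].
    - right; split.
      + by split=> // e; move: ltmM; rewrite -eX e ltnn.
      + by split=> // e; move: ltmM; rewrite -eX e ltnn.
      + by move=> Z [/Sdec [/emp|->|->]] //; rewrite ?leqnn // -eX.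
    apply: (@RepI_upd_root mn mx) => [b' p' hb|]; first by rewrite upd2_root.
    apply: RepI_ext hI => Z; split=> [/emp //|[[/Sdec [//|->|->]]]] //.
    by rewrite -eX.
  have j0 := mnX n0.
  have := RepI_min j0 p0 hI (fun Z => hp Z j0); rewrite (negbTE n0).
  set X' := mn _ (mn _ _) => -[IX' hX'].
  have /andP[c1 c2] := Ib _ IX'.
  apply: gen; rewrite ?upd2_at -/M //.
  - apply: (@RepI_upd_root mn mx) => // b' p' hb; by rewrite upd2_root.
  - move=> Z; split=> [[/Sdec [hZ|->|->]] nZ|[[[SZ Zm ZM] nZ]|->|->]].
    + by have [->|/eqP nZX] := eqVneq Z X'; [constructor 2 | constructor 1].
    + by case: nZ.
    + by constructor 3.
    + by split=> //; rewrite eX.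
    + by case: IX'; rewrite eX.
    + by split=> // e; move: ltmM; rewrite -eX e ltnn.
  - move=> Z [hZ nZ]; have /andP[_ ->] := Ib _ hZ; rewrite andbT ltn_neqAle hX' // andbT.
    by apply/eqP => e; apply: nZ.
  - exact: ltnW.
  - exact: (chroot _ _ (Some X') None).
case: eqP => [eX|nX2].
  case: eqP => [e0|/eqP n0].
    split; last exact: (chroot _ _ None (Some m)).
    have emp Z : ~ interior S m M Z.
      move=> hZ; have j0 := three _ hZ.
      by have := RepI_min j0 p0 hI (fun Z => hp Z j0); rewrite e0 eqxx => /(_ Z hZ).
    apply/RepS; cbn [fst snd]; rewrite -/b upd2_at -/m; split.
    - by move=> Z [/h1].
    - right; split.
      + by split=> // e; move: ltmM; rewrite -eX e ltnn.
      + by split=> // e; move: ltmM; rewrite -eX e ltnn.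
      + by move=> Z [/Sdec [/emp|->|->]] //; rewrite ?leqnn // -eX.
    apply: (@RepI_upd_root mn mx) => [b' p' hb|]; first by rewrite upd2_root.
    apply: RepI_ext hI => Z; split=> [/emp //|[[/Sdec [//|->|->]]]] //.
    by rewrite -eX.
  have j0 := mnX n0.
  have [] := RepI_max j0 p0 hI (fun Z => hp Z j0) n0.
  set X' := mx _ (mx _ _) => IX' hX'.
  have /andP[c1 c2] := Ib _ IX'.
  apply: gen; rewrite ?upd2_at -/m //.
  - apply: (@RepI_upd_root mn mx) => // b' p' hb; by rewrite upd2_root.
  - move=> Z; split=> [[/Sdec [hZ|->|->]] nZ|[[[SZ Zm ZM] nZ]|->|->]].
    + by have [->|/eqP nZX] := eqVneq Z X'; [constructor 3 | constructor 1].
    + by constructor 2.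
    + by case: nZ.
    + by split=> //; rewrite eX.
    + by split=> // e; move: ltmM; rewrite -eX e ltnn.
    + by case: IX'; rewrite eX.
  - move=> Z [hZ nZ]; have /andP[-> _] := Ib _ hZ; rewrite /= ltn_neqAle hX' // andbT.
    by apply/eqP => e; apply: nZ.
  - exact: ltnW.
  - exact: (chroot _ _ None (Some X')).
have IX : interior S m M X by split.
apply: gen; rewrite -/m -/M //.
- exact: three IX.
- move=> Z; split=> [[/Sdec [hZ|->|->]] nZ|[[[SZ Zm ZM] nZ]|->|->]] //.
  + by constructor 1.
  + by constructor 2.
  + by constructor 3.
  + by split=> // e; case: nX.
  + by split=> // e; case: nX2.
- by move=> Z [/Ib].
- exact: ltnW.
- exact: (chroot _ _ None None).
Qed.

(** Comparing [X] with the minimum of its cluster tells beforehand whether the answer lies in that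
    cluster. If not, the answer is the maximum of the preceding nonempty cluster, found in the
    summary, or else the minimum of the node; either way there is one recursive call. The call into
    the summary is not a tail call, since its result still has to be looked up. *)
Fixpoint vpred j p X (mn mx : nat -> nat -> nat) : nat :=
  if j is j'.+1 then
    let b := width j in let c := width j' in
    let Y := X %/ 2 ^ c in
    if mx b p < X then mx b p
    else if 0 < mn c Y < X then vpred j' Y X mn mx
    else if 0 < mn c p < Y then mx c (vpred j' p Y mn mx)
    else mn b p
  else 0.

Lemma vpredP j p X mn mx S : 0 < p -> (forall q, mn 0 q = 0) -> Rep mn mx j p S ->
  X %/ 2 ^ width j = p -> 0 < mn (width j) p < X ->
  let R := vpred j p X mn mx in
  [/\ S R, R < X & forall Z, S Z -> Z < X -> Z <= R].
Proof.
elim: j p X S => [|j IH] p X S p0 hz hR eX /andP[m0 mX]; first by move: m0; rewrite hz.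
have [h1 h2 [hs hc]] := (RepS _ _ _ _ _).1 hR.
rewrite /= -/(width j.+1); set b := width j.+1 in h1 h2 hs hc eX m0 mX *.
set m := mn b p in h2 hs hc m0 mX *; set M := mx b p in h2 hs hc *.
have {h2} [Sm SM hS] : [/\ S m, S M & forall X, S X -> m <= X <= M].
  by case: h2 => [[e0 _ _]|//]; rewrite e0 in m0.
case: (ltnP M X) => hMX; first by split=> // Z /hS/andP[].
have Sdec Z : S Z -> Z < X -> Z = m \/ interior S m M Z.
  move=> SZ hZ; have [->|/eqP Zm] := eqVneq Z m; [by left | right; split=> // e].
  by move: hZ; rewrite e ltnNge hMX.
have [ej|j0] := posnP j.
  rewrite ej /= !hz /= in hs *; split=> // Z SZ /(Sdec _ SZ)[->|IZ] //.
  by case: (hs (Z %/ 2 ^ width j)); exists Z => //; rewrite ej.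
set c := width j in hs hc *; set Y := X %/ 2 ^ c.
have hp Z : Z %/ 2 ^ b = p -> Z %/ 2 ^ c %/ 2 ^ c = p.
  by rewrite /c /b; case: (j) j0 => // j' _ <-; rewrite div_width.
have eY : Y %/ 2 ^ c = p by apply: hp.
have Y0 : 0 < Y by case: Y eY p0 => // <-; rewrite div0n.
case: ifP => [hY|nY].
  have [[[SR Rm RM] RY] RX hmax] := IH _ _ _ Y0 hz (hc _ eY) erefl hY.
  split=> // Z SZ hZ; case: (Sdec _ SZ hZ) => [->|IZ].
    by case/andP: (hS _ SR).
  rewrite leqNgt; apply/negP => hgt; suff /hmax/(_ hZ) : interior S m M Z /\ Z %/ 2 ^ c = Y.
    by rewrite leqNgt hgt.
  split=> //; apply/eqP; rewrite eqn_leq (leq_div2r _ (ltnW hZ)) -RY.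
  exact: leq_div2r (ltnW hgt).
(* The cluster of [X] has no member below [X], so interior elements below [X] lie in strictly
   earlier clusters. *)
have low Z : interior S m M Z -> Z < X -> Z %/ 2 ^ c < Y.
  move=> IZ hZ; rewrite ltn_neqAle leq_div2r ?andbT; last exact: ltnW.
  apply/eqP => eZ; move/negP: nY; apply.
  have hcY := hc _ eY; have [e0|n0] := eqVneq (mn c Y) 0.
    by case: (Rep_empty Y0 j0 hcY e0 (conj IZ eZ)).
  have [_ _ h] := Rep_nonempty j0 hcY n0.
  by case/andP: (h _ (conj IZ eZ)) => h' _; rewrite lt0n n0 (leq_ltn_trans h' hZ).
case: ifP => [hq|nq].
  have [[Z0 IZ0 eq0] qY hmax] := IH _ _ _ p0 hz hs eY hq.
  set q := vpred _ _ _ _ _ in eq0 qY hmax *.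
  have eqp : q %/ 2 ^ c = p by rewrite -eq0; apply: hp; case: IZ0 => /h1.
  have q0 : 0 < q by case: q eqp {eq0 qY hmax} p0 => // <-; rewrite div0n.
  have [_ [[SR Rm RM] RX] a3] : [/\ interior S m M (mn c q) /\ mn c q %/ 2 ^ c = q,
     interior S m M (mx c q) /\ mx c q %/ 2 ^ c = q &
     forall X, interior S m M X /\ X %/ 2 ^ c = q -> mn c q <= X <= mx c q].
    apply: (Rep_nonempty j0 (hc _ eqp)); apply/eqP => e0.
    exact: (Rep_empty q0 j0 (hc _ eqp) e0 (conj IZ0 eq0)).
  split=> //.
    by rewrite ltnNge; apply/negP => /(leq_div2r (2 ^ c)); rewrite RX leqNgt qY.
  move=> Z SZ hZ; case: (Sdec _ SZ hZ) => [->|IZ]; first by case/andP: (hS _ SR).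
  have hle : Z %/ 2 ^ c <= q by apply: hmax; [exists Z | apply: low].
  have [eZ|nZ] := eqVneq (Z %/ 2 ^ c) q; first by case/andP: (a3 _ (conj IZ eZ)).
  rewrite leqNgt; apply/negP => /ltnW/(leq_div2r (2 ^ c)); rewrite RX leqNgt.
  by rewrite ltn_neqAle nZ hle.
split=> // Z SZ hZ; case: (Sdec _ SZ hZ) => [->|IZ] //.
have [e0|n0] := eqVneq (mn c p) 0.
  by case: (Rep_empty p0 j0 hs e0 (ex_intro2 _ _ Z IZ erefl)).
have [_ _ h] := Rep_nonempty j0 hs n0.
case/andP: (h _ (ex_intro2 _ _ Z IZ erefl)) => h' _; move/negP: nq; case.
by rewrite lt0n n0 (leq_ltn_trans h' (low _ IZ hZ)).
Qed.

Lemma natpowE b n : Nat.pow b n = b ^ n.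
Proof. by elim: n => //= n ->; rewrite expnS. Qed.

(** * A structured language and its translation to the word-RAM *)

Inductive binop := OAdd | OSub | OMul | ODiv | OShr | OLt | OEq.

Inductive expr :=
  | Cst of nat
  | Bin of binop & expr & expr
  | Ld of nat & expr.

Inductive cmd :=
  | Skip
  | Asg of nat & expr & expr
  | Seq of cmd & cmd
  | If of expr & cmd & cmd
  | While of expr & cmd.

(* A state is a family of unbounded arrays; cell [i] of array [a] lives at address [q * i + a], and cell [0] of an array serves as a variable. *)
Definition state := nat -> nat -> nat.

Definition eval_op op x y : nat :=
  match op with
  | OAdd => x + y
  | OSub => x - y
  | OMul => x * y
  | ODiv => x %/ y
  | OShr => x %/ 2 ^ y
  | OLt => x < y
  | OEq => x == y
  end.

Fixpoint eval (st : state) e : nat :=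
  match e with
  | Cst n => n
  | Bin op e1 e2 => eval_op op (eval st e1) (eval st e2)
  | Ld a e => st a (eval st e)
  end.

Section Exec.
(* Indices and arithmetic results must stay below [lim], array names below [arr]. *)
Variables (lim arr : nat).

(** Conditions under which the operation on natural numbers agrees with the one modulo the word
    size: truncated and wrapping subtraction coincide for [y <= x], and quotients, shifts and tests
    cannot overflow. *)
Definition safe_op op x y : Prop :=
  match op with
  | OAdd | OMul => eval_op op x y < lim
  | OSub => y <= x
  | _ => True
  end.

Fixpoint safe (st : state) e : Prop :=
  match e with
  | Cst n => n < lim
  | Bin op e1 e2 => [/\ safe st e1, safe st e2 & safe_op op (eval st e1) (eval st e2)]
  | Ld a e => [/\ a < arr, safe st e & eval st e < lim]
  end.

Definition op_cost op := if op is OEq then 3 else 1.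

Fixpoint expr_cost e :=
  match e with
  | Cst _ => 1
  | Bin op e1 e2 => expr_cost e1 + (expr_cost e2 + op_cost op)
  | Ld _ e => expr_cost e + 5
  end.

(** The costs are instruction counts of the translation: forming an address takes 4 instructions,
    and a branch or loop body that is entered pays the test and a jump of two instructions at its
    end. *)
Inductive exec : cmd -> state -> nat -> state -> Prop :=
  | ESkip st : exec Skip st 0 st
  | EAsg a e1 e2 st : a < arr -> safe st e1 -> safe st e2 -> eval st e1 < lim ->
      exec (Asg a e1 e2) st (expr_cost e1 + (expr_cost e2 + 5))
        (upd2 st a (eval st e1) (eval st e2))
  | ESeq c1 c2 st1 st2 st3 t1 t2 : exec c1 st1 t1 st2 -> exec c2 st2 t2 st3 ->
      exec (Seq c1 c2) st1 (t1 + t2) st3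
  | EIfT e c1 c2 st st' t : safe st e -> eval st e != 0 -> exec c1 st t st' ->
      exec (If e c1 c2) st (expr_cost e + t + 3) st'
  | EIfF e c1 c2 st st' t : safe st e -> eval st e = 0 -> exec c2 st t st' ->
      exec (If e c1 c2) st (expr_cost e + t + 1) st'
  | EWhileT e c st st' st'' t t' : safe st e -> eval st e != 0 -> exec c st t st' ->
      exec (While e c) st' t' st'' ->
      exec (While e c) st (expr_cost e + t + 3 + t') st''
  | EWhileF e c st : safe st e -> eval st e = 0 ->
      exec (While e c) st (expr_cost e + 1) st.
End Exec.

(** * Translation of expressions and commands into machine code *)

Section Compile.
Variables (W lim arr q : nat).

(** The machine has no equality test: two words are equal exactly when their difference modulo the
    word size is below 1. *)
Definition comp_op op t :=
  match op with
  | OAdd => [:: IAdd t t t.+1]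
  | OSub => [:: ISub t t t.+1]
  | OMul => [:: IMul t t t.+1]
  | ODiv => [:: IDiv t t t.+1]
  | OShr => [:: IShr t t t.+1]
  | OLt => [:: ILt t t t.+1]
  | OEq => [:: ISub t t t.+1; IConst t.+1 1; ILt t t t.+1]
  end.

Definition comp_addr a t := [:: IConst t.+1 q; IMul t t t.+1; IConst t.+1 a; IAdd t t t.+1].

(* The value is left in cell [t]; temporaries are the cells [t .. q - 1], which belong to no array [a < arr] when [arr <= t]. *)
Fixpoint comp_expr e t : program :=
  match e with
  | Cst n => [:: IConst t n]
  | Bin op e1 e2 => comp_expr e1 t ++ comp_expr e2 t.+1 ++ comp_op op t
  | Ld a e => comp_expr e t ++ comp_addr a t ++ [:: ILoad t t]
  end.

Fixpoint expr_depth e :=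
  match e with
  | Cst _ => 2
  | Bin _ e1 e2 => maxn (expr_depth e1) (expr_depth e2).+1
  | Ld _ e => expr_depth e
  end.

(** Jump targets are absolute, hence the argument [pos]. An unconditional jump is a conditional one
    on a temporary that has just been set to 0. *)
Fixpoint comp c pos : program :=
  match c with
  | Skip => [::]
  | Asg a e1 e2 => comp_expr e1 arr ++ comp_addr a arr ++
      comp_expr e2 arr.+1 ++ [:: IStore arr arr.+1]
  | Seq c1 c2 => let p1 := comp c1 pos in p1 ++ comp c2 (pos + size p1)
  | If e c1 c2 =>
      let pe := comp_expr e arr in
      let p1 := comp c1 (pos + size pe).+1 in
      let pos2 := pos + size pe + 1 + size p1 + 2 in
      let p2 := comp c2 pos2 in
      pe ++ IJz arr pos2 :: p1 ++ [:: IConst arr 0, IJz arr (pos2 + size p2) & p2]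
  | While e c =>
      let pe := comp_expr e arr in
      let p := comp c (pos + size pe).+1 in
      pe ++ IJz arr (pos + size pe + 1 + size p + 2) :: p ++ [:: IConst arr 0; IJz arr pos]
  end.

Arguments comp : simpl never.

Lemma comp_asgE a e1 e2 pos : comp (Asg a e1 e2) pos =
  comp_expr e1 arr ++ comp_addr a arr ++ comp_expr e2 arr.+1 ++ [:: IStore arr arr.+1].
Proof. by []. Qed.

Lemma comp_seqE c1 c2 pos :
  comp (Seq c1 c2) pos = comp c1 pos ++ comp c2 (pos + size (comp c1 pos)).
Proof. by []. Qed.

Lemma comp_ifE e c1 c2 pos : comp (If e c1 c2) pos =
  let pe := comp_expr e arr in
  let p1 := comp c1 (pos + size pe).+1 in
  let pos2 := pos + size pe + 1 + size p1 + 2 in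
  let p2 := comp c2 pos2 in
  pe ++ IJz arr pos2 :: p1 ++ [:: IConst arr 0, IJz arr (pos2 + size p2) & p2].
Proof. by []. Qed.

Lemma comp_whileE e c pos : comp (While e c) pos =
  let pe := comp_expr e arr in
  let p := comp c (pos + size pe).+1 in
  pe ++ IJz arr (pos + size pe + 1 + size p + 2) :: p ++ [:: IConst arr 0; IJz arr pos].
Proof. by []. Qed.

Fixpoint cmd_depth c :=
  match c with
  | Skip => 0
  | Asg _ e1 e2 => maxn (expr_depth e1) (expr_depth e2).+1
  | Seq c1 c2 => maxn (cmd_depth c1) (cmd_depth c2)
  | If e c1 c2 => maxn (expr_depth e) (maxn (cmd_depth c1) (cmd_depth c2))
  | While e c => maxn (expr_depth e) (cmd_depth c)
  end.

Lemma size_comp_expr e t : size (comp_expr e t) = expr_cost e.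
Proof.
elim: e t => [//|op e1 IH1 e2 IH2|a e IH] t /=; rewrite !size_cat ?IH1 ?IH2 ?IH //.
by case: op.
Qed.

Variable p : program.

Definition code_at pos (c : program) :=
  forall k, k < size c -> fetch p (pos + k) = nth IHalt c k.

Lemma code_at_cat pos c1 c2 :
  code_at pos (c1 ++ c2) <-> code_at pos c1 /\ code_at (pos + size c1) c2.
Proof.
split=> [h|[h1 h2] k].
  split=> k hk.
    by rewrite h ?nth_cat ?hk // size_cat ltn_addr.
  rewrite -addnA h ?nth_cat; first by rewrite ltnNge leq_addr /= addKn.
  by rewrite size_cat ltn_add2l.
rewrite size_cat nth_cat => hk; case: ltnP => h; first exact: h1.
by rewrite -h2 -?addnA ?subnKC // ltn_subLR.
Qed.

Lemma code_at_cons pos i c :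
  code_at pos (i :: c) <-> fetch p pos = i /\ code_at pos.+1 c.
Proof.
rewrite -cat1s code_at_cat /= addn1; split=> -[h1 h2]; split=> //.
  by have := h1 0 isT; rewrite addn0.
by case=> // _; rewrite addn0.
Qed.

Definition runs n (s s' : nat * memory) := iter n (ram_step W p) s = s'.

Lemma runs0 s : runs 0 s s. Proof. by []. Qed.

Lemma runsD n1 n2 s1 s2 s3 : runs n1 s1 s2 -> runs n2 s2 s3 -> runs (n1 + n2) s1 s3.
Proof. by rewrite /runs addnC iterD => -> ->. Qed.

Lemma runsS n s1 s2 s3 : ram_step W p s1 = s2 -> runs n s2 s3 -> runs n.+1 s1 s3.
Proof. by move=> h; apply: (@runsD 1). Qed.

Hypothesis q_lim : q * lim <= 2 ^ W.
Hypothesis W0 : 0 < W.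

Definition agree (m : memory) (st : state) :=
  (forall a i, a < arr -> m (q * i + a) = st a i) /\ forall x, m x < 2 ^ W.

Definition keeps t (m m' : memory) := forall x, (x < t) || (q <= x) -> m' x = m x.

Lemma keeps_trans t m1 m2 m3 : keeps t m1 m2 -> keeps t m2 m3 -> keeps t m1 m3.
Proof. by move=> h1 h2 x hx; rewrite h2 ?h1. Qed.

Lemma keepsW t t' m m' : t <= t' -> keeps t' m m' -> keeps t m m'.
Proof. by move=> h k x hx; apply: k; case/orP: hx => [hx|->]; rewrite ?orbT // (leq_trans hx h). Qed.

Lemma keeps_upd t u m v : t <= u < q -> keeps t m (mem_upd m u v).
Proof.
move=> h x hx; rewrite /mem_upd; case: eqP => // e; move: hx; rewrite e.
by case/andP: h => h1 h2; rewrite ltnNge h1 leqNgt h2.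
Qed.

(** Memory is a matrix with rows of length [q]. The temporaries are in row 0 at columns from [arr]
    on, whereas the arrays occupy the columns below [arr]. *)
Lemma keeps_agree t m m' st : arr <= t -> agree m st -> keeps t m m' ->
  (forall x, m' x < 2 ^ W) -> agree m' st.
Proof.
move=> ht [h1 h2] k b; split=> // a i ha; rewrite k ?h1 //.
case: i => [|i]; first by rewrite muln0 add0n (leq_trans ha ht).
by rewrite mulnS -addnA leq_addr orbT.
Qed.

Lemma pow_gt0 : 0 < 2 ^ W. Proof. by rewrite expn_gt0. Qed.
Lemma pow_gt1 : 1 < 2 ^ W. Proof. by rewrite -{1}(expn0 2) ltn_exp2l. Qed.

Lemma bound_upd (m : memory) u v : (forall x, m x < 2 ^ W) -> v < 2 ^ W ->
  forall x, mem_upd m u v x < 2 ^ W.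
Proof. by move=> h hv x; rewrite /mem_upd; case: eqP. Qed.

Lemma mem_updE m u v x : mem_upd m u v x = if x == u then v else m x.
Proof. by []. Qed.

Lemma step_at pos m i : fetch p pos = i -> ram_step W p (pos, m) =
  let md x := x %% 2 ^ W in
  let nxt i v := (pos.+1, mem_upd m i (md v)) in
  match i with
  | IConst i c => nxt i c
  | IAdd i j k => nxt i (m j + m k)
  | ISub i j k => nxt i (m j + (2 ^ W - md (m k)))
  | IMul i j k => nxt i (m j * m k)
  | IDiv i j k => nxt i (m j %/ m k)
  | IMod i j k => nxt i (m j %% m k)
  | IAnd i j k => nxt i (Nat.land (m j) (m k))
  | IOr i j k => nxt i (Nat.lor (m j) (m k))
  | IXor i j k => nxt i (Nat.lxor (m j) (m k))
  | IShl i j k => nxt i (m j * 2 ^ (m k))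
  | IShr i j k => nxt i (m j %/ 2 ^ (m k))
  | ILt i j k => nxt i (m j < m k)
  | ILoad i j => nxt i (m (m j))
  | IStore i j => (pos.+1, mem_upd m (m i) (md (m j)))
  | IJz i l => if m i == 0 then (l, m) else (pos.+1, m)
  | IHalt => (pos, m)
  end.
Proof.
move=> hf; rewrite /ram_step; cbv zeta; rewrite hf.
by case: i {hf} => *; rewrite ?natpowE.
Qed.

Lemma sub_mod x y : x < 2 ^ W -> y < 2 ^ W ->
  (x + (2 ^ W - y %% 2 ^ W)) %% 2 ^ W = if y <= x then x - y else x + 2 ^ W - y.
Proof.
move=> hx hy; rewrite (modn_small hy); case: leqP => h.
  by rewrite addnBA 1?ltnW // addnC -addnBA // modnDl modn_small // (leq_ltn_trans _ hx) // leq_subr.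
rewrite addnBA 1?ltnW // modn_small //; lia.
Qed.

Lemma comp_op_ok op t pos m x y : code_at pos (comp_op op t) -> t.+1 < q ->
  m t = x -> m t.+1 = y -> (forall z, m z < 2 ^ W) -> safe_op lim op x y ->
  exists m', [/\ runs (op_cost op) (pos, m) (pos + op_cost op, m'),
    m' t = eval_op op x y, keeps t m m' & forall z, m' z < 2 ^ W].
Proof.
move=> hc ht ex ey hb hs.
have hx : x < 2 ^ W by rewrite -ex.
have hy : y < 2 ^ W by rewrite -ey.
have q0 : 0 < q by lia.
have limW : lim <= 2 ^ W by apply: leq_trans q_lim; rewrite leq_pmull.
have one i v v' : fetch p pos = i -> ram_step W p (pos, m) = (pos.+1, mem_upd m t (v' %% 2 ^ W)) ->
    v' %% 2 ^ W = v -> v < 2 ^ W ->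
    exists m', [/\ runs 1 (pos, m) (pos + 1, m'), m' t = v, keeps t m m' & forall z, m' z < 2 ^ W].
  move=> hi hst ev hv; exists (mem_upd m t v); split.
  - by apply: runsS hst _; rewrite ev addn1; apply: runs0.
  - by rewrite mem_updE eqxx.
  - by apply: keeps_upd; rewrite leqnn ltnW.
  - exact: bound_upd.
case: op hc hs => hc hs; move/code_at_cons: (hc) => [hf hc'];
  have hst := step_at m hf; cbv beta iota zeta in hst; rewrite ?ex ?ey in hst.
- by apply: (one _ _ _ hf hst); [rewrite modn_small // | ]; apply: leq_trans hs limW.
- rewrite /= in hs; apply: (one _ _ _ hf hst); first by rewrite sub_mod // hs.
  by apply: leq_ltn_trans hx; apply: leq_subr.
- by apply: (one _ _ _ hf hst); [rewrite modn_small // | ]; apply: leq_trans hs limW.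
- have hd : x %/ y < 2 ^ W by apply: leq_ltn_trans hx; apply: leq_div.
  by apply: (one _ _ _ hf hst) => //; rewrite modn_small.
- have hd : x %/ 2 ^ y < 2 ^ W by apply: leq_ltn_trans hx; apply: leq_div.
  by apply: (one _ _ _ hf hst) => //; rewrite modn_small.
- have hd : (x < y : nat) < 2 ^ W by apply: leq_ltn_trans pow_gt1; case: (x < y).
  by apply: (one _ _ _ hf hst) => //; rewrite modn_small.
rewrite sub_mod // in hst; set v := (if y <= x then _ else _) in hst.
(* For [x < y] the difference wraps around to a positive number, so the test for being below 1
   correctly fails. *)
have wrap B : x < y -> y < B -> 0 < x + B - y < B by move=> {hst v}; lia.
have hv : v < 2 ^ W.
  rewrite /v; case: (leqP y x) => h; first exact: leq_ltn_trans (leq_subr _ _) hx.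
  by case/andP: (wrap _ h hy).
case/code_at_cons: hc' => hf2 /code_at_cons[hf3 _].
set m1 := mem_upd m t v in hst; pose m2 := mem_upd m1 t.+1 1.
exists (mem_upd m2 t (v < 1)); split.
- have e2 := step_at m1 hf2; have e3 := step_at m2 hf3; cbv beta iota zeta in e2, e3.
  rewrite (modn_small pow_gt1) in e2.
  apply: runsS hst _; apply: runsS e2 _; apply: runsS e3 _.
  rewrite !addnS addn0 /runs /=.
  rewrite /m2 /m1 !mem_updE !eqxx (ltn_eqF (ltnSn t)) modn_small //.
  by apply: leq_ltn_trans pow_gt1; case: (v < 1).
- rewrite mem_updE eqxx /v /=; case: (leqP y x) => h; first by rewrite ltnS leqn0 subn_eq0 eqn_leq h andbT.
  by rewrite (ltn_eqF h) ltnS leqn0; case/andP: (wrap _ h hy); case: (_ - _).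
- have k0 : t <= t < q by rewrite leqnn ltnW.
  have k1 : t <= t.+1 < q by rewrite leqnSn.
  exact: keeps_trans (keeps_trans (keeps_upd _ _ k0) (keeps_upd _ _ k1)) (keeps_upd _ _ k0).
- do ! apply: bound_upd; rewrite ?pow_gt1 //.
  by apply: leq_ltn_trans pow_gt1; case: (v < 1).
Qed.

Hypothesis q_pow : q < 2 ^ W.

Lemma addr_lt a i : a < q -> i < lim -> q * i + a < 2 ^ W.
Proof.
move=> ha hi; apply: leq_trans q_lim; apply: leq_trans (_ : q * i.+1 <= _).
  by rewrite mulnS addnC ltn_add2r.
by rewrite leq_pmul2l ?(leq_trans _ ha).
Qed.

Lemma comp_addr_ok a t pos m i : code_at pos (comp_addr a t) -> t.+1 < q ->
  m t = i -> a < q -> i < lim -> (forall z, m z < 2 ^ W) ->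
  exists m', [/\ runs 4 (pos, m) (pos + 4, m'), m' t = q * i + a, keeps t m m' &
    forall z, m' z < 2 ^ W].
Proof.
move=> /code_at_cons[f1 /code_at_cons[f2 /code_at_cons[f3 /code_at_cons[f4 _]]]].
move=> ht em ha hi hb.
have hqa := addr_lt ha hi.
have hqi : q * i < 2 ^ W by apply: leq_ltn_trans hqa; rewrite leq_addr.
have hap : a < 2 ^ W by apply: ltn_trans q_pow.
pose m1 := mem_upd m t.+1 q; pose m2 := mem_upd m1 t (q * i).
pose m3 := mem_upd m2 t.+1 a; exists (mem_upd m3 t (q * i + a)).
have e1 := step_at m f1; have e2 := step_at m1 f2; have e3 := step_at m2 f3.
have e4 := step_at m3 f4; cbv beta iota zeta in e1, e2, e3, e4.
have nt : (t == t.+1) = false by rewrite (ltn_eqF (ltnSn t)).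
have nt' : (t.+1 == t) = false by rewrite eq_sym.
rewrite (modn_small q_pow) in e1.
have v1 : m1 t = i by rewrite /m1 mem_updE nt.
have v1' : m1 t.+1 = q by rewrite /m1 mem_updE eqxx.
rewrite v1 v1' mulnC (modn_small hqi) in e2.
rewrite (modn_small hap) in e3.
have v3 : m3 t = q * i by rewrite /m3 mem_updE nt /m2 mem_updE eqxx.
have v3' : m3 t.+1 = a by rewrite /m3 mem_updE eqxx.
rewrite v3 v3' (modn_small hqa) in e4.
split.
- apply: runsS e1 _; apply: runsS e2 _; apply: runsS e3 _; apply: runsS e4 _.
  by rewrite !addnS addn0.
- by rewrite mem_updE eqxx.
- have k0 : t <= t < q by rewrite leqnn ltnW.
  have k1 : t <= t.+1 < q by rewrite leqnSn.
  apply: keeps_trans (keeps_trans (keeps_upd _ _ k1) (keeps_upd _ _ k0)) _.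
  exact: keeps_trans (keeps_upd _ _ k1) (keeps_upd _ _ k0).
- by do ! apply: bound_upd.
Qed.

Lemma expr_depth_ge2 e : 1 < expr_depth e.
Proof. by elim: e => //= _ e1 h1 e2 h2; rewrite leq_max h1. Qed.

Lemma comp_expr_ok e t pos m st : code_at pos (comp_expr e t) -> arr <= t ->
  t + expr_depth e <= q -> agree m st -> safe lim arr st e ->
  exists m', [/\ runs (expr_cost e) (pos, m) (pos + expr_cost e, m'),
    m' t = eval st e, keeps t m m' & agree m' st].
Proof.
elim: e t pos m => [n|op e1 IH1 e2 IH2|a e IH] t pos m /= hc ha hd hag hs.
- case/code_at_cons: hc => f1 _; exists (mem_upd m t n).
  have e1 := step_at m f1; cbv beta iota zeta in e1.
  have hn : n < 2 ^ W.
    apply: leq_trans hs _; apply: leq_trans q_lim; rewrite leq_pmull //; lia.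
  rewrite (modn_small hn) in e1.
  have k0 : t <= t < q by lia.
  split.
  + by apply: runsS e1 _; rewrite addn1.
  + by rewrite mem_updE eqxx.
  + exact: keeps_upd.
  + by have hb := hag.2; apply: keeps_agree ha hag (keeps_upd _ _ k0) _; apply: bound_upd.
- case/code_at_cat: hc => c1 /code_at_cat[c2 c3]; case: hs => s1 s2 s3.
  rewrite !size_comp_expr in c2 c3.
  have [g1 g2] := (expr_depth_ge2 e1, expr_depth_ge2 e2).
  have d1 : t + expr_depth e1 <= q by apply: leq_trans hd; rewrite leq_add2l leq_maxl.
  have d2 : t.+1 + expr_depth e2 <= q.
    by apply: leq_trans hd; rewrite addSnnS leq_add2l leq_maxr.
  have [m1 [r1 v1 k1 a1]] := IH1 _ _ _ c1 ha d1 hag s1.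
  have [m2 [r2 v2 k2 a2]] := IH2 _ _ _ c2 (leqW ha) d2 a1 s2.
  have e12 : m2 t = eval st e1 by rewrite k2 ?ltnSn.
  have ht : t.+1 < q by apply: leq_trans d1; rewrite -addn2 leq_add2l.
  have [m3 [r3 v3 k3 b3]] := comp_op_ok c3 ht e12 v2 a2.2 s3.
  have k : keeps t m m3 by apply: keeps_trans k1 (keeps_trans (keepsW _ k2) k3).
  exists m3; split=> //.
    by rewrite !addnA; apply: runsD r3; apply: runsD r2.
  exact: keeps_agree ha hag k b3.
- case/code_at_cat: hc => c1 /(code_at_cat _ (comp_addr a t) [:: _])[c2 /code_at_cons[f3 _]].
  rewrite !size_comp_expr /= in c2 f3; case: hs => sa s1 s2.
  have g := expr_depth_ge2 e.
  have [m1 [r1 v1 k1 a1]] := IH _ _ _ c1 ha hd hag s1.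
  have ht : t.+1 < q by apply: leq_trans hd; rewrite -addn2 leq_add2l.
  have aq : a < q by apply: leq_trans sa (leq_trans ha (leq_trans _ hd)); rewrite leq_addr.
  have [m2 [r2 v2 k2 b2]] := comp_addr_ok c2 ht v1 aq s2 a1.2.
  have a2 := keeps_agree ha a1 k2 b2.
  have e3 := step_at m2 f3; cbv beta iota zeta in e3.
  rewrite v2 (proj1 a2) // modn_small in e3; last by rewrite -(proj1 a2) //; apply: b2.
  have k0 : t <= t < q by rewrite leqnn ltnW.
  have k : keeps t m (mem_upd m2 t (st a (eval st e))).
    by apply: keeps_trans k1 (keeps_trans k2 (keeps_upd _ _ k0)).
  exists (mem_upd m2 t (st a (eval st e))); split=> //.
  + rewrite (_ : 5 = 4 + 1) // !addnA; apply: runsD (runsD r1 r2) _.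
    by apply: runsS e3 _; rewrite addn1.
  + by rewrite mem_updE eqxx.
  + apply: keeps_agree ha hag k _; apply: bound_upd a2.2 _.
    by rewrite -(proj1 a2 _ _ sa); apply: a2.2.
Qed.

(** Quotient and remainder of an address by [q] recover index and array, so a store hits no other
    cell of an array. *)
Lemma agree_store m st a i v : agree m st -> a < arr -> arr <= q -> v < 2 ^ W ->
  agree (mem_upd m (q * i + a) v) (upd2 st a i v).
Proof.
move=> [h1 h2] ha hq hv; split; last exact: bound_upd.
move=> a' i' ha'; rewrite mem_updE /upd2; case: andP => [[/eqP -> /eqP ->]|ne].
  by rewrite eqxx.
case: eqP => [e|_]; last exact: h1.
have aq : a < q by apply: leq_trans ha hq.
have aq' : a' < q by apply: leq_trans ha' hq.
have q0 : 0 < q by apply: leq_ltn_trans aq.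
case: ne; split; apply/eqP.
  have := congr1 (modn^~ q) e.
  by rewrite ![q * _]mulnC !modnMDl !modn_small.
have := congr1 (divn^~ q) e.
by rewrite ![q * _]mulnC !divnMDl // !divn_small // !addn0.
Qed.

Lemma comp_ok c st n st' : exec lim arr c st n st' -> forall pos m,
  code_at pos (comp c pos) -> arr + cmd_depth c <= q -> arr.+1 < q -> agree m st ->
  exists m', runs n (pos, m) (pos + size (comp c pos), m') /\ agree m' st'.
Proof.
move=> hex pos m hc hd hq; have aq : arr < q by apply: ltnW.
have k0 : arr <= arr < q by rewrite leqnn.
(* Induction on the execution and not on the command: each round of a loop runs the same code at the
   same position again. *)
elim: hex pos m hc hd => {c st n st'}
  [st|a e1 e2 st ha s1 s2 hl|c1 c2 st1 st2 st3 n1 n2 _ IH1 _ IH2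
  |e c1 c2 st st' n s0 he _ IH|e c1 c2 st st' n s0 he _ IH
  |e c st st1 st2 n1 n2 s0 he _ IH1 _ IH2|e c st s0 he] pos m hc hd hag.
- by exists m; rewrite addn0.
- rewrite comp_asgE in hc; case/code_at_cat: hc => c1 /(code_at_cat _ (comp_addr a arr))[c2 /code_at_cat[c3 /code_at_cons[f4 _]]].
  rewrite !size_comp_expr [size (comp_addr _ _)]/= in c2 c3 f4.
  move: hd => /= hd.
  have d1 : arr + expr_depth e1 <= q by apply: leq_trans hd; rewrite leq_add2l leq_maxl.
  have d2 : arr.+1 + expr_depth e2 <= q.
    by apply: leq_trans hd; rewrite addSnnS leq_add2l leq_maxr.
  have [m1 [r1 v1 k1 a1]] := comp_expr_ok c1 (leqnn _) d1 hag s1.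
  have [m2 [r2 v2 k2 b2]] := comp_addr_ok c2 hq v1 (ltn_trans ha aq) hl a1.2.
  have a2 := keeps_agree (leqnn _) a1 k2 b2.
  have [m3 [r3 v3 k3 a3]] := comp_expr_ok c3 (leqnSn _) d2 a2 s2.
  have e4 := step_at m3 f4; cbv beta iota zeta in e4.
  have hv : eval st e2 < 2 ^ W by rewrite -v3; apply: a3.2.
  rewrite v3 k3 ?ltnSn // v2 (modn_small hv) in e4.
  exists (mem_upd m3 (q * eval st e1 + a) (eval st e2)); split; last first.
    exact: agree_store a3 ha (ltnW aq) hv.
  rewrite (_ : expr_cost e1 + (expr_cost e2 + 5) = expr_cost e1 + 4 + expr_cost e2 + 1); last by lia.
  rewrite (_ : pos + _ = pos + expr_cost e1 + 4 + expr_cost e2 + 1); last first.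
    by rewrite ?comp_asgE ?comp_seqE ?comp_ifE ?comp_whileE; cbv zeta; rewrite !size_cat !size_comp_expr /=; lia.
  apply: runsD (runsD (runsD r1 r2) r3) _.
  by apply: runsS e4 _; rewrite addn1.
- rewrite comp_seqE in hc; move: hd; rewrite /= => hd; case/code_at_cat: hc => p1 p2.
  have d1 : arr + cmd_depth c1 <= q by apply: leq_trans hd; rewrite leq_add2l leq_maxl.
  have d2 : arr + cmd_depth c2 <= q by apply: leq_trans hd; rewrite leq_add2l leq_maxr.
  have [m1 [r1 a1]] := IH1 _ _ p1 d1 hag.
  have [m2 [r2 a2]] := IH2 _ _ p2 d2 a1.
  exists m2; split=> //; rewrite ?comp_asgE ?comp_seqE ?comp_ifE ?comp_whileE; cbv zeta; rewrite size_cat addnA.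
  exact: runsD r1 r2.
- rewrite comp_ifE in hc.
  have [d0 d1] : arr + expr_depth e <= q /\ arr + cmd_depth c1 <= q.
    by move: hd => /=; lia.
  case/code_at_cat: hc => p0 /code_at_cons[f1 /code_at_cat[p1 /code_at_cons[f2 /code_at_cons[f3 _]]]].
  rewrite !size_comp_expr in f1 p1 f2 f3.
  have [m1 [r1 v1 k1 a1]] := comp_expr_ok p0 (leqnn _) d0 hag s0.
  have e1 := step_at m1 f1; cbv beta iota zeta in e1; rewrite v1 (negbTE he) in e1.
  have [m2 [r2 a2]] := IH _ _ p1 d1 a1.
  have e2 := step_at m2 f2; cbv beta iota zeta in e2.
  rewrite (modn_small pow_gt0) in e2.
  set m3 := mem_upd m2 arr 0 in e2.
  have e3 := step_at m3 f3; cbv beta iota zeta in e3.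
  have v3 : m3 arr = 0 by rewrite /m3 mem_updE eqxx.
  rewrite v3 eqxx in e3.
  exists m3; split; last first.
    by apply: (keeps_agree (leqnn _) a2); [apply: keeps_upd | exact: (@bound_upd m2 arr 0 a2.2 pow_gt0)].
  rewrite (_ : expr_cost e + n + 3 = expr_cost e + (1 + (n + (1 + 1)))); last by lia.
  apply: runsD r1 _; apply: (runsD (n1 := 1) e1).
  apply: runsD r2 _; apply: (runsD (n1 := 1) e2).
  rewrite /runs; apply: etrans e3 _; congr pair.
  rewrite ?comp_asgE ?comp_seqE ?comp_ifE ?comp_whileE; cbv zeta; rewrite !size_cat /= !size_cat /= size_comp_expr; lia.
- rewrite comp_ifE in hc.
  have [d0 d2] : arr + expr_depth e <= q /\ arr + cmd_depth c2 <= q.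
    by move: hd => /=; lia.
  case/code_at_cat: hc => p0 /code_at_cons[f1 /code_at_cat[p1 /code_at_cons[f2 /code_at_cons[f3 p2]]]].
  rewrite !size_comp_expr in f1 p1 f2 f3 p2.
  have [m1 [r1 v1 k1 a1]] := comp_expr_ok p0 (leqnn _) d0 hag s0.
  have e1 := step_at m1 f1; cbv beta iota zeta in e1; rewrite v1 he eqxx in e1.
  set pos2 := pos + expr_cost e + 1 + _ + 2 in e1 p2.
  have ep : pos2 = ((pos + expr_cost e).+1 + size (comp c1 (pos + expr_cost e).+1)).+2.
    by rewrite /pos2; lia.
  rewrite -ep in p2.
  have [m2 [r2 a2]] := IH _ _ p2 d2 a1.
  exists m2; split=> //.
  rewrite (_ : expr_cost e + n + 1 = expr_cost e + (1 + n)); last by lia.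
  apply: runsD r1 _; apply: (runsD (n1 := 1) e1).
  move: r2; rewrite /runs => ->; congr pair.
  rewrite ?comp_asgE ?comp_seqE ?comp_ifE ?comp_whileE; cbv zeta; rewrite !size_cat /= !size_cat /= size_comp_expr -/pos2; lia.
- have [d0 d1] : arr + expr_depth e <= q /\ arr + cmd_depth c <= q.
    by move: hd => /=; lia.
  have hc' := hc; rewrite comp_whileE in hc'.
  case/code_at_cat: hc' => p0 /code_at_cons[f1 /code_at_cat[p1 /code_at_cons[f2 /code_at_cons[f3 _]]]].
  rewrite !size_comp_expr in f1 p1 f2 f3.
  have [m1 [r1 v1 k1 a1]] := comp_expr_ok p0 (leqnn _) d0 hag s0.
  have e1 := step_at m1 f1; cbv beta iota zeta in e1; rewrite v1 (negbTE he) in e1.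
  have [m2 [r2 a2]] := IH1 _ _ p1 d1 a1.
  have e2 := step_at m2 f2; cbv beta iota zeta in e2.
  rewrite (modn_small pow_gt0) in e2.
  set m3 := mem_upd m2 arr 0 in e2.
  have e3 := step_at m3 f3; cbv beta iota zeta in e3.
  have v3 : m3 arr = 0 by rewrite /m3 mem_updE eqxx.
  rewrite v3 eqxx in e3.
  have a3 : agree m3 st1.
    by apply: (keeps_agree (leqnn _) a2); [apply: keeps_upd | exact: (@bound_upd m2 arr 0 a2.2 pow_gt0)].
  have [m4 [r4 a4]] := IH2 _ _ hc hd a3.
  exists m4; split=> //.
  rewrite (_ : expr_cost e + n1 + 3 + n2 = expr_cost e + (1 + (n1 + (1 + (1 + n2))))); last by lia.
  apply: runsD r1 _; apply: (runsD (n1 := 1) e1).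
  apply: runsD r2 _; apply: (runsD (n1 := 1) e2).
  exact: (runsD (n1 := 1) e3).
rewrite comp_whileE in hc; case/code_at_cat: hc => p0 /code_at_cons[f1 _].
have d0 : arr + expr_depth e <= q by move: hd => /=; lia.
rewrite !size_comp_expr in f1.
have [m1 [r1 v1 k1 a1]] := comp_expr_ok p0 (leqnn _) d0 hag s0.
have e1 := step_at m1 f1; cbv beta iota zeta in e1; rewrite v1 he eqxx in e1.
exists m1; split=> //; apply: runsD r1 _; rewrite /runs; apply: etrans e1 _; congr pair.
by rewrite ?comp_asgE ?comp_seqE ?comp_ifE ?comp_whileE; cbv zeta; rewrite !size_cat /= !size_cat /= size_comp_expr; lia.
Qed.

End Compile.

(** * Total correctness with time bounds *)

Section Run.
Variables (lim arr : nat).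

Definition run c (st : state) t (Q : state -> Prop) :=
  exists t' st', [/\ t' <= t, exec lim arr c st t' st' & Q st'].

Lemma run_weaken c st t t' (Q Q' : state -> Prop) : t <= t' ->
  (forall st', Q st' -> Q' st') -> run c st t Q -> run c st t' Q'.
Proof.
move=> h hQ [u [st' [h1 h2 h3]]]; exists u, st'; split=> //; last exact: hQ.
exact: leq_trans h.
Qed.

Lemma run_seq c1 c2 st t1 t2 (Q : state -> Prop) :
  run c1 st t1 (fun st' => run c2 st' t2 Q) -> run (Seq c1 c2) st (t1 + t2) Q.
Proof.
case=> u1 [st1 [h1 e1 [u2 [st2 [h2 e2 q2]]]]].
by exists (u1 + u2), st2; split=> //; [apply: leq_add | apply: ESeq e1 e2].
Qed.

Lemma run_while_step e c st tb t (Q : state -> Prop) : safe lim arr st e ->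
  eval st e != 0 -> run c st tb (fun st' => run (While e c) st' t Q) ->
  run (While e c) st (expr_cost e + tb + 3 + t) Q.
Proof.
move=> s0 he [u1 [st1 [h1 e1 [u2 [st2 [h2 e2 q2]]]]]].
exists (expr_cost e + u1 + 3 + u2), st2; split=> //; last exact: EWhileT e1 e2.
by rewrite leq_add // leq_add2r leq_add2l.
Qed.

Lemma run_while_end e c st (Q : state -> Prop) : safe lim arr st e ->
  eval st e = 0 -> Q st -> run (While e c) st (expr_cost e + 1) Q.
Proof. by move=> s0 he q; exists (expr_cost e + 1), st; split=> //; apply: EWhileF. Qed.

(** The index of the invariant is a variant, and its initial value bounds the number of rounds. *)
Lemma run_while e c tb (I : nat -> state -> Prop) n st :
  (forall n st, I n st -> safe lim arr st e) ->
  (forall n st, I n st -> eval st e != 0 ->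
     run c st tb (fun st' => exists2 n', n' < n & I n' st')) ->
  I n st ->
  run (While e c) st (n * (expr_cost e + tb + 3) + (expr_cost e + 1))
    (fun st' => exists2 n', I n' st' & eval st' e = 0).
Proof.
move=> hs hb; elim/ltn_ind: n st => n IH st hI.
have [h0|hn] := eqVneq (eval st e) 0.
  apply: (run_weaken (leq_addl _ _) _ (run_while_end _ (hs _ _ hI) h0 _)) => [st' h|]; first exact: h.
  by exists n.
have [u [st1 [h1 e1 [n' hn' hI']]]] := hb _ _ hI hn.
have [u2 [st2 [h2 e2 q2]]] := IH _ hn' _ hI'.
exists (expr_cost e + u + 3 + u2), st2; split=> //; last exact: EWhileT (hs _ _ hI) hn e1 e2.
case: n {IH hb hI} hn' => // n hn'.
rewrite mulSn -[X in _ <= X]addnA; apply: leq_add; first by rewrite leq_add2r leq_add2l.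
by apply: leq_trans h2 _; rewrite leq_add2r leq_mul2r -ltnS hn' orbT.
Qed.

Fixpoint cmd_cost c :=
  match c with
  | Skip => 0
  | Asg _ e1 e2 => expr_cost e1 + (expr_cost e2 + 5)
  | Seq c1 c2 => cmd_cost c1 + cmd_cost c2
  | If e c1 c2 => expr_cost e + maxn (cmd_cost c1) (cmd_cost c2) + 3
  | While _ _ => 0
  end.

(* Weakest precondition, for loop-free commands. *)
Fixpoint wp c (Q : state -> Prop) (st : state) : Prop :=
  match c with
  | Skip => Q st
  | Asg a e1 e2 => [/\ a < arr, safe lim arr st e1, safe lim arr st e2, eval st e1 < lim &
      Q (upd2 st a (eval st e1) (eval st e2))]
  | Seq c1 c2 => wp c1 (wp c2 Q) st
  | If e c1 c2 => safe lim arr st e /\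
      (if eval st e != 0 then wp c1 Q st else wp c2 Q st)
  | While _ _ => False
  end.

Lemma run_wp c st (Q : state -> Prop) : wp c Q st -> run c st (cmd_cost c) Q.
Proof.
elim: c st Q => //= [|a e1 e2|c1 IH1 c2 IH2|e c1 IH1 c2 IH2] st Q.
- by move=> h; exists 0, st; split=> //; apply: ESkip.
- by case=> h1 h2 h3 h4 h5; eexists; eexists; split; [| apply: EAsg | exact: h5].
- move/IH1=> h; apply: run_seq; apply: run_weaken h => // st'; exact: IH2.
case=> s0; case: eqP => /= [h0 /IH2|/eqP h0 /IH1] [t [st' [h1 h2 h3]]].
  exists (expr_cost e + t + 1), st'; split=> //; last exact: EIfF.
  by rewrite -addnA -[X in _ <= X]addnA leq_add2l leq_add // leq_max h1 orbT.
exists (expr_cost e + t + 3), st'; split=> //; last exact: EIfT.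
by rewrite -addnA -[X in _ <= X]addnA leq_add2l leq_add // leq_max h1.
Qed.

Lemma run_if e c1 c2 st t (Q : state -> Prop) : safe lim arr st e ->
  (eval st e != 0 -> run c1 st t Q) -> (eval st e = 0 -> run c2 st t Q) ->
  run (If e c1 c2) st (expr_cost e + t + 3) Q.
Proof.
move=> s0 h1 h2; have [/eqP h0|h0] := boolP (eval st e == 0).
  have [u [st' [g1 g2 g3]]] := h2 h0; exists (expr_cost e + u + 1), st'; split=> //.
    by rewrite leq_add // leq_add2l.
  exact: EIfF.
have [u [st' [g1 g2 g3]]] := h1 h0; exists (expr_cost e + u + 3), st'; split=> //.
  by rewrite leq_add2r leq_add2l.
exact: EIfT.
Qed.

End Run.

Notation V r := (Ld r (Cst 0)).
Notation SetV r e := (Asg r (Cst 0) e).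

Lemma updE (st : state) a i v b k :
  upd2 st a i v b k = if (b == a) && (k == i) then v else st b k.
Proof. by []. Qed.

Lemma half_width j : width j.+1 %/ 2 = width j.
Proof. by case: j => // j; rewrite /= expnS mulKn. Qed.

Arguments width : simpl never.

Lemma width_mono i j : i <= j -> width i <= width j.
Proof.
elim: j => [|j IH]; first by rewrite leqn0 => /eqP ->.
rewrite leq_eqVlt => /orP[/eqP -> //|hi].
exact: leq_trans (IH hi) (ltnW (width_gt _)).
Qed.

(** * Programs for van Emde Boas trees *)

Section Veb.
Variables (lim arr H aMn aMx : nat).
Let D := width H.+1.
Let U := 2 ^ D.

(* Arrays 7 to 19 are scratch space for all programs. *)
Definition glob (st : state) := st 3 0 = U /\ st 4 0 = D.

Hypothesis lim_ok : 8 * (U * U) <= lim.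
Hypothesis mn_ok : 20 <= aMn < arr.
Hypothesis mx_ok : 20 <= aMx < arr.
Hypothesis mnx : aMn != aMx.

(** The entry of node [(b, p)] has index [p * U + b]. Prefixes are below [2 * U], so indices are
    quadratic in [U], which dictates [lim]. Cutting off at [b < U] keeps distinct nodes at distinct
    indices. *)
Definition view (st : state) a : nat -> nat -> nat :=
  fun b p => if b < U then st a (p * U + b) else 0.

Lemma view_upd st a b p v : b < U -> view (upd2 st a (p * U + b) v) a = upd2 (view st a) b p v.
Proof.
move=> hb; apply: functional_extensionality => b'; apply: functional_extensionality => p'.
rewrite /view /upd2 eqxx /=; case: ltnP => hb'; last first.
  by case: eqP => // e; move: hb'; rewrite e leqNgt hb.
have U0 : 0 < U by apply: leq_trans hb.
case: eqP => [e|ne].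
  have e1 := congr1 (modn^~ U) e; have e2 := congr1 (divn^~ U) e.
  rewrite /= !modnMDl !modn_small // in e1.
  by move: e2; rewrite /= !divnMDl // !divn_small // !addn0 => ->; rewrite e1 !eqxx.
by case: andP => // -[/eqP e1 /eqP e2]; case: ne; rewrite e1 e2.
Qed.

Lemma view_other st a a' i v : a' != a -> view (upd2 st a i v) a' = view st a'.
Proof.
move=> h; apply: functional_extensionality => b'; apply: functional_extensionality => p'.
by rewrite /view /upd2 (negbTE h).
Qed.

Lemma view_ext (st st' : state) a : st' a =1 st a -> view st' a = view st a.
Proof.
move=> h; apply: functional_extensionality => b'; apply: functional_extensionality => p'.
by rewrite /view h.
Qed.

Lemma viewE st a b p : b < U -> st a (p * U + b) = view st a b p.
Proof. by rewrite /view => ->. Qed.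

Definition key b p := Bin OAdd (Bin OMul p (V 3)) b.

(** One unfolding of [vins], which is tail recursive and so becomes a loop. Variables: 7 width, 8
    prefix, 9 number to insert, 10 and 11 extrema of the node, 12 half the width, 13 prefix of the
    cluster. Width 0 ends the loop. *)
Definition ins_body :=
  Seq (SetV 10 (Ld aMn (key (V 7) (V 8))))
 (Seq (SetV 11 (Ld aMx (key (V 7) (V 8))))
 (Seq (SetV 12 (Bin ODiv (V 7) (Cst 2)))
 (If (Bin OEq (V 10) (Cst 0))
   (Seq (Asg aMn (key (V 7) (V 8)) (V 9))
   (Seq (Asg aMx (key (V 7) (V 8)) (V 9))
        (SetV 7 (Cst 0))))
 (If (Bin OEq (V 10) (V 11))
   (Seq (If (Bin OLt (V 9) (V 10)) (Asg aMn (key (V 7) (V 8)) (V 9))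
                                   (Asg aMx (key (V 7) (V 8)) (V 9)))
        (SetV 7 (Cst 0)))
   (Seq (If (Bin OLt (V 9) (V 10))
          (Seq (Asg aMn (key (V 7) (V 8)) (V 9)) (SetV 9 (V 10)))
        (If (Bin OLt (V 11) (V 9))
          (Seq (Asg aMx (key (V 7) (V 8)) (V 9)) (SetV 9 (V 11)))
          Skip))
   (Seq (SetV 13 (Bin OShr (V 9) (V 12)))
   (Seq (If (Bin OEq (Ld aMn (key (V 12) (V 13))) (Cst 0))
          (Seq (Asg aMn (key (V 12) (V 13)) (V 9))
          (Seq (Asg aMx (key (V 12) (V 13)) (V 9))
               (SetV 9 (V 13))))
          (SetV 8 (V 13)))
        (SetV 7 (V 12))))))))).

Definition ins_loop := While (V 7) ins_body.

Definition only_veb (st st' : state) :=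
  forall a, ~~ (7 <= a < 16) -> a != aMn -> a != aMx -> st' a =1 st a.

Lemma widthU j : j <= H.+1 -> width j < U.
Proof.
by move=> h; apply: (@leq_ltn_trans D); [apply: width_mono | apply: ltn_expl].
Qed.

Let mnF k : k < 20 -> (aMn == k) = false. Proof. by case/andP: mn_ok => h _; lia. Qed.
Let mnF' k : k < 20 -> (k == aMn) = false. Proof. by case/andP: mn_ok => h _; lia. Qed.
Let mxF k : k < 20 -> (aMx == k) = false. Proof. by case/andP: mx_ok => h _; lia. Qed.
Let mxF' k : k < 20 -> (k == aMx) = false. Proof. by case/andP: mx_ok => h _; lia. Qed.
Lemma key_lt b p : b < U -> p < 2 * U -> p * U + b < lim /\ p * U < lim.
Proof.
move=> hb hp; have U0 : 0 < U by rewrite expn_gt0.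
suff h : p * U + b < lim by split=> //; apply: leq_ltn_trans h; rewrite leq_addr.
apply: leq_trans lim_ok; apply: (@leq_trans (p.+1 * U)).
  by rewrite mulSn addnC ltn_add2r.
rewrite mulnA leq_pmul2r //; apply: leq_trans hp _; rewrite leq_mul2r; lia.
Qed.

Definition bnd (f : nat -> nat -> nat) := forall b p, f b p < 2 * U.

Lemma bnd_upd f b p v : bnd f -> v < 2 * U -> bnd (upd2 f b p v).
Proof. by move=> h hv b' p'; rewrite /upd2; case: ifP. Qed.

(* All scratch variables together with the two views; [st0] is the state at the start of the operation. *)
Definition VS st0 (st : state) b p X m M c Y mn mx :=
  [/\ [/\ st 3 0 = U, st 4 0 = D & only_veb st0 st],
      [/\ st 7 0 = b, st 8 0 = p & st 9 0 = X],
      [/\ st 10 0 = m, st 11 0 = M, st 12 0 = c & st 13 0 = Y],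
      view st aMn = mn & view st aMx = mx].

Lemma lim_gt k : k < 8 -> k < lim.
Proof.
have U0 : 0 < U by rewrite expn_gt0.
by move=> h; apply: leq_trans lim_ok; apply: leq_trans h _; rewrite leq_pmulr // muln_gt0 U0.
Qed.

Lemma arr_gt k : k < 20 -> k < arr.
Proof. by case/andP: mn_ok => h1 h2; lia. Qed.

Lemma safe_V st r : r < 20 -> safe lim arr st (V r).
Proof. by move=> h; split=> //=; [apply: arr_gt | apply: lim_gt | apply: lim_gt]. Qed.

Lemma safe_key (st : state) rb rp b p : st 3 0 = U -> rb < 20 -> rp < 20 ->
  st rb 0 = b -> st rp 0 = p -> b < U -> p < 2 * U ->
  safe lim arr st (key (V rb) (V rp)) /\ eval st (key (V rb) (V rp)) = p * U + b.
Proof.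
move=> g3 h1 h2 eb ep hb hp; have [k1 k2] := key_lt hb hp.
split; last by rewrite /= g3 eb ep.
do ?split; rewrite /= ?g3 ?eb ?ep //; do [exact: arr_gt | exact: lim_gt].
Qed.

Lemma wp_vset r e (K : state -> Prop) st0 st b p X m M c Y mn mx v :
  VS st0 st b p X m M c Y mn mx -> 7 <= r < 16 ->
  safe lim arr st e -> eval st e = v ->
  (forall st', VS st0 st' (if r == 7 then v else b) (if r == 8 then v else p)
     (if r == 9 then v else X) (if r == 10 then v else m) (if r == 11 then v else M)
     (if r == 12 then v else c) (if r == 13 then v else Y) mn mx -> K st') ->
  wp lim arr (SetV r e) K st.
Proof.
move=> [[g3 g4 go] [e7 e8 e9] [e10 e11 e12 e13] emn emx] hr hs ev hK.
have r20 : r < 20 by lia.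
split=> //=; [exact: arr_gt | exact: lim_gt | exact: lim_gt |].
rewrite ev; apply: hK; split.
- rewrite !updE !andbT; do 2 (case: eqP => [?|_]; first by lia).
  split=> // a ha h1 h2 i; rewrite updE; case: eqP => [e0|_]; last exact: go.
  by move: ha; rewrite e0 hr.
- by rewrite !updE !andbT ![_ == r]eq_sym e7 e8 e9.
- by rewrite !updE !andbT ![_ == r]eq_sym e10 e11 e12 e13.
- by rewrite view_other ?mnF.
- by rewrite view_other ?mxF.
Qed.

Lemma wp_vmn ke e (K : state -> Prop) st0 st b p X m M c Y mn mx b' p' v :
  VS st0 st b p X m M c Y mn mx ->
  safe lim arr st ke /\ eval st ke = p' * U + b' -> b' < U -> p' < 2 * U ->
  safe lim arr st e -> eval st e = v ->
  (forall st', VS st0 st' b p X m M c Y (upd2 mn b' p' v) mx -> K st') ->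
  wp lim arr (Asg aMn ke e) K st.
Proof.
move=> [[g3 g4 go] [e7 e8 e9] [e10 e11 e12 e13] emn emx] [hk ek] hb hp hs ev hK.
split=> //; first by case/andP: mn_ok.
  by rewrite ek; case: (key_lt hb hp).
rewrite ek ev; apply: hK; split; rewrite ?updE ?mnF' //.
- by split=> // a ha h1 h2 i; rewrite updE (negbTE h1); apply: go.
- by rewrite view_upd ?emn.
- by rewrite view_other ?emx // eq_sym.
Qed.

Lemma wp_vmx ke e (K : state -> Prop) st0 st b p X m M c Y mn mx b' p' v :
  VS st0 st b p X m M c Y mn mx ->
  safe lim arr st ke /\ eval st ke = p' * U + b' -> b' < U -> p' < 2 * U ->
  safe lim arr st e -> eval st e = v ->
  (forall st', VS st0 st' b p X m M c Y mn (upd2 mx b' p' v) -> K st') ->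
  wp lim arr (Asg aMx ke e) K st.
Proof.
move=> [[g3 g4 go] [e7 e8 e9] [e10 e11 e12 e13] emn emx] [hk ek] hb hp hs ev hK.
split=> //; first by case/andP: mx_ok.
  by rewrite ek; case: (key_lt hb hp).
rewrite ek ev; apply: hK; split; rewrite ?updE ?mxF' //.
- by split=> // a ha h1 h2 i; rewrite updE (negbTE h2); apply: go.
- by rewrite view_other ?emn.
- by rewrite view_upd ?emx.
Qed.

Lemma wp_if e c1 c2 (K : state -> Prop) st : safe lim arr st e ->
  (eval st e != 0 -> wp lim arr c1 K st) -> (eval st e = 0 -> wp lim arr c2 K st) ->
  wp lim arr (If e c1 c2) K st.
Proof. by move=> h h1 h2; split=> //; case: eqP => [/h2|/eqP /h1]. Qed.

Lemma wp_ifb e c1 c2 (K : state -> Prop) st (bb : bool) : safe lim arr st e ->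
  eval st e = bb -> (bb -> wp lim arr c1 K st) -> (~~ bb -> wp lim arr c2 K st) ->
  wp lim arr (If e c1 c2) K st.
Proof. by move=> h eb h1 h2; split=> //; rewrite eb; case: bb {eb} h1 h2 => h1 h2; [apply: h1 | apply: h2]. Qed.

Lemma safe_ld st a k i : a < arr -> safe lim arr st k /\ eval st k = i -> i < lim ->
  safe lim arr st (Ld a k).
Proof. by move=> ha [h1 <-] h2; split. Qed.

Let aMn_lt : aMn < arr. Proof. by case/andP: mn_ok. Qed.
Let aMx_lt : aMx < arr. Proof. by case/andP: mx_ok. Qed.

Lemma VS_key st0 st b p X m M c Y mn mx : VS st0 st b p X m M c Y mn mx ->
  b < U -> p < 2 * U ->
  safe lim arr st (key (V 7) (V 8)) /\ eval st (key (V 7) (V 8)) = p * U + b.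
Proof. by case=> [[g3 _ _] [e7 e8 _] _ _ _] hb hp; apply: safe_key. Qed.

Lemma VS_key2 st0 st b p X m M c Y mn mx : VS st0 st b p X m M c Y mn mx ->
  c < U -> Y < 2 * U ->
  safe lim arr st (key (V 12) (V 13)) /\ eval st (key (V 12) (V 13)) = Y * U + c.
Proof. by case=> [[g3 _ _] _ [_ _ e12 e13] _ _] hb hp; apply: safe_key. Qed.

Lemma VS_mn st0 st b p X m M c Y mn mx k b' p' : VS st0 st b p X m M c Y mn mx ->
  b' < U -> p' < 2 * U -> safe lim arr st k /\ eval st k = p' * U + b' ->
  safe lim arr st (Ld aMn k) /\ eval st (Ld aMn k) = mn b' p'.
Proof.
case=> _ _ _ emn _ hb hp hk; split; last by rewrite /= hk.2 viewE ?emn.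
by apply: safe_ld hk _ => //; case: (key_lt hb hp).
Qed.

Lemma VS_mx st0 st b p X m M c Y mn mx k b' p' : VS st0 st b p X m M c Y mn mx ->
  b' < U -> p' < 2 * U -> safe lim arr st k /\ eval st k = p' * U + b' ->
  safe lim arr st (Ld aMx k) /\ eval st (Ld aMx k) = mx b' p'.
Proof.
case=> _ _ _ _ emx hb hp hk; split; last by rewrite /= hk.2 viewE ?emx.
by apply: safe_ld hk _ => //; case: (key_lt hb hp).
Qed.

Ltac wseq := lazymatch goal with
  |- wp ?l ?r (Seq ?a ?b) ?Q ?s => change (wp l r a (wp l r b Q) s) end.

Ltac vnext := let s := fresh "st" in let h := fresh "hvs" in
  match goal with hv : VS _ ?t _ _ _ _ _ _ _ _ _ |- _ =>
    clear dependent t; intros t hv; cbn [eqn eq_op Equality.sort] in hv; simpl in hv end.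

Ltac vsafe H := case: (H) => [[? ? ?] [? ? ?] [? ? ? ?] ? ?];
  do ?split; rewrite /=; try (by apply: arr_gt); try (by apply: lim_gt); try done.

Ltac veval H := let g1 := fresh in let g2 := fresh in let g3 := fresh in
  let h7 := fresh in let h8 := fresh in let h9 := fresh in let h10 := fresh in
  let h11 := fresh in let h12 := fresh in let h13 := fresh in
  case: (H) => [[g1 g2 _] [h7 h8 h9] [h10 h11 h12 h13] _ _];
  rewrite /= ?g1 ?g2 ?h7 ?h8 ?h9 ?h10 ?h11 ?h12 ?h13;
  clear g1 g2 h7 h8 h9 h10 h11 h12 h13.

Ltac vs H := let g := fresh in
  pose proof H as g; destruct g as [[? ? ?] [? ? ?] [? ? ? ?] ? ?].

(** After one round the registers either announce the end or hold the arguments of the pending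
    recursive call; this is the invariant of the loop. *)
Lemma ins_body_ok st0 st j p X mn mx (m M c Y : nat) (Q : state -> Prop) :
  j <= H -> p < 2 * U -> X < 2 * U -> bnd mn -> bnd mx ->
  VS st0 st (width j.+1) p X m M c Y mn mx ->
  (forall st' b' p' X' m' M' c' Y' mn' mx', bnd mn' -> bnd mx' ->
     p' < 2 * U -> X' < 2 * U ->
     VS st0 st' b' p' X' m' M' c' Y' mn' mx' ->
     (b' = 0 /\ vins j.+1 p X mn mx = (mn', mx')) \/
     (b' = width j /\ vins j.+1 p X mn mx = vins j p' X' mn' mx') -> Q st') ->
  wp lim arr ins_body Q st.
Proof.
move=> hj hp hX bmn bmx hvs hQ.
have hb : width j.+1 < U by apply: widthU.
have hc : width j < U by apply: widthU; apply: leqW.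
rewrite /ins_body; wseq.
have [s1 v1] := VS_mn hvs hb hp (VS_key hvs hb hp).
apply: (wp_vset hvs _ s1 v1); first by [].
vnext; wseq.
have [s1 v1] := VS_mx hvs hb hp (VS_key hvs hb hp).
apply: (wp_vset hvs _ s1 v1); first by [].
vnext; wseq.
apply: (wp_vset (v := width j) hvs); first by [].
  by vsafe hvs.
  by veval hvs; rewrite half_width.
vnext.
apply: (wp_ifb (bb := mn (width j.+1) p == 0)) => [||e0|n0].
- by vsafe hvs.
- by veval hvs.
- wseq.
  apply: (wp_vmn (v := X) hvs (VS_key hvs hb hp) hb hp (safe_V _ _)) => //; first by veval hvs.
  vnext; wseq.
  apply: (wp_vmx (v := X) hvs (VS_key hvs hb hp) hb hp (safe_V _ _)) => //; first by veval hvs.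
  vnext.
  apply: (wp_vset (v := 0) hvs); [by [] | by vsafe hvs | by [] | vnext].
  apply: (hQ _ _ _ _ _ _ _ _ _ _ _ _ _ _ hvs); rewrite ?bnd_upd //.
  + exact: bnd_upd.
  + exact: bnd_upd.
  + by left; rewrite /= e0.
apply: (wp_ifb (bb := mn (width j.+1) p == mx (width j.+1) p)) => [||e1|n1].
- by vsafe hvs.
- by veval hvs.
- wseq; apply: (wp_ifb (bb := X < mn (width j.+1) p)) => [||hlt|hge].
  + by vsafe hvs.
  + by veval hvs.
  + apply: (wp_vmn (v := X) hvs (VS_key hvs hb hp) hb hp (safe_V _ _)) => //; first by veval hvs.
    vnext.
    apply: (wp_vset (v := 0) hvs); [by [] | by vsafe hvs | by [] | vnext].
    apply: (hQ _ _ _ _ _ _ _ _ _ _ _ _ _ _ hvs) => //; first exact: bnd_upd.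
    by left; rewrite /= (negbTE n0) e1 hlt.
  apply: (wp_vmx (v := X) hvs (VS_key hvs hb hp) hb hp (safe_V _ _)) => //; first by veval hvs.
  vnext.
  apply: (wp_vset (v := 0) hvs); [by [] | by vsafe hvs | by [] | vnext].
  apply: (hQ _ _ _ _ _ _ _ _ _ _ _ _ _ _ hvs) => //; first exact: bnd_upd.
  by left; rewrite /= (negbTE n0) e1 (negbTE hge).
have go X' mn' mx' st1 : bnd mn' -> bnd mx' -> X' < 2 * U ->
    VS st0 st1 (width j.+1) p X' (mn (width j.+1) p) (mx (width j.+1) p) (width j) Y mn' mx' ->
    vins j.+1 p X mn mx = (let Y' := X' %/ 2 ^ width j in
      if mn' (width j) Y' == 0 then
        vins j p Y' (upd2 mn' (width j) Y' X') (upd2 mx' (width j) Y' X')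
      else vins j Y' X' mn' mx') ->
    wp lim arr (Seq (SetV 13 (Bin OShr (V 9) (V 12)))
   (Seq (If (Bin OEq (Ld aMn (key (V 12) (V 13))) (Cst 0))
          (Seq (Asg aMn (key (V 12) (V 13)) (V 9))
          (Seq (Asg aMx (key (V 12) (V 13)) (V 9))
               (SetV 9 (V 13))))
          (SetV 8 (V 13)))
        (SetV 7 (V 12)))) Q st1.
  move=> bmn' bmx' hX' {}hvs he; clear st; wseq.
  set Y' := X' %/ 2 ^ width j in he.
  have hY : Y' < 2 * U by apply: leq_ltn_trans hX'; apply: leq_div.
  apply: (wp_vset (v := Y') hvs); [by [] | by vsafe hvs | by veval hvs | vnext; wseq].
  have [s1 v1] := VS_mn hvs hc hY (VS_key2 hvs hc hY).
  apply: (wp_ifb (bb := mn' (width j) Y' == 0)) => [||e1|n2].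
  - by split=> //; apply: lim_gt.
  - by rewrite -v1.
  - clear s1 v1; wseq.
    apply: (wp_vmn (v := X') hvs (VS_key2 hvs hc hY) hc hY (safe_V _ _)) => //; first by veval hvs.
    vnext; wseq.
    apply: (wp_vmx (v := X') hvs (VS_key2 hvs hc hY) hc hY (safe_V _ _)) => //; first by veval hvs.
    vnext.
    apply: (wp_vset (v := Y') hvs); [by [] | by vsafe hvs | by veval hvs | vnext].
    apply: (wp_vset (v := width j) hvs); [by [] | by vsafe hvs | by veval hvs | vnext].
    apply: (hQ _ _ _ _ _ _ _ _ _ _ _ _ _ _ hvs) => //; try exact: bnd_upd.
    by right; rewrite he /= e1.
  apply: (wp_vset (v := Y') hvs); [by [] | by vsafe hvs | by veval hvs | vnext].
  apply: (wp_vset (v := width j) hvs); [by [] | by vsafe hvs | by veval hvs | vnext].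
  apply: (hQ _ _ _ _ _ _ _ _ _ _ _ _ _ _ hvs) => //.
  by right; rewrite he /= (negbTE n2).
wseq; apply: (wp_ifb (bb := X < mn (width j.+1) p)) => [||hlt|hge].
- by vsafe hvs.
- by veval hvs.
- wseq.
  apply: (wp_vmn (v := X) hvs (VS_key hvs hb hp) hb hp (safe_V _ _)) => //; first by veval hvs.
  vnext.
  apply: (wp_vset (v := mn (width j.+1) p) hvs); [by [] | by vsafe hvs | by veval hvs | vnext].
  apply: go hvs _ => //; first exact: bnd_upd.
  by rewrite /= (negbTE n0) (negbTE n1) hlt.
apply: (wp_ifb (bb := mx (width j.+1) p < X)) => [||hlt|hge2].
- by vsafe hvs.
- by veval hvs.
- wseq.
  apply: (wp_vmx (v := X) hvs (VS_key hvs hb hp) hb hp (safe_V _ _)) => //; first by veval hvs.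
  vnext.
  apply: (wp_vset (v := mx (width j.+1) p) hvs); [by [] | by vsafe hvs | by veval hvs | vnext].
  apply: go hvs _ => //; first exact: bnd_upd.
  by rewrite /= (negbTE n0) (negbTE n1) (negbTE hge) hlt.
apply: go hvs _ => //.
by rewrite /= (negbTE n0) (negbTE n1) (negbTE hge) (negbTE hge2).
Qed.

Lemma VS_init st b p X : glob st -> st 7 0 = b -> st 8 0 = p -> st 9 0 = X ->
  VS st st b p X (st 10 0) (st 11 0) (st 12 0) (st 13 0) (view st aMn) (view st aMx).
Proof. by case. Qed.

(** Each round goes down one level. Evaluating the loop test costs 6; 3 more per round and 1 at the
    exit give the numbers 9 and 7. *)
Lemma ins_loop_ok st0 st j p X mn mx m M c Y : j <= H.+1 -> p < 2 * U -> X < 2 * U ->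
  bnd mn -> bnd mx -> VS st0 st (width j) p X m M c Y mn mx ->
  run lim arr ins_loop st (j * (cmd_cost ins_body + 9) + 7) (fun st' =>
    [/\ view st' aMn = (vins j p X mn mx).1, view st' aMx = (vins j p X mn mx).2,
        only_veb st0 st', bnd (view st' aMn) & bnd (view st' aMx)]).
Proof.
have stop st1 t b p1 X1 m1 M1 c1 Y1 mn1 mx1 : b = 0 -> bnd mn1 -> bnd mx1 ->
    VS st0 st1 b p1 X1 m1 M1 c1 Y1 mn1 mx1 -> run lim arr ins_loop st1 (t + 7) (fun st' =>
    [/\ view st' aMn = mn1, view st' aMx = mx1, only_veb st0 st',
        bnd (view st' aMn) & bnd (view st' aMx)]).
  move=> b0 bmn bmx h; have [[g1 g2 g3] [e7 _ _] _ emn emx] := h.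
  apply: (run_weaken (leq_addl t 7) (fun _ h => h)); apply: (@run_while_end lim arr (V 7)).
  - exact: safe_V.
  - by rewrite /= e7.
  - by rewrite emn emx.
elim: j st p X mn mx m M c Y => [|j IH] st p X mn mx m M c Y hj hp hX bmn bmx hvs.
  exact: stop hvs.
rewrite (_ : _ + 7 = expr_cost (V 7) + cmd_cost ins_body + 3 + (j * (cmd_cost ins_body + 9) + 7)).
  2: by rewrite mulSn [expr_cost _]/=; lia.
apply: run_while_step; first exact: safe_V.
  by case: hvs => _ [/= -> _ _] _ _ _; rewrite -lt0n; apply: width_pos.
apply: run_wp; apply: (ins_body_ok _ _ _ _ _ hvs) => //.
move=> st' b' p' X' m' M' c' Y' mn' mx' bmn' bmx' hp' hX' hvs' [[b0 ->]|[eb ->]].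
  exact: stop hvs'.
by rewrite eb in hvs'; apply: IH hvs' => //; apply: ltnW.
Qed.

Definition del_go :=
  Seq (SetV 13 (Bin OShr (V 9) (V 12)))
 (Seq (If (Bin OEq (Ld aMn (key (V 12) (V 13))) (Ld aMx (key (V 12) (V 13))))
        (Seq (Asg aMn (key (V 12) (V 13)) (Cst 0))
        (Seq (Asg aMx (key (V 12) (V 13)) (Cst 0))
             (SetV 9 (V 13))))
        (SetV 8 (V 13)))
      (SetV 7 (V 12))).

Definition del_body :=
  Seq (SetV 10 (Ld aMn (key (V 7) (V 8))))
 (Seq (SetV 11 (Ld aMx (key (V 7) (V 8))))
 (Seq (SetV 12 (Bin ODiv (V 7) (Cst 2)))
 (If (Bin OEq (V 10) (V 11))
   (Seq (Asg aMn (key (V 7) (V 8)) (Cst 0))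
   (Seq (Asg aMx (key (V 7) (V 8)) (Cst 0))
        (SetV 7 (Cst 0))))
 (If (Bin OEq (V 9) (V 10))
   (Seq (SetV 13 (Ld aMn (key (V 12) (V 8))))
   (If (Bin OEq (V 13) (Cst 0))
     (Seq (Asg aMn (key (V 7) (V 8)) (V 11)) (SetV 7 (Cst 0)))
     (Seq (SetV 9 (Ld aMn (key (V 12) (V 13))))
     (Seq (Asg aMn (key (V 7) (V 8)) (V 9)) del_go))))
 (If (Bin OEq (V 9) (V 11))
   (Seq (SetV 13 (Ld aMn (key (V 12) (V 8))))
   (If (Bin OEq (V 13) (Cst 0))
     (Seq (Asg aMx (key (V 7) (V 8)) (V 10)) (SetV 7 (Cst 0)))
     (Seq (SetV 13 (Ld aMx (key (V 12) (V 8))))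
     (Seq (SetV 9 (Ld aMx (key (V 12) (V 13))))
     (Seq (Asg aMx (key (V 7) (V 8)) (V 9)) del_go)))))
   del_go))))).

Definition del_loop := While (V 7) del_body.

Lemma VS_key3 st0 st b p X m M c Y mn mx : VS st0 st b p X m M c Y mn mx ->
  c < U -> p < 2 * U ->
  safe lim arr st (key (V 12) (V 8)) /\ eval st (key (V 12) (V 8)) = p * U + c.
Proof. by case=> [[g3 _ _] [_ e8 _] [_ _ e12 _] _ _] hb hp; apply: safe_key. Qed.

Lemma del_body_ok st0 st j p X mn mx (m M c Y : nat) (Q : state -> Prop) :
  j <= H -> p < 2 * U -> X < 2 * U -> bnd mn -> bnd mx ->
  VS st0 st (width j.+1) p X m M c Y mn mx ->
  (forall st' b' p' X' m' M' c' Y' mn' mx', bnd mn' -> bnd mx' ->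
     p' < 2 * U -> X' < 2 * U ->
     VS st0 st' b' p' X' m' M' c' Y' mn' mx' ->
     (b' = 0 /\ vdel j.+1 p X mn mx = (mn', mx')) \/
     (b' = width j /\ vdel j.+1 p X mn mx = vdel j p' X' mn' mx') -> Q st') ->
  wp lim arr del_body Q st.
Proof.
move=> hj hp hX bmn bmx hvs hQ.
have hb : width j.+1 < U by apply: widthU.
have hc : width j < U by apply: widthU; apply: leqW.
have U2 : 0 < 2 * U by rewrite muln_gt0 expn_gt0.
have go X' M0 Y0 m0 mn' mx' st1 : bnd mn' -> bnd mx' -> X' < 2 * U ->
    VS st0 st1 (width j.+1) p X' m0 M0 (width j) Y0 mn' mx' ->
    vdel j.+1 p X mn mx = (let Y' := X' %/ 2 ^ width j in
      if mn' (width j) Y' == mx' (width j) Y' then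
        vdel j p Y' (upd2 mn' (width j) Y' 0) (upd2 mx' (width j) Y' 0)
      else vdel j Y' X' mn' mx') ->
    wp lim arr del_go Q st1.
  move=> bmn' bmx' hX' {}hvs he; clear st; rewrite /del_go; wseq.
  set Y' := X' %/ 2 ^ width j in he.
  have hY : Y' < 2 * U by apply: leq_ltn_trans hX'; apply: leq_div.
  apply: (wp_vset (v := Y') hvs); [by [] | by vsafe hvs | by veval hvs | vnext; wseq].
  have [s1 v1] := VS_mn hvs hc hY (VS_key2 hvs hc hY).
  have [s2 v2] := VS_mx hvs hc hY (VS_key2 hvs hc hY).
  apply: (wp_ifb (bb := mn' (width j) Y' == mx' (width j) Y')) => [||e1|n2].
  - by split.
  - by rewrite -v1 -v2.
  - clear s1 v1 s2 v2; wseq.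
    apply: (wp_vmn (v := 0) hvs (VS_key2 hvs hc hY) hc hY) => //; first exact: lim_gt.
    vnext; wseq.
    apply: (wp_vmx (v := 0) hvs (VS_key2 hvs hc hY) hc hY) => //; first exact: lim_gt.
    vnext.
    apply: (wp_vset (v := Y') hvs); [by [] | by vsafe hvs | by veval hvs | vnext].
    apply: (wp_vset (v := width j) hvs); [by [] | by vsafe hvs | by veval hvs | vnext].
    apply: (hQ _ _ _ _ _ _ _ _ _ _ _ _ _ _ hvs) => //; try exact: bnd_upd.
    by right; rewrite he /= e1.
  apply: (wp_vset (v := Y') hvs); [by [] | by vsafe hvs | by veval hvs | vnext].
  apply: (wp_vset (v := width j) hvs); [by [] | by vsafe hvs | by veval hvs | vnext].
  apply: (hQ _ _ _ _ _ _ _ _ _ _ _ _ _ _ hvs) => //.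
  by right; rewrite he /= (negbTE n2).
rewrite /del_body; wseq.
have [s1 v1] := VS_mn hvs hb hp (VS_key hvs hb hp).
apply: (wp_vset hvs _ s1 v1); first by [].
vnext; wseq.
have [s1 v1] := VS_mx hvs hb hp (VS_key hvs hb hp).
apply: (wp_vset hvs _ s1 v1); first by [].
vnext; wseq.
apply: (wp_vset (v := width j) hvs); first by [].
  by vsafe hvs.
  by veval hvs; rewrite half_width.
vnext.
apply: (wp_ifb (bb := mn (width j.+1) p == mx (width j.+1) p)) => [||e1|n1].
- by vsafe hvs.
- by veval hvs.
- wseq.
  apply: (wp_vmn (v := 0) hvs (VS_key hvs hb hp) hb hp) => //; first exact: lim_gt.
  vnext; wseq.
  apply: (wp_vmx (v := 0) hvs (VS_key hvs hb hp) hb hp) => //; first exact: lim_gt.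
  vnext.
  apply: (wp_vset (v := 0) hvs); [by [] | by vsafe hvs | by [] | vnext].
  apply: (hQ _ _ _ _ _ _ _ _ _ _ _ _ _ _ hvs) => //; try exact: bnd_upd.
  by left; rewrite /= e1.
apply: (wp_ifb (bb := X == mn (width j.+1) p)) => [||e2|n2].
- by vsafe hvs.
- by veval hvs.
- wseq.
  have [s1 v1] := VS_mn hvs hc hp (VS_key3 hvs hc hp).
  apply: (wp_vset hvs _ s1 v1); first by [].
  vnext.
  apply: (wp_ifb (bb := mn (width j) p == 0)) => [||e3|n3].
  + by vsafe hvs.
  + by veval hvs.
  + wseq; apply: (wp_vmn (v := mx (width j.+1) p) hvs (VS_key hvs hb hp) hb hp (safe_V _ _)) => //; first by veval hvs.
    vnext.
    apply: (wp_vset (v := 0) hvs); [by [] | by vsafe hvs | by [] | vnext].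
    apply: (hQ _ _ _ _ _ _ _ _ _ _ _ _ _ _ hvs) => //; try exact: bnd_upd.
    by left; rewrite /= (negbTE n1) e2 e3.
  wseq; have hq : mn (width j) p < 2 * U by [].
  have [s1 v1] := VS_mn hvs hc hq (VS_key2 hvs hc hq).
  apply: (wp_vset hvs _ s1 v1); first by [].
  vnext; wseq.
  apply: (wp_vmn (v := mn (width j) (mn (width j) p)) hvs (VS_key hvs hb hp) hb hp (safe_V _ _)) => //; first by veval hvs.
  vnext.
  apply: go hvs _ => //; first exact: bnd_upd.
  by rewrite /= (negbTE n1) e2 (negbTE n3).
apply: (wp_ifb (bb := X == mx (width j.+1) p)) => [||e2|n2'].
- by vsafe hvs.
- by veval hvs.
- wseq.
  have [s1 v1] := VS_mn hvs hc hp (VS_key3 hvs hc hp).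
  apply: (wp_vset hvs _ s1 v1); first by [].
  vnext.
  apply: (wp_ifb (bb := mn (width j) p == 0)) => [||e3|n3].
  + by vsafe hvs.
  + by veval hvs.
  + wseq; apply: (wp_vmx (v := mn (width j.+1) p) hvs (VS_key hvs hb hp) hb hp (safe_V _ _)) => //; first by veval hvs.
    vnext.
    apply: (wp_vset (v := 0) hvs); [by [] | by vsafe hvs | by [] | vnext].
    apply: (hQ _ _ _ _ _ _ _ _ _ _ _ _ _ _ hvs) => //; try exact: bnd_upd.
    by left; rewrite /= (negbTE n1) (negbTE n2) e2 e3.
  wseq; have [s1 v1] := VS_mx hvs hc hp (VS_key3 hvs hc hp).
  apply: (wp_vset hvs _ s1 v1); first by [].
  vnext; wseq; have hq : mx (width j) p < 2 * U by [].
  have [s1 v1] := VS_mx hvs hc hq (VS_key2 hvs hc hq).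
  apply: (wp_vset hvs _ s1 v1); first by [].
  vnext; wseq.
  apply: (wp_vmx (v := mx (width j) (mx (width j) p)) hvs (VS_key hvs hb hp) hb hp (safe_V _ _)) => //; first by veval hvs.
  vnext.
  apply: go hvs _ => //; first exact: bnd_upd.
  by rewrite /= (negbTE n1) (negbTE n2) e2 (negbTE n3).
apply: go hvs _ => //.
by rewrite /= (negbTE n1) (negbTE n2) (negbTE n2').
Qed.

Lemma del_loop_ok st0 st j p X mn mx m M c Y : j <= H.+1 -> p < 2 * U -> X < 2 * U ->
  bnd mn -> bnd mx -> VS st0 st (width j) p X m M c Y mn mx ->
  run lim arr del_loop st (j * (cmd_cost del_body + 9) + 7) (fun st' =>
    [/\ view st' aMn = (vdel j p X mn mx).1, view st' aMx = (vdel j p X mn mx).2,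
        only_veb st0 st', bnd (view st' aMn) & bnd (view st' aMx)]).
Proof.
have stop st1 t b p1 X1 m1 M1 c1 Y1 mn1 mx1 : b = 0 -> bnd mn1 -> bnd mx1 ->
    VS st0 st1 b p1 X1 m1 M1 c1 Y1 mn1 mx1 -> run lim arr del_loop st1 (t + 7) (fun st' =>
    [/\ view st' aMn = mn1, view st' aMx = mx1, only_veb st0 st',
        bnd (view st' aMn) & bnd (view st' aMx)]).
  move=> b0 bmn bmx h; have [[g1 g2 g3] [e7 _ _] _ emn emx] := h.
  apply: (run_weaken (leq_addl t 7) (fun _ h => h)); apply: (@run_while_end lim arr (V 7)).
  - exact: safe_V.
  - by rewrite /= e7.
  - by rewrite emn emx.
elim: j st p X mn mx m M c Y => [|j IH] st p X mn mx m M c Y hj hp hX bmn bmx hvs.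
  exact: stop hvs.
rewrite (_ : _ + 7 = expr_cost (V 7) + cmd_cost del_body + 3 + (j * (cmd_cost del_body + 9) + 7)).
  2: by rewrite mulSn [expr_cost _]/=; lia.
apply: run_while_step; first exact: safe_V.
  by case: hvs => _ [/= -> _ _] _ _ _; rewrite -lt0n; apply: width_pos.
apply: run_wp; apply: (del_body_ok _ _ _ _ _ hvs) => //.
move=> st' b' p' X' m' M' c' Y' mn' mx' bmn' bmx' hp' hX' hvs' [[b0 ->]|[eb ->]].
  exact: stop hvs'.
by rewrite eb in hvs'; apply: IH hvs' => //; apply: ltnW.
Qed.

Definition VSP st0 (st : state) b p X m M c Y R F mn mx :=
  [/\ VS st0 st b p X m M c Y mn mx, st 14 0 = R & forall i, st 15 i = F i].

Lemma wp_pset r e (K : state -> Prop) st0 st b p X m M c Y R F mn mx v :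
  VSP st0 st b p X m M c Y R F mn mx -> 7 <= r < 15 ->
  safe lim arr st e -> eval st e = v ->
  (forall st', VSP st0 st' (if r == 7 then v else b) (if r == 8 then v else p)
     (if r == 9 then v else X) (if r == 10 then v else m) (if r == 11 then v else M)
     (if r == 12 then v else c) (if r == 13 then v else Y) (if r == 14 then v else R)
     F mn mx -> K st') ->
  wp lim arr (SetV r e) K st.
Proof.
move=> [hvs eR eF] hr hs ev hK.
have : wp lim arr (SetV r e) (eq (upd2 st r 0 v)) st.
  have r20 : r < 20 by lia.
  by split=> //=; [exact: arr_gt | exact: lim_gt | exact: lim_gt | rewrite ev].
have hr' : 7 <= r < 16 by lia.
move=> [w1 w2 w3 w4 _]; split=> //; rewrite ev; apply: hK.
have : wp lim arr (SetV r e) (fun st' => st' = upd2 st r 0 v ->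
    VS st0 st' (if r == 7 then v else b) (if r == 8 then v else p)
     (if r == 9 then v else X) (if r == 10 then v else m) (if r == 11 then v else M)
     (if r == 12 then v else c) (if r == 13 then v else Y) mn mx) st.
  by apply: (wp_vset hvs hr' hs ev).
move=> [_ _ _ _]; rewrite ev => /(_ erefl) h; split=> //.
  by rewrite updE andbT [14 == r]eq_sym eR.
by move=> i; rewrite updE; case: eqP => [e0|_] /=; [lia | apply: eF].
Qed.

Lemma wp_pflag n (K : state -> Prop) st0 st b p X m M c Y R F mn mx :
  VSP st0 st b p X m M c Y R F mn mx -> 0 < b < lim -> n < 2 ->
  (forall st', VSP st0 st' b p X m M c Y R (fun i => if i == b then n else F i) mn mx ->
     K st') ->
  wp lim arr (Asg 15 (V 7) (Cst n)) K st.
Proof.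
move=> [[[g3 g4 go] [e7 e8 e9] [e10 e11 e12 e13] emn emx] eR eF] /andP[b0 hb] hn hK.
split; rewrite /= ?e7 //; [exact: arr_gt | exact: safe_V | apply: lim_gt; lia | ].
apply: hK; split; first split; rewrite ?updE //.
- split=> // a ha h1 h2 i; rewrite updE; case: eqP => [e0|_]; last exact: go.
  by rewrite e0 in ha.
- by rewrite view_other ?mnF.
- by rewrite view_other ?mxF.
- by move=> i; rewrite updE /=; case: ifP.
Qed.

Lemma VSP_VS st0 st b p X m M c Y R F mn mx :
  VSP st0 st b p X m M c Y R F mn mx -> VS st0 st b p X m M c Y mn mx.
Proof. by case. Qed.

(** The descent of [vpred]. Since its summary case is no tail call, array 15 records, indexed by
    width, which way each level went; the flag is also written when it is 0, as earlier queries
    leave theirs behind. Variable 10 finally holds the width where the search stopped, from which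
    the ascent starts. *)
Definition pred_body :=
  Seq (SetV 11 (Ld aMx (key (V 7) (V 8))))
 (Seq (SetV 12 (Bin ODiv (V 7) (Cst 2)))
 (If (Bin OLt (V 11) (V 9))
   (Seq (SetV 14 (V 11)) (Seq (SetV 10 (V 7)) (SetV 7 (Cst 0))))
   (Seq (SetV 13 (Bin OShr (V 9) (V 12)))
   (Seq (SetV 10 (Ld aMn (key (V 12) (V 13))))
   (If (Bin OMul (Bin OLt (Cst 0) (V 10)) (Bin OLt (V 10) (V 9)))
     (Seq (Asg 15 (V 7) (Cst 0)) (Seq (SetV 8 (V 13)) (SetV 7 (V 12))))
     (Seq (SetV 10 (Ld aMn (key (V 12) (V 8))))
     (If (Bin OMul (Bin OLt (Cst 0) (V 10)) (Bin OLt (V 10) (V 13)))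
       (Seq (Asg 15 (V 7) (Cst 1)) (Seq (SetV 9 (V 13)) (SetV 7 (V 12))))
       (Seq (SetV 14 (Ld aMn (key (V 7) (V 8))))
       (Seq (SetV 10 (V 7)) (SetV 7 (Cst 0))))))))))).

Definition asc_body :=
  Seq (SetV 11 (V 10))
 (Seq (SetV 10 (Bin OMul (V 10) (Cst 2)))
 (If (Ld 15 (V 10)) (SetV 14 (Ld aMx (key (V 11) (V 14)))) Skip)).

(** [vpred] presupposes a member below the query, which the opening test ensures. Otherwise the
    answer is 0, never a member. *)
Definition pred_prog :=
  Seq (Seq (SetV 7 (V 4)) (Seq (SetV 8 (Cst 1))
      (Seq (SetV 10 (Ld aMn (key (V 7) (V 8)))) (SetV 14 (Cst 0)))))
 (If (Bin OMul (Bin OLt (Cst 0) (V 10)) (Bin OLt (V 10) (V 9)))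
   (Seq (While (V 7) pred_body) (While (Bin OLt (V 10) (V 4)) asc_body))
   Skip).

(* [F] flags the levels at which the search descended into the summary; there the cluster found is replaced by its maximum on the way up. *)
Fixpoint asc (mx : nat -> nat -> nat) (F : nat -> nat) i k R :=
  if k is k'.+1 then
    let R' := asc mx F i k' R in
    if F (width (i + k)) != 0 then mx (width (i + k')) R' else R'
  else R.

Ltac vnextp := match goal with hv : VSP _ ?t _ _ _ _ _ _ _ _ _ _ _ |- _ =>
    clear dependent t; intros t hv; cbn [eqn eq_op Equality.sort] in hv; simpl in hv end.

Ltac psafe H := case: (H) => [[[? ? ?] [? ? ?] [? ? ? ?] ? ?] ? ?];
  do ?split; rewrite /=; try (by apply: arr_gt); try (by apply: lim_gt); try done.

Ltac peval H := let g1 := fresh in let g2 := fresh in let g3 := fresh in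
  let h7 := fresh in let h8 := fresh in let h9 := fresh in let h10 := fresh in
  let h11 := fresh in let h12 := fresh in let h13 := fresh in let h14 := fresh in
  case: (H) => [[[g1 g2 _] [h7 h8 h9] [h10 h11 h12 h13] _ _] h14 _];
  rewrite /= ?g1 ?g2 ?h7 ?h8 ?h9 ?h10 ?h11 ?h12 ?h13 ?h14;
  clear g1 g2 h7 h8 h9 h10 h11 h12 h13 h14.

Lemma pred_body_ok st0 st j p X mn mx (m M c Y R : nat) F (Q : state -> Prop) :
  j <= H -> p < 2 * U -> X < 2 * U -> bnd mn -> bnd mx ->
  VSP st0 st (width j.+1) p X m M c Y R F mn mx ->
  (forall st' b' p' X' m' M' c' Y' R' F', p' < 2 * U -> X' < 2 * U ->
     VSP st0 st' b' p' X' m' M' c' Y' R' F' mn mx ->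
     [\/ [/\ b' = 0, m' = width j.+1, F' = F & vpred j.+1 p X mn mx = R'],
         [/\ b' = width j, 0 < mn (width j) p' < X',
           F' = (fun i => if i == width j.+1 then 0 else F i) &
           vpred j.+1 p X mn mx = vpred j p' X' mn mx] |
         [/\ b' = width j, 0 < mn (width j) p' < X',
           F' = (fun i => if i == width j.+1 then 1 else F i) &
           vpred j.+1 p X mn mx = mx (width j) (vpred j p' X' mn mx)]] -> Q st') ->
  wp lim arr pred_body Q st.
Proof.
move=> hj hp hX bmn bmx hvs hQ.
have hb : width j.+1 < U by apply: widthU.
have hc : width j < U by apply: widthU; apply: leqW.
have hbl : 0 < width j.+1 < lim.
  rewrite width_pos //=; apply: ltn_trans hb _; apply: leq_trans lim_ok.
  have U0 : 0 < U by rewrite expn_gt0.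
  by rewrite mulnA -[X in X < _]mul1n ltn_pmul2r //; lia.
rewrite /pred_body; wseq.
have [s1 v1] := VS_mx (VSP_VS hvs) hb hp (VS_key (VSP_VS hvs) hb hp).
apply: (wp_pset hvs _ s1 v1); first by [].
vnextp; wseq.
apply: (wp_pset (v := width j) hvs); first by [].
  by psafe hvs.
  by peval hvs; rewrite half_width.
vnextp.
apply: (wp_ifb (bb := mx (width j.+1) p < X)) => [||h1|h1].
- by psafe hvs.
- by peval hvs.
- wseq.
  apply: (wp_pset (v := mx (width j.+1) p) hvs); [by [] | by psafe hvs | by peval hvs | vnextp; wseq].
  apply: (wp_pset (v := width j.+1) hvs); [by [] | by psafe hvs | by peval hvs | vnextp].
  apply: (wp_pset (v := 0) hvs); [by [] | by psafe hvs | by [] | vnextp].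
  apply: (hQ _ _ _ _ _ _ _ _ _ _ _ _ hvs) => //.
  by constructor 1; split=> //=; rewrite h1.
wseq; set Y' := X %/ 2 ^ width j.
have hY : Y' < 2 * U by apply: leq_ltn_trans hX; apply: leq_div.
apply: (wp_pset (v := Y') hvs); [by [] | by psafe hvs | by peval hvs | vnextp; wseq].
have [s1 v1] := VS_mn (VSP_VS hvs) hc hY (VS_key2 (VSP_VS hvs) hc hY).
apply: (wp_pset hvs _ s1 v1); first by [].
vnextp.
apply: (wp_ifb (bb := 0 < mn (width j) Y' < X)) => [||h2|h2].
- by psafe hvs; rewrite mulnb; apply: lim_gt; case: (_ && _).
- by peval hvs; rewrite mulnb.
- wseq; apply: (wp_pflag hvs) => //; vnextp; wseq.
  apply: (wp_pset (v := Y') hvs); [by [] | by psafe hvs | by peval hvs | vnextp].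
  apply: (wp_pset (v := width j) hvs); [by [] | by psafe hvs | by peval hvs | vnextp].
  apply: (hQ _ _ _ _ _ _ _ _ _ _ _ _ hvs) => //.
  by constructor 2; split=> //=; rewrite (negbTE h1) -/Y' h2.
wseq.
have [s1 v1] := VS_mn (VSP_VS hvs) hc hp (VS_key3 (VSP_VS hvs) hc hp).
apply: (wp_pset hvs _ s1 v1); first by [].
vnextp.
apply: (wp_ifb (bb := 0 < mn (width j) p < Y')) => [||h3|h3].
- by psafe hvs; rewrite mulnb; apply: lim_gt; case: (_ && _).
- by peval hvs; rewrite mulnb.
- wseq; apply: (wp_pflag hvs) => //; vnextp; wseq.
  apply: (wp_pset (v := Y') hvs); [by [] | by psafe hvs | by peval hvs | vnextp].
  apply: (wp_pset (v := width j) hvs); [by [] | by psafe hvs | by peval hvs | vnextp].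
  apply: (hQ _ _ _ _ _ _ _ _ _ _ _ _ hvs) => //.
  by constructor 3; split=> //=; rewrite (negbTE h1) -/Y' (negbTE h2) h3.
wseq.
have [s1 v1] := VS_mn (VSP_VS hvs) hb hp (VS_key (VSP_VS hvs) hb hp).
apply: (wp_pset hvs _ s1 v1); first by [].
vnextp; wseq.
apply: (wp_pset (v := width j.+1) hvs); [by [] | by psafe hvs | by peval hvs | vnextp].
apply: (wp_pset (v := 0) hvs); [by [] | by psafe hvs | by [] | vnextp].
apply: (hQ _ _ _ _ _ _ _ _ _ _ _ _ hvs) => //.
by constructor 1; split=> //=; rewrite (negbTE h1) -/Y' (negbTE h2) (negbTE h3).
Qed.

Lemma vpred_bnd j p X mn mx : bnd mn -> bnd mx -> vpred j p X mn mx < 2 * U.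
Proof.
move=> bmn bmx; elim: j p X => [|j IH] p X /=; first by rewrite muln_gt0 expn_gt0.
by do 3 ?[case: ifP => _ //].
Qed.

(** The search stops at level [i] with result [R'], from which the flags rebuild the value of
    [vpred]. Flags of larger widths are left alone by deeper rounds, so all those written on the way
    down survive until the ascent. *)
Lemma desc_ok st0 st j p X mn mx m M c Y R F : j <= H.+1 -> p < 2 * U -> X < 2 * U ->
  bnd mn -> bnd mx -> (forall q, mn 0 q = 0) -> 0 < mn (width j) p < X ->
  VSP st0 st (width j) p X m M c Y R F mn mx ->
  run lim arr (While (V 7) pred_body) st (j * (cmd_cost pred_body + 9) + 7) (fun st' =>
    exists b' p' X' M' c' Y' R' F' i k, [/\ j = i + k, 0 < i,
      asc mx F' i k R' = vpred j p X mn mx,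
      R' < 2 * U /\ (forall b, width j < b -> F' b = F b) &
      VSP st0 st' b' p' X' (width i) M' c' Y' R' F' mn mx]).
Proof.
elim: j st p X m M c Y R F => [|j IH] st p X m M c Y R F hj hp hX bmn bmx hz hmn hvs.
  by rewrite hz in hmn.
rewrite (_ : _ + 7 = expr_cost (V 7) + cmd_cost pred_body + 3 + (j * (cmd_cost pred_body + 9) + 7)).
  2: by rewrite mulSn [expr_cost _]/=; lia.
apply: run_while_step; first exact: safe_V.
  by case: hvs => -[_ [/= -> _ _] _ _ _] _ _; rewrite -lt0n; apply: width_pos.
apply: run_wp; apply: (pred_body_ok _ _ _ _ _ hvs) => //.
move=> st' b' p' X' m' M' c' Y' R' F' hp' hX' hvs' [[b0 em eF eR]|[eb hmn' eF eR]|[eb hmn' eF eR]].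
- apply: (run_weaken (leq_addl _ 7) (fun _ h => h)); apply: (@run_while_end lim arr (V 7)).
  + exact: safe_V.
  + by case: hvs' => -[_ [/= -> _ _] _ _ _].
  have hR' : R' < 2 * U by rewrite -eR; apply: vpred_bnd.
  exists b', p', X', M', c', Y', R', F', j.+1, 0; rewrite addn0; split=> //.
    by split=> // b hb; rewrite eF.
  by rewrite -em.
- rewrite eb in hvs'; apply: run_weaken (IH _ _ _ _ _ _ _ _ _ (ltnW hj) hp' hX' bmn bmx hz hmn' hvs') => // {hvs'}.
  move=> st1 [b1 [p1 [X1 [M1 [c1 [Y1 [R1 [F1 [i [k [ej i0 ea [hR1 hF1] hv]]]]]]]]]]].
  exists b1, p1, X1, M1, c1, Y1, R1, F1, i, k.+1; split=> //.
  + by rewrite ej addnS.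
  + by rewrite [asc _ _ _ _ _]/= addnS -ej (hF1 _ (width_gt j)) eF !eqxx ea eR.
  + split=> // b hb; rewrite hF1 ?eF; last exact: ltn_trans (width_gt j) hb.
    by rewrite gtn_eqF.
rewrite eb in hvs'; apply: run_weaken (IH _ _ _ _ _ _ _ _ _ (ltnW hj) hp' hX' bmn bmx hz hmn' hvs') => // {hvs'}.
move=> st1 [b1 [p1 [X1 [M1 [c1 [Y1 [R1 [F1 [i [k [ej i0 ea [hR1 hF1] hv]]]]]]]]]]].
exists b1, p1, X1, M1, c1, Y1, R1, F1, i, k.+1; split=> //.
- by rewrite ej addnS.
- by rewrite [asc _ _ _ _ _]/= addnS -ej (hF1 _ (width_gt j)) eF !eqxx eR -ea.
- split=> // b hb; rewrite hF1 ?eF; last exact: ltn_trans (width_gt j) hb.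
  by rewrite gtn_eqF.
Qed.

Lemma asc_ok st0 st i k n mn mx b p X M c Y R F : i + k + n = H.+1 -> 0 < i ->
  bnd mx -> asc mx F i k R < 2 * U ->
  VSP st0 st b p X (width (i + k)) M c Y (asc mx F i k R) F mn mx ->
  run lim arr (While (Bin OLt (V 10) (V 4)) asc_body) st (n * (cmd_cost asc_body + 16) + 14)
   (fun st' => exists M', VSP st0 st' b p X D M' c Y (asc mx F i (k + n) R) F mn mx).
Proof.
elim: n k st M => [|n IH] k st M en i0 bmx hR hvs.
  rewrite addn0; apply: (run_weaken (leq_addl _ 14) (fun _ h => h)).
  apply: (@run_while_end lim arr (Bin OLt (V 10) (V 4))); first by split=> //; apply: safe_V.
    by peval hvs; rewrite /D -en addn0 ltnn.
  by exists M; move: hvs; rewrite /D -en addn0.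
rewrite (_ : _ + 14 = expr_cost (Bin OLt (V 10) (V 4)) + cmd_cost asc_body + 3 + (n * (cmd_cost asc_body + 16) + 14)).
  2: by rewrite mulSn [expr_cost _]/=; lia.
have hik : i + k < H.+1 by lia.
apply: run_while_step; first by split=> //; apply: safe_V.
  peval hvs; rewrite (_ : width (i + k) < D) // /D.
  by apply: leq_trans (width_gt _) (width_mono _).
apply: run_wp; rewrite /asc_body; wseq.
have hw : width (i + k.+1) = width (i + k) * 2.
  by rewrite addnS width_half ?addn_gt0 ?i0 // muln2 addnn.
have hwU : width (i + k.+1) < U by apply: widthU; lia.
have hwU' : width (i + k) < U by apply: widthU; lia.
have hUl : U < lim.
  apply: leq_trans lim_ok; have U0 : 0 < U by rewrite expn_gt0.
  by rewrite mulnA -[X in X < _]mul1n ltn_pmul2r //; lia.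
apply: (wp_pset (v := width (i + k)) hvs); [by [] | by psafe hvs | by peval hvs | vnextp; wseq].
apply: (wp_pset (v := width (i + k.+1)) hvs); [by [] | | by peval hvs | vnextp].
  by psafe hvs; peval hvs; rewrite -hw; apply: ltn_trans hwU hUl.
have eF : st 15 (width (i + k.+1)) = F (width (i + k.+1)) by case: hvs.
have fin st1 : VSP st0 st1 b p X (width (i + k.+1)) (width (i + k)) c Y (asc mx F i k.+1 R) F mn mx ->
   run lim arr (While (Bin OLt (V 10) (V 4)) asc_body) st1 (n * (cmd_cost asc_body + 16) + 14)
   (fun st' => exists M', VSP st0 st' b p X D M' c Y (asc mx F i (k + n.+1) R) F mn mx).
  move=> h; rewrite (addnS k n) -addSn; apply: IH h => //; first by lia.
  by rewrite /=; case: ifP.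
have s15 : safe lim arr st (Ld 15 (V 10)) /\ eval st (Ld 15 (V 10)) = F (width (i + k.+1)).
  by split; [psafe hvs; peval hvs; apply: ltn_trans hwU hUl | peval hvs].
apply: wp_if; first exact: s15.1.
  rewrite s15.2 => h1.
  have hk : safe lim arr st (key (V 11) (V 14)) /\
      eval st (key (V 11) (V 14)) = asc mx F i k R * U + width (i + k).
    by case: hvs => -[[g3 _ _] _ [_ e11 _ _] _ _] e14 _; apply: safe_key.
  have [s1 v1] := VS_mx (VSP_VS hvs) hwU' hR hk.
  apply: (wp_pset hvs _ s1 v1); first by [].
  vnextp; apply: fin.
  by rewrite [asc _ _ _ k.+1 _]/= h1.
rewrite s15.2 => h1; apply: fin.
by rewrite [asc _ _ _ k.+1 _]/= h1.
Qed.

Lemma VSP_init st : glob st -> VSP st st (st 7 0) (st 8 0) (st 9 0) (st 10 0)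
  (st 11 0) (st 12 0) (st 13 0) (st 14 0) (st 15) (view st aMn) (view st aMx).
Proof. by case. Qed.

Lemma root_bound X : X %/ U = 1 -> X < 2 * U.
Proof. by move=> e; rewrite -ltn_divLR ?e // expn_gt0. Qed.

Lemma one_bound : 1 < 2 * U.
Proof. by have : 0 < U by [rewrite expn_gt0]; lia. Qed.

Definition pred_cost := cmd_cost pred_body + cmd_cost asc_body + 200.

Lemma pred_prog_VSP st0 st b p X m M c Y R F mn mx :
  VSP st0 st b p X m M c Y R F mn mx -> X < 2 * U -> bnd mn -> bnd mx ->
  (forall q, mn 0 q = 0) ->
  run lim arr pred_prog st (pred_cost * H.+2)
   (fun st' => [/\ only_veb st0 st', view st' aMn = mn, view st' aMx = mx &
     st' 14 0 = (if 0 < mn D 1 < X then vpred H.+1 1 X mn mx else 0)]).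
Proof.
move=> hvs hX bmn bmx hz.
have hD : D < U by apply: widthU.
apply: (@run_weaken _ _ _ _ (cmd_cost (Seq (SetV 7 (V 4)) (Seq (SetV 8 (Cst 1))
      (Seq (SetV 10 (Ld aMn (key (V 7) (V 8)))) (SetV 14 (Cst 0))))) +
   (expr_cost (Bin OMul (Bin OLt (Cst 0) (V 10)) (Bin OLt (V 10) (V 9))) +
   ((H.+1 * (cmd_cost pred_body + 9) + 7) + (H.+1 * (cmd_cost asc_body + 16) + 14)) + 3))
   _ _ _ _ (fun _ h => h)).
  by rewrite /pred_cost; move: (cmd_cost pred_body) (cmd_cost asc_body) => A B /=; lia.
apply: run_seq; apply: run_wp; wseq.
apply: (wp_pset (v := D) hvs); [by [] | by psafe hvs | by peval hvs | vnextp; wseq].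
apply: (wp_pset (v := 1) hvs); [by [] | by psafe hvs | by [] | vnextp; wseq].
have [s1 v1] := VS_mn (VSP_VS hvs) hD one_bound (VS_key (VSP_VS hvs) hD one_bound).
apply: (wp_pset hvs _ s1 v1); first by [].
vnextp.
apply: (wp_pset (v := 0) hvs); [by [] | by psafe hvs | by [] | vnextp].
have fin st2 b2 p2 X2 m2 M2 c2 Y2 R2 F2 : VSP st0 st2 b2 p2 X2 m2 M2 c2 Y2 R2 F2 mn mx ->
   [/\ only_veb st0 st2, view st2 aMn = mn, view st2 aMx = mx & st2 14 0 = R2].
  by case=> -[[_ _ h] _ _ h1 h2] h3 _.
apply: (@run_weaken _ _ _ _ _ _ _ _ (leqnn _) (fun _ h => h)).
case hc: (0 < mn D 1 < X).
  apply: run_if.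
  - by psafe hvs; rewrite mulnb; apply: lim_gt; case: (_ && _).
  - move=> _; apply: run_seq.
    apply: run_weaken (desc_ok (leqnn _) one_bound hX bmn bmx hz hc hvs) => //.
    move=> st2 [b2 [p2 [X2 [M2 [c2 [Y2 [R2 [F2 [i [k [ej i0 ea [hR2 _] hv2]]]]]]]]]]].
    have hv3 : VSP st0 st2 b2 p2 X2 (width (i + 0)) M2 c2 Y2 (asc mx F2 i 0 R2) F2 mn mx.
      by rewrite addn0.
    apply: run_weaken (asc_ok (n := k) _ i0 bmx _ hv3) => //; last by rewrite addn0.
      by rewrite ej leq_add2r leq_mul2r; lia.
    move=> st3 [M3 hv]; have [a1 a2 a3 a4] := fin _ _ _ _ _ _ _ _ _ _ hv.
    by split=> //; rewrite a4 add0n.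
  by peval hvs; rewrite mulnb -/D hc.
apply: run_if.
- by psafe hvs; rewrite mulnb; apply: lim_gt; case: (_ && _).
- by peval hvs; rewrite mulnb -/D hc.
move=> _; apply: (run_weaken (leq0n _) (fun _ h => h)); apply: (@run_wp _ _ Skip).
exact: fin hvs.
Qed.

Lemma pred_prog_ok st : glob st -> st 9 0 %/ U = 1 ->
  bnd (view st aMn) -> bnd (view st aMx) -> (forall q, view st aMn 0 q = 0) ->
  run lim arr pred_prog st (pred_cost * H.+2)
   (fun st' => [/\ only_veb st st', view st' aMn = view st aMn, view st' aMx = view st aMx &
     st' 14 0 = (if 0 < view st aMn D 1 < st 9 0
                 then vpred H.+1 1 (st 9 0) (view st aMn) (view st aMx) else 0)]).
Proof. by move=> /VSP_init hvs /root_bound hX; apply: pred_prog_VSP hvs hX. Qed.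

End Veb.

Definition same (K : pred nat) (st st' : state) := forall a, ~~ K a -> st' a =1 st a.

Lemma same_trans K st1 st2 st3 : same K st1 st2 -> same K st2 st3 -> same K st1 st3.
Proof. by move=> h1 h2 a ha i; rewrite h2 ?h1. Qed.

Lemma sameW (K K' : pred nat) st st' : subpred K K' -> same K st st' -> same K' st st'.
Proof. by move=> h hs a ha; apply: hs; apply: contra ha; apply: h. Qed.

(* One plus the last position below [k] satisfying [P], or 0 if there is none. *)
Fixpoint pv (P : nat -> bool) k := if k is k'.+1 then if P k' then k else pv P k' else 0.

Lemma pv_uniq (P : nat -> bool) k r : (0 < r -> P r.-1) -> r <= k -> (forall t, r <= t < k -> ~~ P t) ->
  pv P k = r.
Proof.
move=> hr; elim: k => [|k IH]; first by rewrite leqn0 => /eqP.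
rewrite leq_eqVlt => /orP[/eqP e _|]; first by rewrite e in hr *; rewrite /= (hr isT).
rewrite ltnS => hk h /=; rewrite (negbTE (h k _)) ?hk ?leqnn //.
by apply: IH => // t /andP[h1 h2]; apply: h; rewrite h1 ltnW.
Qed.

Lemma pv_spec (P : nat -> bool) k : [/\ 0 < pv P k -> P (pv P k).-1, pv P k <= k &
  forall t, pv P k <= t < k -> ~~ P t].
Proof.
elim: k => [|k [h1 h2 h3]]; first by split=> // t; rewrite ltn0 andbF.
rewrite /=; case: ifP => hk; first by split=> // t /andP[h h']; lia.
split=> //; first exact: leqW.
move=> t /andP[h]; rewrite ltnS leq_eqVlt => /orP[/eqP ->|h']; first by rewrite hk.
by apply: h3; rewrite h.
Qed.

(** * Dynamic sets of positions with predecessor and successor *)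

Section RepV.
Variables (lim arr H : nat).
Let D := width H.+1.
Let U := 2 ^ D.
Hypothesis lim_ok : 8 * (U * U) <= lim.

(** The root has prefix 1, so a member is [U + i] with [i < U]: the prefix is the leading bit that
    makes every number positive. The bounds on entries keep all indices formed from them below
    [lim]. *)
Definition RepV (st : state) m x S :=
  [/\ Rep (view H st m) (view H st x) H.+1 1 S, bnd H (view H st m), bnd H (view H st x) &
      forall q, view H st m 0 q = 0].

Lemma RepV_same st st' m x S : st' m =1 st m -> st' x =1 st x -> RepV st m x S -> RepV st' m x S.
Proof. by move=> h1 h2; rewrite /RepV (view_ext H h1) (view_ext H h2). Qed.

Lemma RepV_ext st m x S S' : (forall X, S X <-> S' X) -> RepV st m x S -> RepV st m x S'.
Proof. by move=> e [h1 h2 h3 h4]; split=> //; apply: Rep_ext h1. Qed.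

Definition root_prog loop := Seq (Seq (SetV 7 (V 4)) (SetV 8 (Cst 1))) loop.

Section One.
Variables (m x : nat).
Hypothesis m_ok : 20 <= m < arr.
Hypothesis x_ok : 20 <= x < arr.
Hypothesis mx : m != x.

Definition vscratch := [pred b | (7 <= b < 16) || (b == m) || (b == x)].

Lemma only_same st st' : only_veb m x st st' <-> same vscratch st st'.
Proof.
by split=> h b; [rewrite /= !negb_or => /andP[/andP[]]; exact: h |
  move=> h1 h2 h3; apply: h; rewrite /= !negb_or h1 h2].
Qed.

Lemma root_ok loop st t X (Q : state -> Prop) : glob H st -> st 9 0 = X ->
  (forall st' M M' c Y, VS H m x st st' D 1 X M M' c Y (view H st m) (view H st x) ->
     run lim arr loop st' t Q) ->
  run lim arr (root_prog loop) st (cmd_cost (Seq (SetV 7 (V 4)) (SetV 8 (Cst 1))) + t) Q.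
Proof.
move=> hg e9 hl; have hvs := VS_init m x hg erefl erefl e9.
have sv st1 r : r < 20 -> safe lim arr st1 (V r) by apply: (safe_V lim_ok m_ok x_ok mx).
apply: run_seq; apply: run_wp.
match goal with |- wp ?l ?r (Seq ?a ?b) ?Q ?s => change (wp l r a (wp l r b Q) s) end.
apply: (wp_vset lim_ok m_ok x_ok mx (v := D) hvs) => [||/=|st1 h1]; first by [].
- exact: sv.
- by case: hg.
simpl in h1; apply: (wp_vset lim_ok m_ok x_ok mx (v := 1) h1) => [||/=|st2 h2] //.
  exact: lim_gt lim_ok _ _.
simpl in h2; exact: hl h2.
Qed.

Definition ins_prog := root_prog (ins_loop m x).
Definition del_prog := root_prog (del_loop m x).

Definition set_cost := 100 + cmd_cost (ins_body m x) + cmd_cost (del_body m x).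

Lemma void_changed (mn0 mx0 mn1 mx1 : nat -> nat -> nat) j p :
  changed_in (subkey (width j) p) mn0 mx0 mn1 mx1 ->
  (forall q, mn0 0 q = 0) -> forall q, mn1 0 q = 0.
Proof. by move=> h h0 q; case: (h 0 q) => [[-> _]|[]]. Qed.

Lemma ins_prog_ok st S : glob H st -> st 9 0 %/ U = 1 -> RepV st m x S -> ~ S (st 9 0) ->
  run lim arr ins_prog st (set_cost * H.+2) (fun st' =>
    RepV st' m x (fun Z => S Z \/ Z = st 9 0) /\ same vscratch st st').
Proof.
move=> hg eX [hR b1 b2 hz] nX; have hX := root_bound eX.
have [k1 k2] := vinsP (isT : 0 < H.+1) (isT : 0 < 1) hR eX nX.
apply: (@run_weaken _ _ _ _ (cmd_cost (Seq (SetV 7 (V 4)) (SetV 8 (Cst 1))) +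
  (H.+1 * (cmd_cost (ins_body m x) + 9) + 7))); last first.
- apply: root_ok => // st' M M' c Y hvs.
  apply: (ins_loop_ok lim_ok m_ok x_ok mx (leqnn _) _ hX b1 b2 hvs).
  exact: (one_bound lim_ok m_ok x_ok mx).
- move=> st' [e1 e2 /only_same hs b1' b2']; split=> //.
  by rewrite /RepV; split=> //; rewrite ?e1 ?e2 //; apply: void_changed k2 hz.
rewrite /set_cost; move: (cmd_cost (ins_body m x)) (cmd_cost (del_body m x)) => A B /=; lia.
Qed.

Lemma del_prog_ok st S : glob H st -> st 9 0 %/ U = 1 -> RepV st m x S -> S (st 9 0) ->
  run lim arr del_prog st (set_cost * H.+2) (fun st' =>
    RepV st' m x (fun Z => S Z /\ Z <> st 9 0) /\ same vscratch st st').
Proof.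
move=> hg eX [hR b1 b2 hz] nX; have hX := root_bound eX.
have [k1 k2] := vdelP (isT : 0 < 1) hz hR nX.
apply: (@run_weaken _ _ _ _ (cmd_cost (Seq (SetV 7 (V 4)) (SetV 8 (Cst 1))) +
  (H.+1 * (cmd_cost (del_body m x) + 9) + 7))); last first.
- apply: root_ok => // st' M M' c Y hvs.
  apply: (del_loop_ok lim_ok m_ok x_ok mx (leqnn _) _ hX b1 b2 hvs).
  exact: (one_bound lim_ok m_ok x_ok mx).
- move=> st' [e1 e2 /only_same hs b1' b2']; split=> //.
  by rewrite /RepV; split=> //; rewrite ?e1 ?e2 //; apply: void_changed k2 hz.
rewrite /set_cost; move: (cmd_cost (ins_body m x)) (cmd_cost (del_body m x)) => A B /=; lia.
Qed.

Lemma RepV_pred st S : glob H st -> st 9 0 %/ U = 1 -> RepV st m x S ->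
  run lim arr (pred_prog m x) st (pred_cost m x * H.+2) (fun st' =>
    [/\ RepV st' m x S, same vscratch st st' &
       [/\ st' 14 0 = 0 & forall Z, S Z -> ~ Z < st 9 0] \/
       [/\ S (st' 14 0), st' 14 0 < st 9 0 & forall Z, S Z -> Z < st 9 0 -> Z <= st' 14 0]]).
Proof.
move=> hg eX [hR b1 b2 hz].
apply: run_weaken (pred_prog_ok lim_ok m_ok x_ok mx hg eX b1 b2 hz) => //.
move=> st' [/only_same hs e1 e2 e3]; split=> //.
  by rewrite /RepV e1 e2.
rewrite e3; case: ifP => hc; last first.
  left; split=> // Z SZ hZ; move/negP: hc; case.
  have n0 : view H st m D 1 != 0.
    apply/eqP => e0; exact: (Rep_empty (isT : 0 < 1) (isT : 0 < H.+1) hR e0 SZ).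
  have [_ _ h] := Rep_nonempty (isT : 0 < H.+1) hR n0.
  by rewrite lt0n n0 /=; case/andP: (h _ SZ) => h1 _; apply: leq_ltn_trans h1 hZ.
right; exact: (vpredP (isT : 0 < 1) hz hR eX hc).
Qed.

End One.

(** Zeroed memory represents the empty set, so the quadratic tables need no initialisation. *)
Lemma RepV0 st m x : (forall i, st m i = 0) -> (forall i, st x i = 0) ->
  RepV st m x (fun _ => False).
Proof.
have U2 : 0 < 2 * U by rewrite muln_gt0 expn_gt0.
have v0 a : (forall i, st a i = 0) -> view H st a = fun _ _ => 0.
  move=> h; do 2 apply: functional_extensionality => ?.
  by rewrite /view h; case: ifP.
move=> h1 h2; rewrite /RepV !v0 //; split=> //.
suff: forall j p, Rep (fun _ _ => 0) (fun _ _ => 0) j p (fun _ => False) by [].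
elim=> [p X []|j IH p]; split=> //; first by left; split=> // X [].
  apply: Rep_ext (IH p) => Y; by split=> // -[X [? _ _]].
by move=> Y _; apply: Rep_ext (IH Y) => X; split=> // -[[]].
Qed.

Variable a : nat.
Hypothesis a_ok : 20 <= a /\ a.+4 < arr.

(* Positions are inserted both as [U + i] and mirrored as [2 * U - 1 - i], so that successor queries are predecessor queries. *)
Definition OS (st : state) (P : nat -> bool) :=
  [/\ forall i, i < U -> st a i = nat_of_bool (P i),
      RepV st a.+1 a.+2 (fun X => exists2 i, i < U /\ P i & X = U + i) &
      RepV st a.+3 a.+4 (fun X => exists2 i, i < U /\ P i & X = 2 * U - i.+1)].

Definition mirror e := Bin OSub (Bin OMul (Cst 2) (V 3)) (Bin OAdd e (Cst 1)).

(** Insertion expects an absent and deletion a present element; the bit table in array [a] is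
    consulted to meet this. *)
Definition os_set :=
  If (Bin OEq (Ld a (V 16)) (V 17)) Skip
  (Seq (Seq (Asg a (V 16) (V 17)) (SetV 9 (Bin OAdd (V 3) (V 16))))
  (If (V 17)
    (Seq (ins_prog a.+1 a.+2)
    (Seq (SetV 9 (mirror (V 16))) (ins_prog a.+3 a.+4)))
    (Seq (del_prog a.+1 a.+2)
    (Seq (SetV 9 (mirror (V 16))) (del_prog a.+3 a.+4))))).

(** A member [U + t] is reported as [t + 1], and the answer 0 for none is kept, in accordance with
    [pv]. *)
Definition os_prv :=
  Seq (SetV 9 (Bin OAdd (V 3) (V 16)))
 (Seq (pred_prog a.+1 a.+2)
 (If (V 14) (SetV 14 (Bin OAdd (Bin OSub (V 14) (V 3)) (Cst 1))) Skip)).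

(** Mirroring is an involution, so the same expression encodes the query and decodes the answer. If
    there is no successor the answer is [U]. *)
Definition os_nxt :=
  Seq (SetV 9 (mirror (V 16)))
 (Seq (pred_prog a.+3 a.+4)
 (If (V 14) (SetV 14 (mirror (V 14))) (SetV 14 (V 3)))).

Definition os_scratch := [pred b | (7 <= b < 16) || (a <= b <= a.+4)].

Lemma OS_same st st' P : (forall b, a <= b <= a.+4 -> st' b =1 st b) -> OS st P -> OS st' P.
Proof.
move=> h [h1 h2 h3]; split.
- by move=> i hi; rewrite h ?h1 //; lia.
- by apply: RepV_same h2 => i; rewrite h //; lia.
- by apply: RepV_same h3 => i; rewrite h //; lia.
Qed.

Lemma OS_ext st P P' : (forall i, i < U -> P i = P' i) -> OS st P -> OS st P'.
Proof.
move=> e [h1 h2 h3]; split.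
- by move=> i hi; rewrite h1 ?e.
- apply: RepV_ext h2 => X; split=> -[i [hi pi] ->]; exists i => //; split=> //.
    by rewrite -e.
  by rewrite e.
- apply: RepV_ext h3 => X; split=> -[i [hi pi] ->]; exists i => //; split=> //.
    by rewrite -e.
  by rewrite e.
Qed.

Lemma OS0 st : (forall b i, a <= b <= a.+4 -> st b i = 0) -> OS st (fun=> false).
Proof.
move=> h; split.
- by move=> i _; rewrite h //; lia.
- by apply: RepV_ext (RepV0 _ _) => [X|i|i]; [split=> // -[i []] | rewrite h //; lia | rewrite h //; lia].
- by apply: RepV_ext (RepV0 _ _) => [X|i|i]; [split=> // -[i []] | rewrite h //; lia | rewrite h //; lia].
Qed.

Lemma U_pos : 0 < U. Proof. by rewrite expn_gt0. Qed.

Lemma U_lim : 8 * U <= lim.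
Proof. by have U0 := U_pos; apply: leq_trans lim_ok; rewrite leq_mul2l leq_pmulr. Qed.

Lemma id_div i : i < U -> (U + i) %/ U = 1.
Proof. by move=> hi; rewrite -{1}(mul1n U) divnMDl ?U_pos // divn_small. Qed.

Lemma mirror_div i : i < U -> (2 * U - i.+1) %/ U = 1.
Proof.
move=> hi; rewrite (_ : 2 * U - i.+1 = U + (U - i.+1)); last by lia.
by apply: id_div; lia.
Qed.

Lemma arrk k : k < 20 -> k < arr. Proof. by case: a_ok; lia. Qed.
Lemma limk k : k < 8 -> k < lim. Proof. by have := U_pos; have := U_lim; lia. Qed.

Lemma safe_var st r : r < 20 -> safe lim arr st (V r).
Proof. by move=> h; split=> //=; [apply: arrk | apply: limk | apply: limk]. Qed.

Lemma safe_mirror st r i : glob H st -> r < 20 -> st r 0 = i -> i < 2 * U ->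
  safe lim arr st (mirror (V r)) /\ eval st (mirror (V r)) = 2 * U - i.+1.
Proof.
have := U_pos; have := U_lim; move=> h1 h2 [g3 _] hr er hi.
split; last by rewrite /= g3 er addn1.
rewrite /mirror; do ?split; try (by apply: safe_var); rewrite /= ?g3 ?er -/U; lia.
Qed.

Lemma safe_id st r i : glob H st -> r < 20 -> st r 0 = i -> i < 2 * U ->
  safe lim arr st (Bin OAdd (V 3) (V r)) /\ eval st (Bin OAdd (V 3) (V r)) = U + i.
Proof.
have := U_pos; have := U_lim; move=> h1 h2 [g3 _] hr er hi.
split; last by rewrite /= g3 er.
do ?split; try (by apply: arrk); try (by apply: limk); rewrite /= ?g3 ?er -/U; lia.
Qed.

Lemma run_set r e st v (Q : state -> Prop) : r < arr -> safe lim arr st e -> eval st e = v ->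
  Q (upd2 st r 0 v) -> run lim arr (SetV r e) st (expr_cost e + 6) Q.
Proof.
move=> hr hs ev hQ; apply: (run_weaken _ (fun _ h => h) (@run_wp lim arr (SetV r e) st Q _)).
  by rewrite /= add1n -addnS.
by split=> //=; [apply: limk | apply: limk | rewrite ev].
Qed.

Lemma upd_same (K : pred nat) st r i v : K r -> same K st (upd2 st r i v).
Proof.
by move=> hr b hb k; rewrite updE; case: eqP => // e; rewrite e hr in hb.
Qed.

Definition pred_costs := pred_cost a.+1 a.+2 + pred_cost a.+3 a.+4 + 200.

Let m1 : 20 <= a.+1 < arr. Proof. by case: a_ok; lia. Qed.
Let m2 : 20 <= a.+2 < arr. Proof. by case: a_ok; lia. Qed.
Let m3 : 20 <= a.+3 < arr. Proof. by case: a_ok; lia. Qed.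
Let m4 : 20 <= a.+4 < arr. Proof. by case: a_ok; lia. Qed.
Let n12 : a.+1 != a.+2. Proof. by rewrite (ltn_eqF (ltnSn _)). Qed.
Let n34 : a.+3 != a.+4. Proof. by rewrite (ltn_eqF (ltnSn _)). Qed.

Lemma glob_same K st st' : ~~ K 3 -> ~~ K 4 -> same K st st' -> glob H st -> glob H st'.
Proof. by move=> k3 k4 hs [e1 e2]; rewrite /glob !hs. Qed.

Lemma glob_os st st' : same os_scratch st st' -> glob H st -> glob H st'.
Proof. by move=> hs; apply: glob_same hs; case: a_ok => h _ /=; lia. Qed.

Lemma os_reg st st' r : same os_scratch st st' -> r < 20 -> ~~ (7 <= r < 16) -> st' r 0 = st r 0.
Proof. by move=> hs h1 h2; rewrite hs //= negb_or h2; case: a_ok => h _; lia. Qed.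

Lemma os_upd r st v : 7 <= r < 16 -> same os_scratch st (upd2 st r 0 v).
Proof. by move=> h; apply: upd_same; rewrite /= h. Qed.

Lemma OS_upd st r v P : 7 <= r < 16 -> OS st P -> OS (upd2 st r 0 v) P.
Proof.
move=> hr; apply: OS_same => b hb k; rewrite updE; case: eqP => //= e.
by case: a_ok; lia.
Qed.

Lemma os_prv_ok st P i : glob H st -> OS st P -> i < U -> st 16 0 = i ->
  run lim arr os_prv st (pred_costs * H.+2) (fun st' =>
    [/\ OS st' P, same os_scratch st st' & st' 14 0 = pv P i]).
Proof.
move=> hg hos hi e16; have U0 := U_pos; have U1 := U_lim.
have i2 : i < 2 * U by lia.
have [s1 v1] := safe_id hg (isT : 16 < 20) e16 i2.
apply: (@run_weaken _ _ _ _ (expr_cost (Bin OAdd (V 3) (V 16)) + 6 + (pred_cost a.+1 a.+2 * H.+2 +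
   (cmd_cost (If (V 14) (SetV 14 (Bin OAdd (Bin OSub (V 14) (V 3)) (Cst 1))) Skip)))) _ _ _ _ (fun _ h => h)).
  rewrite /pred_costs; move: (pred_cost _ _) (pred_cost _ _) => A B /=; lia.
apply: run_seq; apply: (run_set (arrk _) s1 v1) => //.
have hs1 := os_upd st (U + i) (isT : 7 <= 9 < 16).
have hos1 := OS_upd (U + i) (isT : 7 <= 9 < 16) hos.
set st1 := upd2 st 9 0 (U + i) in hs1 hos1 *.
have hg1 := glob_os hs1 hg.
have [h1 h2 h3] := hos1.
apply: run_seq.
have e9 : st1 9 0 = U + i by rewrite /st1 updE.
apply: run_weaken (RepV_pred m1 m2 n12 hg1 _ h2) => //; last by rewrite e9 id_div.
move=> st2 [hR hs hres]; rewrite e9 in hres; apply: run_wp.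
have hs2 : same os_scratch st1 st2.
  apply: sameW hs => b /=; lia.
have hos2 : OS st2 P.
  split=> //; first by move=> k hk; rewrite hs ?h1 //=; case: a_ok; lia.
  by apply: RepV_same h3 => k; rewrite hs //=; case: a_ok; lia.
have hg2 := glob_os hs2 hg1; have [g3 _] := hg2.
split; first exact: safe_var.
case: hres => [[e14 hno]|[[t [ht pt] e14] hlt hmax]].
  rewrite /= e14 /=; split=> //; first exact: same_trans hs1 hs2.
  apply/esym/pv_uniq => // t /andP[_ hti]; apply/negP => pt.
  by apply: (hno (U + t)); [exists t => //; split=> //; apply: ltn_trans hti hi | rewrite ltn_add2l].
have -> : eval st2 (V 14) != 0 by rewrite /= e14; lia.
split; rewrite /= ?g3 ?e14; try (by apply: arrk); try (by apply: limk).
  do ?split; rewrite /= ?g3 ?e14; try (by apply: arrk); try (by apply: limk); rewrite -/U; lia.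
rewrite -/U addKn addn1; split.
- exact: OS_upd.
- exact: same_trans (same_trans hs1 hs2) (os_upd _ _ _).
rewrite updE /=; apply/esym/pv_uniq => //; first by move: hlt; rewrite e14 ltn_add2l.
move=> k /andP[k1 k2]; apply/negP => pk.
have := hmax (U + k); rewrite e14 leq_add2l ltn_add2l => hm.
have : k <= t by apply: hm => //; exists k => //; split=> //; apply: ltn_trans k2 hi.
by rewrite leqNgt k1.
Qed.

Lemma os_nxt_ok st P i : glob H st -> OS st P -> i < U -> st 16 0 = i ->
  run lim arr os_nxt st (pred_costs * H.+2) (fun st' =>
    [/\ OS st' P, same os_scratch st st', i < st' 14 0 <= U,
       st' 14 0 < U -> P (st' 14 0) & forall k, i < k < st' 14 0 -> ~~ P k]).
Proof.
move=> hg hos hi e16; have U0 := U_pos; have U1 := U_lim.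
have i2 : i < 2 * U by lia.
have [s1 v1] := safe_mirror hg (isT : 16 < 20) e16 i2.
apply: (@run_weaken _ _ _ _ (expr_cost (mirror (V 16)) + 6 + (pred_cost a.+3 a.+4 * H.+2 +
   (cmd_cost (If (V 14) (SetV 14 (mirror (V 14))) (SetV 14 (V 3)))))) _ _ _ _ (fun _ h => h)).
  rewrite /pred_costs; move: (pred_cost _ _) (pred_cost _ _) => A B /=; lia.
apply: run_seq; apply: (run_set (arrk _) s1 v1) => //.
have hs1 := os_upd st (2 * U - i.+1) (isT : 7 <= 9 < 16).
have hos1 := OS_upd (2 * U - i.+1) (isT : 7 <= 9 < 16) hos.
set st1 := upd2 st 9 0 _ in hs1 hos1 *.
have hg1 := glob_os hs1 hg.
have [h1 h2 h3] := hos1.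
apply: run_seq.
have e9 : st1 9 0 = 2 * U - i.+1 by rewrite /st1 updE.
apply: run_weaken (RepV_pred m3 m4 n34 hg1 _ h3) => //; last by rewrite e9 mirror_div.
move=> st2 [hR hs hres]; rewrite e9 in hres; apply: run_wp.
have hs2 : same os_scratch st1 st2.
  apply: sameW hs => b /=; lia.
have hos2 : OS st2 P.
  split=> //; first by move=> k hk; rewrite hs ?h1 //=; case: a_ok; lia.
  by apply: RepV_same h2 => k; rewrite hs //=; case: a_ok; lia.
have hg2 := glob_os hs2 hg1; have [g3 _] := hg2.
split; first exact: safe_var.
case: hres => [[e14 hno]|[[t [ht pt] e14] hlt hmax]].
  rewrite /= e14 /=; split; try (by apply: arrk); try (by apply: limk).
    by split; try (by apply: arrk); try (by apply: limk).
  rewrite g3; split.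
  - exact: OS_upd.
  - exact: same_trans (same_trans hs1 hs2) (os_upd _ _ _).
  - by rewrite updE /= hi leqnn.
  - by rewrite updE /= ltnn.
  - rewrite updE /= => k /andP[k1 k2]; apply/negP => pk.
    apply: (hno (2 * U - k.+1)); first by exists k.
    by rewrite -/U in k2; lia.
have -> : eval st2 (V 14) != 0 by rewrite /= e14; lia.
have t2 : 2 * U - t.+1 < 2 * U by lia.
have [s2 v2] := safe_mirror hg2 (isT : 14 < 20) e14 t2.
split; [exact: arrk | exact: limk | exact: s2 | exact: limk | ].
rewrite v2 (_ : 2 * U - (2 * U - t.+1).+1 = t); last by lia.
split.
- exact: OS_upd.
- exact: same_trans (same_trans hs1 hs2) (os_upd _ _ _).
- by rewrite updE /=; rewrite e14 in hlt; lia.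
- by rewrite updE.
rewrite updE /= => k /andP[k1 k2]; apply/negP => pk.
have hk : k < U by apply: ltn_trans ht.
have := hmax (2 * U - k.+1); rewrite e14 => hm.
have : 2 * U - k.+1 <= 2 * U - t.+1.
  by apply: hm; [exists k | lia].
by lia.
Qed.

Definition set_costs := set_cost a.+1 a.+2 + set_cost a.+3 a.+4 + 300.

Lemma os_set_ok st P i (v : bool) : glob H st -> OS st P -> i < U -> st 16 0 = i -> st 17 0 = v ->
  run lim arr os_set st (set_costs * H.+2) (fun st' =>
    OS st' (fun k => if k == i then v else P k) /\ same os_scratch st st').
Proof.
move=> hg hos hi e16 e17; have U0 := U_pos; have U1 := U_lim.
have i2 : i < 2 * U by lia.
have [g1 g2 g3] := hos.
have ilim : i < lim by lia.
have a20 : 20 <= a < arr by case: a_ok; lia.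
have sa : safe lim arr st (Ld a (V 16)).
  by split; [case/andP: a20 | exact: safe_var | rewrite /= e16].
have sid := safe_id hg (isT : 16 < 20) e16 i2.
have sm := safe_mirror hg (isT : 16 < 20) e16 i2.
apply: (@run_weaken _ _ _ _ (expr_cost (Bin OEq (Ld a (V 16)) (V 17)) +
   (cmd_cost (Seq (Asg a (V 16) (V 17)) (SetV 9 (Bin OAdd (V 3) (V 16)))) +
    (expr_cost (V 17) + (set_cost a.+1 a.+2 * H.+2 + (expr_cost (mirror (V 16)) + 6 +
      set_cost a.+3 a.+4 * H.+2)) + 3)) + 3) _ _ _ _ (fun _ h => h)).
  rewrite /set_costs; move: (set_cost _ _) (set_cost _ _) => A B /=; lia.
apply: run_if; first by split=> //; apply: safe_var.
  rewrite /= e16 e17 g1 // => hpv.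
  apply: (run_weaken (leq0n _) (fun _ h => h)); apply: (@run_wp _ _ Skip); split=> //.
  apply: OS_ext hos => k _; case: eqP => // ->.
  by move: hpv; case: (P i); case: v {e17}.
rewrite /= e16 e17 g1 // => hpv.
have {}hpv : P i = ~~ v by move: hpv; case: (P i); case: v {e17}.
apply: run_seq; apply: run_wp.
split; [by case/andP: a20 | exact: safe_var | exact: safe_var | by rewrite /= e16 | ].
rewrite /= e16 e17.
have hsa : same os_scratch st (upd2 st a i v) by apply: upd_same; rewrite /= leqnn; lia.
set sta := upd2 st a i v in hsa *.
have hga := glob_os hsa hg.
have e16a : sta 16 0 = i by rewrite (os_reg hsa).
have [s1 v1] := safe_id hga (isT : 16 < 20) e16a i2.
split; [exact: arrk | exact: limk | exact: s1 | exact: limk |].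
move: v1; rewrite /= => ->.
have hs1 := same_trans hsa (os_upd sta (U + i) (isT : 7 <= 9 < 16)).
set st1 := upd2 sta 9 0 (U + i) in hs1 *.
have hg1 := glob_os hs1 hg.
have e17' : st1 17 0 = v by rewrite (os_reg hs1).
have e9 : st1 9 0 = U + i by rewrite /st1 updE.
have mem1 k : k < U -> st1 a k = nat_of_bool (if k == i then v else P k).
  move=> hk; rewrite /st1 updE; case: eqP => [e|_] /=; first by case: a_ok; lia.
  by rewrite /sta updE eqxx /=; case: eqP => // _; rewrite g1.
have st1b b : a < b <= a.+4 -> st1 b =1 st b.
  move=> hb k; rewrite /st1 /sta !updE; case: eqP => [e|_] /=; first by case: a_ok; lia.
  by case: eqP => [e|_] //=; lia.
have R1 : RepV st1 a.+1 a.+2 (fun X => exists2 i, i < U /\ P i & X = U + i).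
  by apply: RepV_same g2; apply: st1b; lia.
have R2 : RepV st1 a.+3 a.+4 (fun X => exists2 i, i < U /\ P i & X = 2 * U - i.+1).
  by apply: RepV_same g3; apply: st1b; lia.
(* The two trees occupy different arrays, so operating on one preserves the other. Insertion and
   deletion share this ending and differ only in the sets obtained. *)
have fin S1 S2 st2 st3 st4 :
    RepV st2 a.+1 a.+2 S1 -> same (vscratch a.+1 a.+2) st1 st2 ->
    st3 = upd2 st2 9 0 (2 * U - i.+1) ->
    RepV st4 a.+3 a.+4 S2 -> same (vscratch a.+3 a.+4) st3 st4 ->
    (forall X, S1 X <-> exists2 k, k < U /\ (if k == i then v else P k) & X = U + k) ->
    (forall X, S2 X <-> exists2 k, k < U /\ (if k == i then v else P k) & X = 2 * U - k.+1) ->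
    OS st4 (fun k => if k == i then v else P k) /\ same os_scratch st st4.
  move=> r1 h12 e3 r2 h34 hS1 hS2.
  have h23 b : ~~ (7 <= b < 16) -> st3 b =1 st2 b.
    by move=> hb k; rewrite e3 updE; case: eqP => // e; rewrite e in hb.
  split; first split.
  - move=> k hk; rewrite h34 ?h23 ?h12 ?mem1 //=; case: a_ok; lia.
  - apply: RepV_ext hS1 _; apply: RepV_same r1 => k; rewrite h34 ?h23 //=; case: a_ok; lia.
  - exact: RepV_ext hS2 r2.
  apply: same_trans hs1 _ => b /= hb k.
  by rewrite h34 ?h23 ?h12 //=; lia.
have mid st2 : same (vscratch a.+1 a.+2) st1 st2 ->
   [/\ glob H st2, st2 16 0 = i & RepV st2 a.+3 a.+4 (fun X => exists2 i, i < U /\ P i & X = 2 * U - i.+1)].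
  move=> h12; have h12' : same os_scratch st1 st2 by apply: sameW h12 => b /=; lia.
  split; first exact: glob_os h12' hg1.
    by rewrite (os_reg h12') // (os_reg hs1).
  by apply: RepV_same R2 => k; rewrite h12 //=; case: a_ok; lia.
apply: run_if; first exact: safe_var.
- rewrite /= e17' => hv; have {hv} ev : v = true by case: v hv {e17 hpv sta hsa hga e16a s1 hs1 st1 hg1 e17' e9 mem1 st1b R1 R2 fin mid}.
  rewrite ev /= in hpv.
  apply: run_seq; apply: run_weaken (ins_prog_ok m1 m2 n12 hg1 _ R1 _) => //; first last.
  + by rewrite e9 => -[k [hk pk] /addnI ek]; rewrite -ek hpv in pk.
  + by rewrite e9 id_div.
  move=> st2 [r1 h12]; have [hg2 e16' R2'] := mid _ h12.
  have [s2 v2] := safe_mirror hg2 (isT : 16 < 20) e16' i2.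
  apply: run_seq; apply: (run_set (arrk _) s2 v2) => //.
  set st3 := upd2 st2 9 0 _.
  have hg3 : glob H st3 by apply: glob_os hg2; apply: os_upd.
  have R3 : RepV st3 a.+3 a.+4 (fun X => exists2 i, i < U /\ P i & X = 2 * U - i.+1).
    by apply: RepV_same R2' => k; rewrite /st3 updE; case: eqP => //= e; case: a_ok; lia.
  have e9' : st3 9 0 = 2 * U - i.+1 by rewrite /st3 updE.
  apply: run_weaken (ins_prog_ok m3 m4 n34 hg3 _ R3 _) => //; first last.
  + by rewrite e9' => -[k [hk pk] ek]; have eki : k = i by [lia]; rewrite eki hpv in pk.
  + by rewrite e9' mirror_div.
  move=> st4 [r2 h34]; apply: (fin _ _ _ _ _ r1 h12 (erefl _) r2 h34) => X.
  + rewrite e9; split=> [[[k [hk pk] ->]|->]|[k [hk pk] ->]].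
    * by exists k => //; split=> //; case: eqP => // _; rewrite ev.
    * by exists i => //; split=> //; rewrite eqxx ev.
    * case: (k =P i) pk => [-> _|_ pk]; [by right | by left; exists k].
  + rewrite e9'; split=> [[[k [hk pk] ->]|->]|[k [hk pk] ->]].
    * by exists k => //; split=> //; case: eqP => // _; rewrite ev.
    * by exists i => //; split=> //; rewrite eqxx ev.
    * case: (k =P i) pk => [-> _|_ pk]; [by right | by left; exists k].
rewrite /= e17' => hv; have {hv} ev : v = false by case: v hv {e17 hpv sta hsa hga e16a s1 hs1 st1 hg1 e17' e9 mem1 st1b R1 R2 fin mid}.
rewrite ev /= in hpv.
apply: run_seq; apply: run_weaken (del_prog_ok m1 m2 n12 hg1 _ R1 _) => //; first last.
- by rewrite e9; exists i.
- by rewrite e9 id_div.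
move=> st2 [r1 h12]; have [hg2 e16' R2'] := mid _ h12.
have [s2 v2] := safe_mirror hg2 (isT : 16 < 20) e16' i2.
apply: run_seq; apply: (run_set (arrk _) s2 v2) => //.
set st3 := upd2 st2 9 0 _.
have hg3 : glob H st3 by apply: glob_os hg2; apply: os_upd.
have R3 : RepV st3 a.+3 a.+4 (fun X => exists2 i, i < U /\ P i & X = 2 * U - i.+1).
  by apply: RepV_same R2' => k; rewrite /st3 updE; case: eqP => //= e; case: a_ok; lia.
have e9' : st3 9 0 = 2 * U - i.+1 by rewrite /st3 updE.
apply: run_weaken (del_prog_ok m3 m4 n34 hg3 _ R3 _) => //; first last.
- by rewrite e9'; exists i.
- by rewrite e9' mirror_div.
move=> st4 [r2 h34]; apply: (fin _ _ _ _ _ r1 h12 (erefl _) r2 h34) => X.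
- rewrite e9; split=> [[[k [hk pk] ->] hne]|[k [hk pk] ->]].
    by exists k => //; split=> //; case: eqP => // ek; case: hne; rewrite ek.
  case: (k =P i) pk => [_|nk pk]; first by rewrite ev.
  by split; [exists k | move/addnI].
rewrite e9'; split=> [[[k [hk pk] ->] hne]|[k [hk pk] ->]].
  by exists k => //; split=> //; case: eqP => // ek; case: hne; rewrite ek.
case: (k =P i) pk => [_|nk pk]; first by rewrite ev.
by split; [exists k | move=> e; apply: nk; lia].
Qed.

End RepV.

(** * Local divisors *)

Section Product.
Variables (T : finType) (op : T -> T -> T) (e : T).

Definition pr (x : nat -> T) l r := foldr op e [seq x k | k <- iota l (r - l)].

Lemma pr_nil x l r : r <= l -> pr x l r = e.
Proof. by rewrite /pr -subn_eq0 => /eqP ->. Qed.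

Lemma pr_ext x x' l r : (forall k, l <= k < r -> x k = x' k) -> pr x l r = pr x' l r.
Proof.
move=> h; rewrite /pr; congr foldr; apply/eq_in_map => k; rewrite mem_iota => hk.
apply: h; lia.
Qed.

Variable E : {set T}.
Hypothesis am : aperiodic_monoid E op e.

Lemma pr_in x l r : (forall k, x k \in E) -> pr x l r \in E.
Proof.
by move=> h; rewrite /pr; elim: (iota _ _) => [|k s IH] /=; [apply: (am_one am) | apply: (am_mul am)].
Qed.

Lemma foldr_cat s1 s2 : {subset s1 <= E} -> {subset s2 <= E} ->
  foldr op e (s1 ++ s2) = op (foldr op e s1) (foldr op e s2).
Proof.
move=> h1 h2.
have fE s : {subset s <= E} -> foldr op e s \in E.
  elim: s => [|a s IH] h /=; first exact: am_one am.
  apply: (am_mul am); first by apply: h; rewrite inE eqxx.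
  by apply: IH => z hz; apply: h; rewrite inE hz orbT.
elim: s1 h1 => [|a s1 IH] h1 /=; first by rewrite (am_mul1l am) // fE.
have h1' : {subset s1 <= E} by move=> z hz; apply: h1; rewrite inE hz orbT.
by rewrite IH // (am_assoc am) ?fE //; apply: h1; rewrite inE eqxx.
Qed.

Lemma pr_cat x l m r : (forall k, x k \in E) -> l <= m <= r ->
  pr x l r = op (pr x l m) (pr x m r).
Proof.
move=> h /andP[h1 h2]; rewrite /pr -foldr_cat; try by move=> z /mapP[k _ ->].
rewrite -map_cat (_ : iota l (r - l) = iota l (m - l) ++ iota m (r - m)) //.
by rewrite -{2}(subnKC h1) -iotaD; congr iota; lia.
Qed.

Lemma pr_one x l : (forall k, x k \in E) -> pr x l l.+1 = x l.
Proof. by move=> h; rewrite /pr subSnn /= (am_mul1r am). Qed.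

Lemma pr_recr x l r : (forall k, x k \in E) -> l <= r -> pr x l r.+1 = op (pr x l r) (x r).
Proof. by move=> h hlr; rewrite (@pr_cat x l r) ?pr_one ?leqnSn ?hlr. Qed.

Lemma pr_unit x l m r : (forall k, x k \in E) -> l <= m <= r ->
  (forall k, m <= k < r -> x k = e) -> pr x l r = pr x l m.
Proof.
move=> h hm hx; rewrite (pr_cat h hm); have := pr_in m r h.
suff -> : pr x m r = e by move=> _; rewrite (am_mul1r am) // pr_in.
rewrite (pr_ext hx) /pr; elim: (iota _ _) => //= _ s ->.
by rewrite (am_mul1l am) // (am_one am).
Qed.

Lemma iter_in z n : z \in E -> iter n (op z) e \in E.
Proof. by move=> hz; elim: n => [|n IH]; [apply: (am_one am) | apply: (am_mul am)]. Qed.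

Section LocalDivisor.
Variable c : T.
Hypothesis cE : c \in E.

Definition ld_set := [set t in E | [exists y in E, op y c == t] && [exists z in E, op c z == t]].
Definition lquo t := odflt t [pick y in E | op y c == t].
(* [xc . cy = xcy]; the unit is [c]. *)
Definition ld_op s t := op (lquo s) t.

Lemma ld_setP t : reflect [/\ t \in E, exists2 y, y \in E & op y c = t &
  exists2 z, z \in E & op c z = t] (t \in ld_set).
Proof.
rewrite inE; apply: (iffP and3P) => -[h1 h2 h3]; split=> //.
- by case/exists_inP: h2 => y hy /eqP; exists y.
- by case/exists_inP: h3 => y hy /eqP; exists y.
- by apply/exists_inP; case: h2 => y hy <-; exists y.
- by apply/exists_inP; case: h3 => y hy <-; exists y.
Qed.

Lemma lquoP t : t \in ld_set -> lquo t \in E /\ op (lquo t) c = t.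
Proof.
case/ld_setP=> _ [y hy ey] _; rewrite /lquo; case: pickP => [z /andP[hz /eqP]|/(_ y)] //.
by rewrite hy ey eqxx.
Qed.

(** The right-hand side does not mention the quotient: on multiples of [c], hence on all of
    [ld_set], the product is independent of the choice made by [lquo]. *)
Lemma ld_opc s z : s \in ld_set -> z \in E -> ld_op s (op c z) = op s z.
Proof.
by move=> /lquoP[h1 h2] hz; rewrite /ld_op (am_assoc am) // h2.
Qed.

(** Writing the right factor as [c z] turns the laws into those of the monoid by [ld_opc]. The
    powers of [s] are the ordinary powers of its quotient times [c], so aperiodicity is
    inherited. *)
Lemma ld_monoid : aperiodic_monoid ld_set ld_op c.
Proof.
have eE := am_one am.
have cld : c \in ld_set.
  by apply/ld_setP; split=> //; exists e; rewrite // ?(am_mul1l am) // (am_mul1r am).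
have mul s t : s \in ld_set -> t \in ld_set -> ld_op s t \in ld_set.
  move=> hs ht; have [qs es] := lquoP hs; have [qt et] := lquoP ht.
  have /ld_setP[sE _ [z hz ez]] := hs; have /ld_setP[tE _ [z' hz' ez']] := ht.
  apply/ld_setP; split; first exact: (am_mul am).
    exists (op (lquo s) (lquo t)); first exact: (am_mul am).
    by rewrite -(am_assoc am) // et.
  exists (op z z'); first exact: (am_mul am).
  by rewrite (am_assoc am) // ez -ez' ld_opc.
have ldE s : s \in ld_set -> s \in E by case/ld_setP.
split=> //.
- move=> s t u hs ht hu; have [qs es] := lquoP hs; have [qt et] := lquoP ht.
  have /ld_setP[uE _ [z hz <-]] := hu.
  rewrite (ld_opc ht) // (ld_opc (mul _ _ hs ht)) // /ld_op (am_assoc am) //; exact: ldE.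
- move=> s hs; have /ld_setP[sE _ [z hz ez]] := hs.
  by rewrite -{1}ez ld_opc.
- by move=> s hs; have [qs es] := lquoP hs.
move=> s hs; have [qs es] := lquoP hs; have [n hn] := am_aperiodic am qs.
have it m : iter m (ld_op s) c = op (iter m (op (lquo s)) e) c.
  elim: m => [|m IH] /=; first by rewrite (am_mul1l am).
  by rewrite IH /ld_op (am_assoc am) //; apply: iter_in.
by exists n; rewrite !it hn.
Qed.

(* If [e = y c] then [y^n c^n = e], so aperiodicity of [c] cancels down to [c = e]. *)
Lemma ld_proper : c != e -> e \notin ld_set.
Proof.
move=> ne; apply/negP => /ld_setP[_ [y hy ey] _]; case/eqP: ne.
have [n hn] := am_aperiodic am cE.
have yc m : op (iter m (op y) e) (iter m (op c) e) = e.
  elim: m => [|m IH]; first by rewrite /= (am_mul1l am) // (am_one am).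
  have comm k : op y (iter k (op y) e) = op (iter k (op y) e) y.
    elim: k => [|k IHk] /=; first by rewrite (am_mul1l am) // (am_mul1r am).
    by rewrite {1}IHk (am_assoc am) //; apply: iter_in.
  rewrite !iterS comm -(am_assoc am) ?(am_mul am) ?iter_in //.
  by rewrite (am_assoc am hy cE) ?iter_in // ey (am_mul1l am) ?iter_in.
have := congr1 (op (iter n (op y) e)) hn.
have ccomm k : op c (iter k (op c) e) = op (iter k (op c) e) c.
  elim: k => [|k IHk] /=; first by rewrite (am_mul1l am) // (am_mul1r am).
  by rewrite {1}IHk (am_assoc am) //; apply: iter_in.
rewrite iterS ccomm (am_assoc am) ?iter_in // yc (am_mul1l am) //.
Qed.

Lemma ld_card : c != e -> #|ld_set| < #|E|.
Proof.
move=> ne; apply: proper_card; apply/properP; split.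
  by apply/subsetP => t /ld_setP[].
by exists e; [apply: am_one am | apply: ld_proper].
Qed.

Variable x : nat -> T.
Hypothesis xE : forall k, x k \in E.

Definition is_c k := x k == c.
(** The unit takes the place of [c], so that the sequence loses a letter without shifting
    positions. *)
Definition del_c k := if x k == c then e else x k.
(** At an occurrence [k] of [c], the product from the previous occurrence to [k], both included;
    [pv] points just behind that occurrence. At the first occurrence a letter [c] is prefixed
    artificially, which keeps the value in the local divisor. *)
Definition gap k := op c (op (pr del_c (pv is_c k) k) c).
(* Positions without [c] carry the unit of the local divisor. *)
Definition gaps k := if x k == c then gap k else c.

Lemma del_cE k : del_c k \in E.
Proof. by rewrite /del_c; case: ifP => // _; apply: am_one am. Qed.

Lemma gap_ld k : gap k \in ld_set.
Proof.
have hp := pr_in (pv is_c k) k del_cE.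
apply/ld_setP; split; first by rewrite !(am_mul am).
  by exists (op c (pr del_c (pv is_c k) k)); rewrite ?(am_mul am) // /gap (am_assoc am).
by exists (op (pr del_c (pv is_c k) k) c); rewrite ?(am_mul am).
Qed.

Lemma gaps_ld k : gaps k \in ld_set.
Proof. by rewrite /gaps; case: ifP => _; [apply: gap_ld | apply: am_one ld_monoid]. Qed.

End LocalDivisor.
End Product.

(** * Maintaining infix products *)

Section Factor.
Variables (T : finType) (op : T -> T -> T) (e : T) (E : {set T}).
Hypothesis am : aperiodic_monoid E op e.
Variable c : T.
Hypothesis cE : c \in E.

(** The letter at [p] is the unit of the local divisor, so the empty product of gaps accounts for
    it. As [r] passes an occurrence of [c], the gap [c u c] multiplies by [u c] through [ld_opc],
    where [u] is the tail collected so far, and the tail restarts; any other letter just extends the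
    tail. *)
Lemma pr_factor x p r : (forall k, x k \in E) -> x p = c -> p < r ->
  pr op e x p r = op (pr (ld_op op E c) c (gaps op e c x) p.+1 r)
                     (pr op e (del_c e c x) (pv (is_c c x) r) r).
Proof.
move=> xE xp; have ldm := ld_monoid am cE; have gE := gaps_ld am cE xE.
have dE := del_cE am c xE.
have ldE s : s \in ld_set op E c -> s \in E by case/ld_setP.
elim: r => // r IH; rewrite ltnS leq_eqVlt => /orP[/eqP <-|hr].
  rewrite (pr_one am) // xp /= /is_c xp eqxx !pr_nil // (am_mul1r am) //.
have hpr := IH hr; rewrite (pr_recr am) ?(ltnW hr) // hpr (pr_recr ldm) //.
have h1 := pr_in ldm p.+1 r gE; have h2 := pr_in am (pv (is_c c x) r) r dE.
rewrite /= {2}/is_c /gaps; case: eqP => [er|ner].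
  rewrite (pr_nil _ _ _ (leqnn _)) (am_mul1r am); last first.
    by apply: ldE; apply: (am_mul ldm) => //; apply: gap_ld.
  by rewrite er /gap (ld_opc am cE) ?(am_mul am) // (am_assoc am) //; apply: ldE.
rewrite (am_mul1r ldm) // (pr_recr am dE); last by case: (pv_spec (is_c c x) r).
rewrite {3}/del_c; case: eqP => // _; rewrite (am_assoc am) //; exact: ldE.
Qed.

Lemma pr_no_c x l r : (forall k, l <= k < r -> x k != c) ->
  pr op e x l r = pr op e (del_c e c x) l r.
Proof. by move=> h; apply: pr_ext => k /h; rewrite /del_c => /negbTE ->. Qed.

(* Changing position [i] affects the gaps ending at [i] and at the next occurrence [s] of [c] only. *)
Lemma gaps_upd x i v s n : i < n -> c != e -> (forall k, n <= k -> x k = e) ->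
  let x' := fun k => if k == i then v else x k in
  i < s <= n -> (s < n -> x' s = c) -> (forall k, i < k < s -> x' k != c) ->
  gaps op e c x' = fun k => if (k == s) && (s < n) then gap op e c x' s
    else if k == i then gaps op e c x' i else gaps op e c x k.
Proof.
move=> hin nce xn x' /andP[his hsn] xs hno; apply: functional_extensionality => k.
case: (k =P s) => [->|ks] /=.
  case: ltnP => hs; first by rewrite /gaps xs // eqxx.
  have -> : s = n by lia.
  rewrite gtn_eqF // /gaps /x' gtn_eqF // xn //.
  by rewrite eq_sym (negbTE nce).
case: eqP => [->|ki] //.
have xk : x' k = x k by rewrite /x'; case: eqP.
rewrite /gaps xk; case: eqP => // xkc; rewrite /gap.
have hk : k < n by rewrite ltnNge; apply/negP => /xn e1; case/eqP: nce; rewrite -e1.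
have agree t : t != i -> is_c c x' t = is_c c x t.
  by move=> ht; rewrite /is_c /x' (negbTE ht).
have dagree t : t != i -> del_c e c x' t = del_c e c x t.
  by move=> ht; rewrite /del_c /x' (negbTE ht).
have [hki|hki] := ltnP k i.
  have -> : pv (is_c c x) k = pv (is_c c x') k.
    have [p1 p2 p3] := pv_spec (is_c c x') k; apply: pv_uniq => //.
      by move=> h; rewrite -agree ?p1 //; lia.
    by move=> t ht; rewrite -agree ?p3 //; lia.
  congr (op c (op _ c)); apply: pr_ext => t ht; apply: dagree; lia.
have sk : s < k.
  have h1 : i < k by lia.
  rewrite ltnNge; apply/negP => h2; have : x' k != c by apply: hno; lia.
  by rewrite xk xkc eqxx.
have [p1 p2 p3] := pv_spec (is_c c x') k.
(* The occurrence before [k] is at [s] or later, so the gap ending at [k] does not reach back to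
   [i]. *)
have ps : s < pv (is_c c x') k.
  rewrite ltnNge; apply/negP => h; have := p3 s; rewrite h sk => /(_ isT).
  by rewrite /is_c xs ?eqxx //; lia.
have -> : pv (is_c c x) k = pv (is_c c x') k.
  apply: pv_uniq => //.
    by move=> h; rewrite -agree ?p1 //; lia.
  by move=> t ht; rewrite -agree ?p3 //; lia.
congr (op c (op _ c)); apply: pr_ext => t ht; apply: dagree; lia.
Qed.

End Factor.

(** Table lookup as an expression: the sum of all entries weighted by an equality test on the index.
    The tables depend only on the monoid and the alphabet, so a lookup takes constant time and no
    memory. *)
Fixpoint tabE (l : seq expr) i ev :=
  if l is x :: l' then Bin OAdd (Bin OMul (Bin OEq ev (Cst i)) x) (tabE l' i.+1 ev)
  else Cst 0.

Lemma tabE_ok lim arr st l i ev : 0 < lim -> safe lim arr st ev ->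
  (forall k, k < size l -> safe lim arr st (nth (Cst 0) l k) /\ eval st (nth (Cst 0) l k) < lim) ->
  i + size l <= lim ->
  safe lim arr st (tabE l i ev) /\
  eval st (tabE l i ev) =
    if i <= eval st ev < i + size l then eval st (nth (Cst 0) l (eval st ev - i)) else 0.
Proof.
move=> l0 hs; elim: l i => [|x l IH] i hl hi /=.
  by split=> //; rewrite addn0; case: andP => // -[h1 h2]; lia.
have [||k2 e2] := IH i.+1.
- by move=> k hk; apply: (hl k.+1).
- by rewrite addSnnS.
have [sx ex] := hl 0 isT; rewrite /= in sx ex.
have il : i < lim by apply: leq_trans hi; rewrite /= addnS ltnS leq_addr.
have hb : eval st (tabE l i.+1 ev) < lim.
  rewrite e2; case: ifP => // h; apply: (hl (eval st ev - i.+1).+1 _).2.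
  by rewrite /=; lia.
rewrite e2; case: (eval st ev =P i) => [ei|ni] /=.
  have -> : (i < eval st ev < i.+1 + size l) = false by lia.
  have -> : (i <= eval st ev < i + (size l).+1) = true by lia.
  rewrite mul1n addn0 ei subnn /=; split=> //; do ?split=> //.
rewrite mul0n add0n; split.
  by do ?split=> //; rewrite -e2.
have -> : (i <= eval st ev < i + (size l).+1) = (i < eval st ev < i.+1 + size l) by lia.
by case: ifP => // h; rewrite (_ : eval st ev - i = (eval st ev - i.+1).+1) //; lia.
Qed.

(** * Operations on a finite type as expressions *)

Section Tables.
Variable T : finType.

Definition code (t : T) : nat := enum_rank t.

Lemma code_lt t : code t < #|T|. Proof. exact: ltn_ord. Qed.

Lemma code_inj : injective code.
Proof. by move=> s t /val_inj/enum_rank_inj. Qed.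

Definition fun1 (f : T -> T) ev := tabE [seq Cst (code (f t)) | t <- enum T] 0 ev.
Definition fun2 (f : T -> T -> T) e1 e2 := tabE [seq fun1 (f s) e2 | s <- enum T] 0 e1.

Lemma nth_code (X : Type) (x0 : X) (f : T -> X) t : nth x0 [seq f s | s <- enum T] (code t) = f t.
Proof. by rewrite (nth_map t) ?nth_enum_rank // -cardE code_lt. Qed.

Variables (lim arr : nat).
Hypothesis T_lim : #|T| <= lim.

Lemma tab_code st (g : T -> expr) ev t : safe lim arr st ev -> eval st ev = code t ->
  (forall s, safe lim arr st (g s) /\ eval st (g s) < lim) ->
  safe lim arr st (tabE [seq g s | s <- enum T] 0 ev) /\
  eval st (tabE [seq g s | s <- enum T] 0 ev) = eval st (g t).
Proof.
move=> hs ev_t hg.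
have hT : size [seq g s | s <- enum T] = #|T| by rewrite size_map -cardE.
have [|||s1 ->] := @tabE_ok lim arr st [seq g s | s <- enum T] 0 ev _ hs.
- by apply: leq_trans T_lim; apply: leq_trans (code_lt t).
- by move=> k; rewrite size_map => hk; rewrite (nth_map t).
- by rewrite hT.
by rewrite hT ev_t add0n code_lt /= subn0 nth_code.
Qed.

Lemma fun1_ok st f ev t : safe lim arr st ev -> eval st ev = code t ->
  safe lim arr st (fun1 f ev) /\ eval st (fun1 f ev) = code (f t).
Proof.
move=> hs ev_t; apply: (tab_code hs ev_t (g := fun s => Cst (code (f s)))) => s.
by rewrite /= (leq_trans (code_lt _) T_lim).
Qed.

Lemma fun2_ok st f e1 e2 s t : safe lim arr st e1 -> eval st e1 = code s ->
  safe lim arr st e2 -> eval st e2 = code t ->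
  safe lim arr st (fun2 f e1 e2) /\ eval st (fun2 f e1 e2) = code (f s t).
Proof.
move=> h1 v1 h2 v2.
have hg r : safe lim arr st (fun1 (f r) e2) /\ eval st (fun1 (f r) e2) < lim.
  have [k1 ->] := fun1_ok (f r) h2 v2; split=> //; exact: leq_trans (code_lt _) T_lim.
have [k1 ->] := tab_code h1 v1 hg; split=> //.
by have [] := fun1_ok (f s) h2 v2.
Qed.

End Tables.

Definition scr a0 a1 := [pred b | (7 <= b < 20) || (a0 <= b < a1)].

(* [cset] stores the element coded in array 17 at the position given by array 16; [cinf] puts the code of the product of the infix [[l, r)] given by arrays 18 and 19 into array 14. *)
Record comp_spec (T : finType) (op : T -> T -> T) (e : T) (A : {set T}) lim arr H a0 a1
    (cset cinf : cmd) C (Inv : (nat -> T) -> state -> Prop) : Prop := CompSpec {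
  cs_frame : forall x st st', (forall b, a0 <= b < a1 -> st' b =1 st b) -> Inv x st -> Inv x st';
  cs_init : forall st, (forall b i, a0 <= b < a1 -> st b i = 0) -> Inv (fun=> e) st;
  cs_set : forall x st i v, glob H st -> Inv x st -> i < 2 ^ width H.+1 -> v \in e |: A ->
    st 16 0 = i -> st 17 0 = code v ->
    run lim arr cset st (C * H.+2) (fun st' =>
      Inv (fun k => if k == i then v else x k) st' /\ same (scr a0 a1) st st');
  cs_inf : forall x st l r, glob H st -> Inv x st -> l <= r < 2 ^ width H.+1 ->
    st 18 0 = l -> st 19 0 = r ->
    run lim arr cinf st (C * H.+2) (fun st' =>
      [/\ Inv x st', same (scr a0 a1) st st' & st' 14 0 = code (pr op e x l r)])
}.

(** The programs, the arrays they occupy and the constant [C] come before [lim], [arr] and [H]: one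
    pair of programs serves all lengths. *)
Definition computable (T : finType) (op : T -> T -> T) (e : T) (A : {set T}) a0 :=
  exists a1 cset cinf C, a0 <= a1 /\ forall lim arr H,
    8 * (2 ^ width H.+1 * 2 ^ width H.+1) <= lim -> #|T| <= lim -> a1 <= arr ->
    exists Inv, comp_spec op e A lim arr H a0 a1 cset cinf C Inv.

(** * The inductive step: structures without [c] and over the local divisor are combined *)

Section Programs.
Variables (T : finType) (op : T -> T -> T) (e c : T) (a0 : nat).
Variables (setB infB setM infM : cmd).
Let li := a0 + 5.
Let lv := a0 + 6.
Let ls := a0 + 7.
Let lr := a0 + 8.
Let la := a0 + 9.

(** The arrays [a0] to [a0 + 4] hold the occurrences of [c] and the next five are local variables.
    Both sub-structures occupy other arrays, so the locals survive calls, while the scratch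
    variables 7 to 19 do not and are reloaded each time. *)
Definition gap_prog L :=
  Seq (SetV 16 (V L)) (Seq (os_prv a0) (Seq (SetV 18 (V 14)) (Seq (SetV 19 (V L))
 (Seq infB (Seq (SetV 17 (fun1 (fun u => op c (op u c)) (V 14)))
 (Seq (SetV 16 (V L)) setM)))))).

(** The occurrences and the sequence without [c] are brought up to date before any gap is
    recomputed, since a gap is read off from both. Then the entry at the position itself is
    refreshed, a gap or the unit [c], and last the gap ending at the next occurrence. *)
Definition set_prog :=
  Seq (SetV li (V 16)) (Seq (SetV lv (V 17))
 (Seq (SetV 17 (Bin OEq (V lv) (Cst (code c)))) (Seq (os_set a0)
 (Seq (SetV 16 (V li))
 (Seq (If (Bin OEq (V lv) (Cst (code c))) (SetV 17 (Cst (code e))) (SetV 17 (V lv)))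
 (Seq setB
 (Seq (If (Bin OEq (V lv) (Cst (code c))) (gap_prog li)
        (Seq (SetV 16 (V li)) (Seq (SetV 17 (Cst (code c))) setM)))
 (Seq (SetV 16 (V li)) (Seq (os_nxt a0) (Seq (SetV ls (V 14))
      (If (Bin OLt (V ls) (V 3)) (gap_prog ls) Skip))))))))))).

(** Three factors: the part before the first occurrence [s] of [c], the product of the gaps after
    [s] in the local divisor, which includes the letter at [s], and the part behind the last
    occurrence. *)
Definition inf_split :=
   Seq (SetV 18 (V li))
   (Seq (SetV 19 (V ls))
   (Seq infB
   (Seq (SetV la (V 14))
   (Seq (SetV 18 (Bin OAdd (V ls) (Cst 1)))
   (Seq (SetV 19 (V lr))
   (Seq infM
   (Seq (SetV la (fun2 op (V la) (V 14)))
   (Seq (SetV 16 (V lr))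
   (Seq (os_prv a0)
   (Seq (SetV 18 (V 14))
   (Seq (SetV 19 (V lr))
   (Seq infB
   (SetV 14 (fun2 op (V la) (V 14))))))))))))))).

(** Successor search is strict, so the left end itself is first looked up in the bit table. Without
    an occurrence inside the infix, the structure without [c] answers alone. *)
Definition inf_prog :=
  Seq (SetV li (V 18)) (Seq (SetV lr (V 19))
 (If (Bin OLt (V li) (V lr))
   (Seq (If (Ld a0 (V li)) (SetV ls (V li))
          (Seq (SetV 16 (V li)) (Seq (os_nxt a0) (SetV ls (V 14)))))
   (If (Bin OLt (V ls) (V lr)) inf_split
     (Seq (SetV 18 (V li)) (Seq (SetV 19 (V lr)) infB))))
   (SetV 14 (Cst (code e))))).

Variables (lim arr H aB a1 : nat) (CB CM : nat).
Let U := 2 ^ width H.+1.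
Hypothesis lim_ok : 8 * (U * U) <= lim.
Hypothesis T_lim : #|T| <= lim.
Hypothesis a_ok : [/\ 20 <= a0, a0 + 10 <= aB, aB <= a1 & a1 <= arr].
Variables (InvB InvM : (nat -> T) -> state -> Prop) (B : {set T}) (E : {set T}).
Hypothesis specB : comp_spec op e B lim arr H (a0 + 10) aB setB infB CB InvB.
Hypothesis am : aperiodic_monoid E op e.
Hypothesis cE : c \in E.
Let E' := ld_set op E c.
Let op' := ld_op op E c.
Hypothesis specM : comp_spec op' c E' lim arr H aB a1 setM infM CM InvM.

Let os_ok : 20 <= a0 /\ a0.+4 < arr. Proof. by case: a_ok; lia. Qed.

(** Time in units of [H + 2]: constants of consecutive commands simply add up, and steps of constant
    cost are absorbed. *)
Definition rn C k st Q := run lim arr k st (C * H.+2) Q.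

Lemma rn_seq C1 C2 c1 c2 st (R Q : state -> Prop) : rn C1 c1 st R ->
  (forall st', R st' -> rn C2 c2 st' Q) -> rn (C1 + C2) (Seq c1 c2) st Q.
Proof. by move=> h1 h2; rewrite /rn mulnDl; apply: run_seq; apply: run_weaken h1. Qed.

Lemma rn_weaken C C' k st (Q Q' : state -> Prop) : C <= C' ->
  (forall st', Q st' -> Q' st') -> rn C k st Q -> rn C' k st Q'.
Proof. by move=> h hq; apply: run_weaken => //; rewrite leq_mul2r h orbT. Qed.

Lemma rn_set r ex st v (Q : state -> Prop) : r < arr -> safe lim arr st ex -> eval st ex = v ->
  Q (upd2 st r 0 v) -> rn (expr_cost ex + 6) (SetV r ex) st Q.
Proof.
move=> hr hs ev hq; apply: (run_weaken _ (fun _ h => h) (run_set lim_ok os_ok hr hs ev hq)).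
by rewrite leq_pmulr.
Qed.

Lemma rn_if ex c1 c2 C st (bb : bool) (Q : state -> Prop) : safe lim arr st ex -> eval st ex = bb ->
  (bb -> rn C c1 st Q) -> (~~ bb -> rn C c2 st Q) -> rn (expr_cost ex + 3 + C) (If ex c1 c2) st Q.
Proof.
move=> hs eb h1 h2; rewrite /rn mulnDl.
apply: (@run_weaken _ _ _ _ (expr_cost ex + C * H.+2 + 3) _ _ _ _ (fun _ h => h)).
  by rewrite addnAC leq_add2r leq_pmulr.
by case: bb eb h1 h2 => eb h1 h2; apply: run_if hs _ _; rewrite eb // => _; do [exact: h1 | exact: h2].
Qed.

Lemma rn_skip C st (Q : state -> Prop) : Q st -> rn C Skip st Q.
Proof. by move=> h; apply: (run_weaken (leq0n _) (fun _ h => h)); apply: (@run_wp _ _ Skip). Qed.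

(** The three components are described independently, because in the middle of an update they belong
    to different sequences. *)
Definition ok (st : state) P z y := [/\ glob H st, OS H a0 st P, InvB z st & InvM y st].
Definition fr (st st' : state) :=
  same (scr a0 a1) st st' /\ forall b, a0 + 5 <= b < a0 + 10 -> st' b =1 st b.

Lemma fr_trans st1 st2 st3 : fr st1 st2 -> fr st2 st3 -> fr st1 st3.
Proof.
move=> [h1 g1] [h2 g2]; split; first exact: same_trans h1 h2.
by move=> b hb i; rewrite g2 ?g1.
Qed.

Lemma ok_reg st P z y r v : ok st P z y -> 7 <= r < 20 ->
  ok (upd2 st r 0 v) P z y /\ fr st (upd2 st r 0 v).
Proof.
move=> [hg ho hB hM] hr.
have hu b : ~~ (7 <= b < 20) -> upd2 st r 0 v b =1 st b.
  by move=> hb i; rewrite updE; case: eqP => // eb; rewrite eb hr in hb.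
case: (a_ok) => i1 i2 i3 i4.
split; last by split=> b /= hb; apply: hu; lia.
split.
- by case: hg => g1 g2; split; rewrite hu.
- by apply: (OS_same lim_ok os_ok _ ho) => b hb; apply: hu; lia.
- by apply: (cs_frame specB) hB => b hb; apply: hu; lia.
- by apply: (cs_frame specM) hM => b hb; apply: hu; lia.
Qed.

Lemma ok_loc st P z y L v : ok st P z y -> a0 + 5 <= L < a0 + 10 ->
  ok (upd2 st L 0 v) P z y /\ same (scr a0 a1) st (upd2 st L 0 v).
Proof.
move=> [hg ho hB hM] hr.
have hu b : b != L -> upd2 st L 0 v b =1 st b.
  by move=> hb i; rewrite updE (negbTE hb).
case: (a_ok) => i1 i2 i3 i4.
split; last by move=> b /= hb; apply: hu; lia.
split.
- by case: hg => g1 g2; split; rewrite hu //; lia.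
- by apply: (OS_same lim_ok os_ok _ ho) => b hb; apply: hu; lia.
- by apply: (cs_frame specB) hB => b hb; apply: hu; lia.
- by apply: (cs_frame specM) hM => b hb; apply: hu; lia.
Qed.

Lemma sv st r : r < arr -> safe lim arr st (V r).
Proof. by move=> h; split=> //; apply: (limk lim_ok os_ok). Qed.

Lemma do_reg r ex v st P z y C k (Q : state -> Prop) : 7 <= r < 20 -> ok st P z y ->
  safe lim arr st ex -> eval st ex = v ->
  (forall st', ok st' P z y -> fr st st' ->
     (forall r', r' < 20 -> st' r' 0 = if r' == r then v else st r' 0) -> rn C k st' Q) ->
  rn (expr_cost ex + 6 + C) (Seq (SetV r ex) k) st Q.
Proof.
move=> hr ho hs ev hk; have [h1 h2] := ok_reg v ho hr.
apply: (rn_seq (R := eq (upd2 st r 0 v))).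
  by apply: rn_set hs ev _ => //; case: (a_ok); lia.
move=> _ <-; apply: hk => // r' hr'; by rewrite updE andbT.
Qed.

Lemma do_loc L ex v st P z y C k (Q : state -> Prop) : a0 + 5 <= L < a0 + 10 -> ok st P z y ->
  safe lim arr st ex -> eval st ex = v ->
  (forall st', ok st' P z y -> same (scr a0 a1) st st' ->
     (forall r', r' < 20 -> st' r' 0 = st r' 0) ->
     (forall b, a0 + 5 <= b < a0 + 10 -> st' b 0 = if b == L then v else st b 0) -> rn C k st' Q) ->
  rn (expr_cost ex + 6 + C) (Seq (SetV L ex) k) st Q.
Proof.
move=> hr ho hs ev hk; have [h1 h2] := ok_loc v ho hr.
apply: (rn_seq (R := eq (upd2 st L 0 v))).
  by apply: rn_set hs ev _ => //; case: (a_ok); lia.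
move=> _ <-; apply: hk => // [r' hr'|b hb]; rewrite updE andbT //.
by case: eqP => // ?; case: (a_ok); lia.
Qed.

Lemma ok_os st st' P P' z y : ok st P z y -> OS H a0 st' P' -> same (os_scratch a0) st st' ->
  ok st' P' z y /\ fr st st'.
Proof.
move=> [hg ho hB hM] ho' hs; case: (a_ok) => i1 i2 i3 i4.
split; last by split=> b /= hb; apply: hs => /=; lia.
split=> //.
- by apply: glob_same hs hg => /=; lia.
- by apply: (cs_frame specB) hB => b hb; apply: hs => /=; lia.
- by apply: (cs_frame specM) hM => b hb; apply: hs => /=; lia.
Qed.

Lemma op_set st P z y i (v : bool) : ok st P z y -> i < U -> st 16 0 = i -> st 17 0 = v ->
  rn (set_costs a0) (os_set a0) st (fun st' =>
    ok st' (fun k => if k == i then v else P k) z y /\ fr st st').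
Proof.
move=> ho hi h1 h2; have [hg hos _ _] := ho.
apply: run_weaken (os_set_ok lim_ok os_ok hg hos hi h1 h2) => // st' [a2 a3].
exact: ok_os ho a2 a3.
Qed.

Lemma op_prv st P z y i : ok st P z y -> i < U -> st 16 0 = i ->
  rn (pred_costs a0) (os_prv a0) st (fun st' =>
    [/\ ok st' P z y, fr st st' & st' 14 0 = pv P i]).
Proof.
move=> ho hi h1; have [hg hos _ _] := ho.
apply: run_weaken (os_prv_ok lim_ok os_ok hg hos hi h1) => // st' [a2 a3 a4].
by have [? ?] := ok_os ho a2 a3.
Qed.

Lemma op_nxt st P z y i : ok st P z y -> i < U -> st 16 0 = i ->
  rn (pred_costs a0) (os_nxt a0) st (fun st' =>
    [/\ ok st' P z y, fr st st', i < st' 14 0 <= U,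
      st' 14 0 < U -> P (st' 14 0) & forall k, i < k < st' 14 0 -> ~~ P k]).
Proof.
move=> ho hi h1; have [hg hos _ _] := ho.
apply: run_weaken (os_nxt_ok lim_ok os_ok hg hos hi h1) => // st' [a2 a3 a4 a5 a6].
by have [? ?] := ok_os ho a2 a3.
Qed.

Lemma ok_B st st' P z z' y : ok st P z y -> InvB z' st' -> same (scr (a0 + 10) aB) st st' ->
  ok st' P z' y /\ fr st st'.
Proof.
move=> [hg ho hB hM] hB' hs; case: (a_ok) => i1 i2 i3 i4.
split; last by split=> b /= hb; apply: hs => /=; lia.
split=> //.
- by apply: glob_same hs hg => /=; lia.
- by apply: (OS_same lim_ok os_ok _ ho) => b hb; apply: hs => /=; lia.
- by apply: (cs_frame specM) hM => b hb; apply: hs => /=; lia.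
Qed.

Lemma ok_M st st' P z y y' : ok st P z y -> InvM y' st' -> same (scr aB a1) st st' ->
  ok st' P z y' /\ fr st st'.
Proof.
move=> [hg ho hB hM] hM' hs; case: (a_ok) => i1 i2 i3 i4.
split; last by split=> b /= hb; apply: hs => /=; lia.
split=> //.
- by apply: glob_same hs hg => /=; lia.
- by apply: (OS_same lim_ok os_ok _ ho) => b hb; apply: hs => /=; lia.
- by apply: (cs_frame specB) hB => b hb; apply: hs => /=; lia.
Qed.

Lemma op_setB st P z y i v : ok st P z y -> i < U -> v \in e |: B -> st 16 0 = i -> st 17 0 = code v ->
  rn CB setB st (fun st' => ok st' P (fun k => if k == i then v else z k) y /\ fr st st').
Proof.
move=> ho hi hv h1 h2; have [hg _ hB _] := ho.
apply: run_weaken (cs_set specB hg hB hi hv h1 h2) => // st' [a2 a3]; exact: ok_B ho a2 a3.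
Qed.

Lemma op_setM st P z y i v : ok st P z y -> i < U -> v \in c |: E' -> st 16 0 = i -> st 17 0 = code v ->
  rn CM setM st (fun st' => ok st' P z (fun k => if k == i then v else y k) /\ fr st st').
Proof.
move=> ho hi hv h1 h2; have [hg _ _ hM] := ho.
apply: run_weaken (cs_set specM hg hM hi hv h1 h2) => // st' [a2 a3]; exact: ok_M ho a2 a3.
Qed.

Lemma op_infB st P z y l r : ok st P z y -> l <= r < U -> st 18 0 = l -> st 19 0 = r ->
  rn CB infB st (fun st' => [/\ ok st' P z y, fr st st' & st' 14 0 = code (pr op e z l r)]).
Proof.
move=> ho hi h1 h2; have [hg _ hB _] := ho.
apply: run_weaken (cs_inf specB hg hB hi h1 h2) => // st' [a2 a3 a4].
by have [? ?] := ok_B ho a2 a3.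
Qed.

Lemma op_infM st P z y l r : ok st P z y -> l <= r < U -> st 18 0 = l -> st 19 0 = r ->
  rn CM infM st (fun st' => [/\ ok st' P z y, fr st st' & st' 14 0 = code (pr op' c y l r)]).
Proof.
move=> ho hi h1 h2; have [hg _ _ hM] := ho.
apply: run_weaken (cs_inf specM hg hM hi h1 h2) => // st' [a2 a3 a4].
by have [? ?] := ok_M ho a2 a3.
Qed.

Lemma fr_loc st st' b : fr st st' -> a0 + 5 <= b < a0 + 10 -> st' b 0 = st b 0.
Proof. by case=> _ h hb; apply: h. Qed.

Lemma arr20 r : r < 20 -> r < arr. Proof. by case: a_ok; lia. Qed.
Lemma arrl b : a0 + 5 <= b < a0 + 10 -> b < arr. Proof. by case: a_ok; lia. Qed.

Definition gap_fun u := op c (op u c).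
Definition gap_cost := pred_costs a0 + CB + CM + expr_cost (fun1 gap_fun (V 14)) + 100.

Lemma rn_le C C' k st Q : rn C k st Q -> C <= C' -> rn C' k st Q.
Proof. by move=> h hC; apply: rn_weaken h. Qed.

Lemma gap_ok st P z y L k : ok st P z y -> a0 + 5 <= L < a0 + 10 -> st L 0 = k -> k < U ->
  gap_fun (pr op e z (pv P k) k) \in c |: E' ->
  rn gap_cost (gap_prog L) st (fun st' =>
    ok st' P z (fun j => if j == k then gap_fun (pr op e z (pv P k) k) else y j) /\ fr st st').
Proof.
move=> ho hL eL hk hval; rewrite /gap_prog.
have hLa := arrl hL.
apply: rn_le.
  apply: (do_reg _ ho (sv _ hLa) eL) => // st1 ho1 hf1 r1.
  have e16 : st1 16 0 = k by rewrite r1.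
  apply: rn_seq (op_prv ho1 hk e16) _ => st2 [ho2 hf2 e14].
  have {}hf2 := fr_trans hf1 hf2.
  apply: (do_reg _ ho2 (sv _ (arr20 _)) e14) => // st3 ho3 hf3 r3.
  have {}hf3 := fr_trans hf2 hf3.
  have eL3 : st3 L 0 = k by rewrite (fr_loc hf3 hL).
  apply: (do_reg _ ho3 (sv _ hLa) eL3) => // st4 ho4 hf4 r4.
  have {}hf4 := fr_trans hf3 hf4.
  have [p1 p2 p3] := pv_spec P k.
  have hr : pv P k <= k < U by rewrite p2.
  have e18 : st4 18 0 = pv P k by rewrite r4 // r3.
  have e19 : st4 19 0 = k by rewrite r4.
  apply: rn_seq (op_infB ho4 hr e18 e19) _ => st5 [ho5 hf5 e14'].
  have {}hf5 := fr_trans hf4 hf5.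
  have [s6 v6] := fun1_ok T_lim gap_fun (sv st5 (arr20 (isT : 14 < 20))) e14'.
  apply: (do_reg _ ho5 s6 v6) => // st6 ho6 hf6 r6.
  have {}hf6 := fr_trans hf5 hf6.
  have eL6 : st6 L 0 = k by rewrite (fr_loc hf6 hL).
  apply: (do_reg _ ho6 (sv _ hLa) eL6) => // st7 ho7 hf7 r7.
  have {}hf7 := fr_trans hf6 hf7.
  have e16' : st7 16 0 = k by rewrite r7.
  have e17' : st7 17 0 = code (gap_fun (pr op e z (pv P k) k)) by rewrite r7 // r6.
  apply: rn_weaken (leqnn _) _ (op_setM ho7 hk hval e16' e17') => st8 [ho8 hf8].
  by split=> //; apply: fr_trans hf7 hf8.
rewrite /gap_cost; move: (expr_cost (fun1 _ _)) => F /=; lia.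
Qed.

Hypothesis nce : c != e.
Variable A : {set T}.
Hypothesis cA : c \in A.
Hypothesis AE : A \subset E.
Hypothesis BA : B = A :\ c.

(** From [U] on the sequence is the unit, which differs from [c], so searching the occurrences below
    [U] finds them all. *)
Definition Inv x (st : state) := [/\ OS H a0 st (is_c c x), InvB (del_c e c x) st,
  InvM (gaps op e c x) st, forall k, x k \in e |: A & forall k, U <= k -> x k = e].

Definition set_total := set_costs a0 + pred_costs a0 + CB + CM + 2 * gap_cost + 400.

Lemma set_prog_ok x st i v : glob H st -> Inv x st -> i < U -> v \in e |: A ->
  st 16 0 = i -> st 17 0 = code v ->
  rn set_total set_prog st (fun st' =>
    Inv (fun k => if k == i then v else x k) st' /\ same (scr a0 a1) st st').
Proof.
move=> hg [hos hB hM xA xU] hi hv e16 e17.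
set x' := fun k => if k == i then v else x k.
have ho : ok st (is_c c x) (del_c e c x) (gaps op e c x) by split.
have xE k : x k \in E.
  by have := xA k; rewrite !inE => /orP[/eqP ->|/(subsetP AE)] //; apply: am_one am.
have vE : v \in E.
  by move: hv; rewrite !inE => /orP[/eqP ->|/(subsetP AE)] //; apply: am_one am.
have x'E k : x' k \in E by rewrite /x'; case: ifP.
have ex' : is_c c x' = fun k => if k == i then v == c else is_c c x k.
  by apply: functional_extensionality => k; rewrite /is_c /x'; case: ifP.
have ed' : del_c e c x' = fun k => if k == i then (if v == c then e else v) else del_c e c x k.
  by apply: functional_extensionality => k; rewrite /del_c /x'; case: (k == i).
have climt (t : T) : code t < lim by apply: leq_trans (code_lt t) T_lim.
have eqc (t : T) : (code t == code c) = (t == c) by apply/eqP/eqP => [/code_inj|->].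
have gi : gaps op e c x' i = if v == c then gap op e c x' i else c.
  by rewrite /gaps /x' eqxx.
have li_ok : a0 + 5 <= li < a0 + 10 by rewrite /li; lia.
have lv_ok : a0 + 5 <= lv < a0 + 10 by rewrite /lv; lia.
have ls_ok : a0 + 5 <= ls < a0 + 10 by rewrite /ls; lia.
have safe_isc st0 : safe lim arr st0 (Bin OEq (V lv) (Cst (code c))).
  by split=> //; [apply/sv/arrl | apply: climt].
rewrite /set_prog; apply: rn_le.
  apply: (do_loc li_ok ho (sv _ (arr20 _)) e16) => // st1 ho1 hf1 r1 l1.
  have e17' : st1 17 0 = code v by rewrite r1.
  apply: (do_loc lv_ok ho1 (sv _ (arr20 _)) e17') => // st2 ho2 hf2 r2 l2.
  have {}hf2 := same_trans hf1 hf2.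
  have eli : st2 li 0 = i by rewrite l2 // l1 // eqxx /li /lv eqn_add2l.
  have elv : st2 lv 0 = code v by rewrite l2 // eqxx.
  have eb st0 : st0 lv 0 = code v -> eval st0 (Bin OEq (V lv) (Cst (code c))) = (v == c).
    by move=> h; rewrite /= h eqc.
  apply: (do_reg _ ho2 (safe_isc _) (eb _ elv)) => // st3 ho3 hf3 r3.
  have e16' : st3 16 0 = i by rewrite r3 // r2 // r1.
  apply: rn_seq (op_set ho3 hi e16' (r3 17 isT)) _ => st4 [ho4 hf4].
  rewrite -ex' in ho4; have {}hf4 := fr_trans hf3 hf4.
  have eli4 : st4 li 0 = i by rewrite (fr_loc hf4).
  apply: (do_reg _ ho4 (sv _ (arrl li_ok)) eli4) => // st5 ho5 hf5 r5.
  have {}hf5 := fr_trans hf4 hf5.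
  have elv5 : st5 lv 0 = code v by rewrite (fr_loc hf5).
  apply: (rn_seq (C1 := 100) (R := fun st' => [/\ ok st' (is_c c x') (del_c e c x) (gaps op e c x),
      fr st2 st', st' 16 0 = i & st' 17 0 = code (if v == c then e else v)])).
    apply: (@rn_le (expr_cost (Bin OEq (V lv) (Cst (code c))) + 3 + 20)); last by [].
    apply: (rn_if (bb := v == c) (safe_isc _) (eb _ elv5)) => hvc.
      apply: rn_le (rn_set (v := code e) _ _ _ _) _ => //; [exact: arr20 | exact: climt | ].
      have [h1 h2] := ok_reg (r := 17) (code e) ho5 isT.
      by split=> //; [apply: fr_trans hf5 h2 | rewrite updE /= r5 | rewrite updE hvc].
    apply: rn_le (rn_set (v := code v) _ _ _ _) _ => //; [exact: arr20 | exact/sv/arrl | ].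
    have [h1 h2] := ok_reg (r := 17) (code v) ho5 isT.
    by split=> //; [apply: fr_trans hf5 h2 | rewrite updE /= r5 | rewrite updE (negbTE hvc)].
  move=> st6 [ho6 hf6 e16'' e17''].
  (* The letter [c] is handed on as the unit, so the sub-structure works with the alphabet without
     [c]. *)
  have hvB : (if v == c then e else v) \in e |: B.
    rewrite BA; case: (v =P c) => [_|/eqP hvc]; first by rewrite !inE eqxx.
    by move: hv; rewrite !inE hvc.
  apply: rn_seq (op_setB ho6 hi hvB e16'' e17'') _ => st7 [ho7 hf7].
  rewrite -ed' in ho7; have {}hf7 := fr_trans hf6 hf7.
  have eli7 : st7 li 0 = i by rewrite (fr_loc hf7).
  have elv7 : st7 lv 0 = code v by rewrite (fr_loc hf7).
  have gapE k : gap op e c x' k \in c |: E' by rewrite inE gap_ld // orbT.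
  apply: (rn_seq (C1 := gap_cost + CM + 100) (R := fun st' => ok st' (is_c c x') (del_c e c x')
      (fun k => if k == i then gaps op e c x' i else gaps op e c x k) /\ fr st2 st')).
    apply: (@rn_le (expr_cost (Bin OEq (V lv) (Cst (code c))) + 3 + (gap_cost + CM + 50))).
      2: by rewrite /=; lia.
    apply: (rn_if (bb := v == c) (safe_isc _) (eb _ elv7)) => hvc.
      apply: rn_weaken _ _ (gap_ok ho7 li_ok eli7 hi (gapE i)); first by lia.
      move=> st8 [ho8 hf8]; split; last exact: fr_trans hf7 hf8.
      by rewrite gi hvc.
    apply: rn_le.
      apply: (do_reg _ ho7 (sv _ (arrl li_ok)) eli7) => // st8 ho8 hf8 r8.
      have {}hf8 := fr_trans hf7 hf8.
      apply: (do_reg (ex := Cst (code c)) (v := code c) _ ho8 (climt c) erefl) => //.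
      move=> st9 ho9 hf9 r9; have {}hf9 := fr_trans hf8 hf9.
      have e16_9 : st9 16 0 = i by rewrite r9 // r8.
      have cin : c \in c |: E' by rewrite inE set11.
      apply: rn_weaken (leqnn _) _ (op_setM ho9 hi cin e16_9 (r9 17 isT)).
      move=> st10 [ho10 hf10]; split; last exact: fr_trans hf9 hf10.
      by rewrite gi (negbTE hvc).
    by rewrite /=; lia.
  move=> st8 [ho8 hf8].
  have eli8 : st8 li 0 = i by rewrite (fr_loc hf8).
  apply: (do_reg _ ho8 (sv _ (arrl li_ok)) eli8) => // st9 ho9 hf9 r9.
  have {}hf9 := fr_trans hf8 hf9.
  apply: rn_seq (op_nxt ho9 hi (r9 16 isT)) _ => st10 [ho10 hf10 hs1 hs2 hs3].
  have {}hf10 := fr_trans hf9 hf10.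
  set s := st10 14 0 in hs1 hs2 hs3.
  (* If no occurrence follows, the search has returned [U] and only the entry at [i] changes. *)
  have gapsE : gaps op e c x' = fun k => if (k == s) && (s < U) then gap op e c x' s
    else if k == i then gaps op e c x' i else gaps op e c x k.
    by apply: gaps_upd => // h; apply/eqP; apply: hs2.
  apply: (do_loc ls_ok ho10 (sv _ (arr20 _)) (erefl s)) => // st11 ho11 hf11 r11 l11.
  have els : st11 ls 0 = s by rewrite l11 // eqxx.
  have hfin : same (scr a0 a1) st st11 := same_trans (same_trans hf2 hf10.1) hf11.
  have eU : st11 3 0 = U by case: ho11 => -[].
  apply: (rn_if (bb := s < U) (C := gap_cost)) => [||hsU|hsU].
  - by split=> //; apply: sv; [apply: arrl | apply: arr20].
  - by rewrite /= els eU.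
  - apply: rn_weaken (leqnn _) _ (gap_ok ho11 ls_ok els hsU (gapE s)) => st12 [ho12 hf12].
    have [_ h1 h2 h3] := ho12; split; last exact: same_trans hfin hf12.1.
    split=> //; last 2 first.
    + by move=> k; rewrite /x'; case: eqP.
    + by move=> k hk; rewrite /x' xU //; case: eqP => // e0; move: hk; rewrite e0 leqNgt hi.
    rewrite gapsE; congr (InvM _ st12): h3.
    by apply: functional_extensionality => k; rewrite hsU andbT.
  apply: rn_skip; have [_ h1 h2 h3] := ho11; split=> //; split=> //.
  + rewrite gapsE; congr (InvM _ st11): h3.
    by apply: functional_extensionality => k; rewrite (negbTE hsU) andbF.
  + by move=> k; rewrite /x'; case: eqP.
  + by move=> k hk; rewrite /x' xU //; case: eqP => // e0; move: hk; rewrite e0 leqNgt hi.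
rewrite /set_total /=; lia.
Qed.

Definition mul_cost := expr_cost (fun2 op (V la) (V 14)).
Definition inf_total := 2 * pred_costs a0 + 2 * CB + CM + 2 * mul_cost + 600.

Lemma ok_Inv x st st' : Inv x st -> ok st' (is_c c x) (del_c e c x) (gaps op e c x) -> Inv x st'.
Proof. by case=> _ _ _ h1 h2 [_ g1 g2 g3]. Qed.

Lemma do_fun2 L t1 t2 st P z y C k (Q : state -> Prop) : a0 + 5 <= L < a0 + 10 -> L = la ->
  ok st P z y -> st L 0 = code t1 -> st 14 0 = code t2 ->
  (forall st', ok st' P z y -> same (scr a0 a1) st st' ->
     (forall b, a0 + 5 <= b < a0 + 10 -> st' b 0 = if b == L then code (op t1 t2) else st b 0) ->
     rn C k st' Q) ->
  rn (mul_cost + 6 + C) (Seq (SetV la (fun2 op (V la) (V 14))) k) st Q.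
Proof.
move=> hL eL ho e1 e2 hk.
have [s1 v1] := fun2_ok T_lim op (sv st (arrl hL)) e1 (sv st (arr20 (isT : 14 < 20))) e2.
rewrite eL in s1 v1 hL hk; apply: (do_loc hL ho s1 v1) => st' h1 h2 _ h3.
exact: hk.
Qed.

Lemma inf_split_ok x st st0 l r s : Inv x st0 -> same (scr a0 a1) st0 st ->
  ok st (is_c c x) (del_c e c x) (gaps op e c x) ->
  l <= s < r -> r < U -> x s = c -> (forall k, l <= k < s -> x k != c) ->
  st li 0 = l -> st ls 0 = s -> st lr 0 = r ->
  rn (pred_costs a0 + 2 * CB + CM + 2 * mul_cost + 300) inf_split st (fun st' =>
    [/\ Inv x st', same (scr a0 a1) st0 st' & st' 14 0 = code (pr op e x l r)]).
Proof.
move=> hinv hst ho /andP[hls hsr] hr xs nc eli els elr.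
have [_ _ _ xA xU] := hinv.
have xE k : x k \in E.
  by have := xA k; rewrite !inE => /orP[/eqP ->|/(subsetP AE)] //; apply: am_one am.
have li_ok : a0 + 5 <= li < a0 + 10 by rewrite /li; lia.
have ls_ok : a0 + 5 <= ls < a0 + 10 by rewrite /ls; lia.
have lr_ok : a0 + 5 <= lr < a0 + 10 by rewrite /lr; lia.
have la_ok : a0 + 5 <= la < a0 + 10 by rewrite /la; lia.
have sU : s < U by apply: ltn_trans hr.
rewrite /inf_split; apply: rn_le.
  apply: (do_reg _ ho (sv _ (arrl li_ok)) eli) => // st1 ho1 hf1 r1.
  have els1 : st1 ls 0 = s by rewrite (fr_loc hf1).
  apply: (do_reg _ ho1 (sv _ (arrl ls_ok)) els1) => // st2 ho2 hf2 r2.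
  have {}hf2 := fr_trans hf1 hf2.
  have b1 : l <= s < U by rewrite hls.
  have e18 : st2 18 0 = l by rewrite r2 // r1.
  apply: rn_seq (op_infB ho2 b1 e18 (r2 19 isT)) _ => st3 [ho3 hf3 e14].
  have {}hf3 := fr_trans hf2 hf3.
  apply: (do_loc la_ok ho3 (sv _ (arr20 _)) e14) => // st4 ho4 hs4 r4 l4.
  have ela4 := l4 _ la_ok; rewrite eqxx in ela4.
  have nla b : a0 + 5 <= b < a0 + 9 -> (b == la) = false by rewrite /la; lia.
  have els4 : st4 ls 0 = s by rewrite l4 // nla ?(fr_loc hf3) // /ls; lia.
  have elr4 : st4 lr 0 = r by rewrite l4 // nla ?(fr_loc hf3) // /lr; lia.
  have hs4' := same_trans (same_trans hst hf3.1) hs4.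
  have s5 : safe lim arr st4 (Bin OAdd (V ls) (Cst 1)).
    split; [exact/sv/arrl | exact: (limk lim_ok os_ok) | rewrite /= els4].
    by have := U_lim lim_ok; rewrite -/U; lia.
  have v5 : eval st4 (Bin OAdd (V ls) (Cst 1)) = s.+1 by rewrite /= els4 addn1.
  apply: (do_reg _ ho4 s5 v5) => // st5 ho5 hf5 r5.
  have elr5 : st5 lr 0 = r by rewrite (fr_loc hf5).
  apply: (do_reg _ ho5 (sv _ (arrl lr_ok)) elr5) => // st6 ho6 hf6 r6.
  have {}hf6 := fr_trans hf5 hf6.
  have b2 : s.+1 <= r < U by rewrite hsr.
  have e18' : st6 18 0 = s.+1 by rewrite r6 // r5.
  apply: rn_seq (op_infM ho6 b2 e18' (r6 19 isT)) _ => st7 [ho7 hf7 e14'].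
  have {}hf7 := fr_trans hf6 hf7.
  have ela7 : st7 la 0 = code (pr op e (del_c e c x) l s) by rewrite (fr_loc hf7).
  apply: (do_fun2 la_ok (erefl _) ho7 ela7 e14') => st8 ho8 hs8 l8.
  have hs8' := same_trans (same_trans hs4' hf7.1) hs8.
  have elr8 : st8 lr 0 = r by rewrite l8 // nla ?(fr_loc hf7) // /lr; lia.
  have ela8 := l8 _ la_ok; rewrite eqxx in ela8.
  apply: (do_reg _ ho8 (sv _ (arrl lr_ok)) elr8) => // st9 ho9 hf9 r9.
  apply: rn_seq (op_prv ho9 hr (r9 16 isT)) _ => st10 [ho10 hf10 e14''].
  have {}hf10 := fr_trans hf9 hf10.
  apply: (do_reg _ ho10 (sv _ (arr20 _)) e14'') => // st11 ho11 hf11 r11.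
  have {}hf11 := fr_trans hf10 hf11.
  have elr11 : st11 lr 0 = r by rewrite (fr_loc hf11).
  apply: (do_reg _ ho11 (sv _ (arrl lr_ok)) elr11) => // st12 ho12 hf12 r12.
  have {}hf12 := fr_trans hf11 hf12.
  have [_ p2 _] := pv_spec (is_c c x) r.
  have b3 : pv (is_c c x) r <= r < U by rewrite p2.
  have e18'' : st12 18 0 = pv (is_c c x) r by rewrite r12 // r11.
  apply: rn_seq (op_infB ho12 b3 e18'' (r12 19 isT)) _ => st13 [ho13 hf13 e14f].
  have {}hf13 := fr_trans hf12 hf13.
  have ela13 := etrans (fr_loc hf13 la_ok) ela8.
  have [s14 v14] := fun2_ok T_lim op (sv st13 (arrl la_ok)) ela13 (sv st13 (arr20 (isT : 14 < 20))) e14f.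
  apply: (rn_set (arr20 _) s14 v14) => //.
  have [ho14 hf14] := ok_reg (r := 14) (code (op (op (pr op e (del_c e c x) l s)
    (pr op' c (gaps op e c x) s.+1 r)) (pr op e (del_c e c x) (pv (is_c c x) r) r))) ho13 isT.
  split; first exact: ok_Inv hinv ho14.
    exact: same_trans (same_trans hs8' hf13.1) hf14.1.
  rewrite updE /=; congr code.
  have dE := del_cE am c xE.
  (* The infix is cut at [s]: the left part contains no [c], and [pr_factor] resolves the part that
     starts with the letter at [s]. *)
  rewrite (@pr_cat _ op e E am x l s r xE) ?hls ?(ltnW hsr) // (pr_no_c _ _ nc).
  rewrite (pr_factor am cE xE xs hsr) (am_assoc am) //; try exact: (pr_in am).
  by have /ld_setP[] := pr_in (ld_monoid am cE) s.+1 r (gaps_ld am cE xE).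
rewrite -/mul_cost /=; lia.
Qed.

Lemma inf_prog_ok x st l r : glob H st -> Inv x st -> l <= r < U ->
  st 18 0 = l -> st 19 0 = r ->
  rn inf_total inf_prog st (fun st' =>
    [/\ Inv x st', same (scr a0 a1) st st' & st' 14 0 = code (pr op e x l r)]).
Proof.
move=> hg hinv /andP[hlr hr] e18 e19.
have [hos hB hM xA xU] := hinv.
have ho : ok st (is_c c x) (del_c e c x) (gaps op e c x) by split.
have li_ok : a0 + 5 <= li < a0 + 10 by rewrite /li; lia.
have ls_ok : a0 + 5 <= ls < a0 + 10 by rewrite /ls; lia.
have lr_ok : a0 + 5 <= lr < a0 + 10 by rewrite /lr; lia.
have lU : l < U by apply: leq_ltn_trans hr.
rewrite /inf_prog; apply: rn_le.
  apply: (do_loc li_ok ho (sv _ (arr20 _)) e18) => // st1 ho1 hf1 r1 l1.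
  have e19' : st1 19 0 = r by rewrite r1.
  apply: (do_loc lr_ok ho1 (sv _ (arr20 _)) e19') => // st2 ho2 hf2 r2 l2.
  have {}hf2 := same_trans hf1 hf2.
  have eli : st2 li 0 = l by rewrite l2 // l1 // eqxx /li /lr eqn_add2l.
  have elr : st2 lr 0 = r by rewrite l2 // eqxx.
  apply: (rn_if (bb := l < r) (C := inf_total - 100)) => [||hlt|hge].
  - by split=> //; apply/sv/arrl.
  - by rewrite /= eli elr.
  - apply: (@rn_le (pred_costs a0 + 100 + (expr_cost (Bin OLt (V ls) (V lr)) + 3 +
       (pred_costs a0 + 2 * CB + CM + 2 * mul_cost + 300)))); last first.
      by rewrite /inf_total; move: mul_cost => mc /=; lia.
    apply: (rn_seq (R := fun st' => [/\ ok st' (is_c c x) (del_c e c x) (gaps op e c x),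
        same (scr a0 a1) st st', st' li 0 = l /\ st' lr 0 = r &
        let s := st' ls 0 in [/\ l <= s, s < U -> x s = c & forall k, l <= k < s -> x k != c]])).
      have [hg2 [m1 _ _] _ _] := ho2.
      apply: (@rn_le (expr_cost (Ld a0 (V li)) + 3 + (pred_costs a0 + 50))); last first.
        by rewrite /=; lia.
      apply: (rn_if (bb := is_c c x l)) => [||hc|hnc].
      + split; [by case: a_ok; lia | exact/sv/arrl | rewrite /= eli].
        by have := U_lim lim_ok; rewrite -/U; lia.
      + by rewrite /= eli m1.
      + apply: (rn_le (rn_set (arrl ls_ok) (sv _ (arrl li_ok)) eli _)); last by rewrite /=; lia.
        have [h1 h2] := ok_loc l ho2 ls_ok.
        split=> //; first exact: same_trans hf2 h2.
          by rewrite !updE /li /ls /lr !eqn_add2l /= -/li -/lr eli elr.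
        rewrite updE !eqxx /=; split=> //.
          by move=> _; apply/eqP.
        by move=> k; case: ltngtP.
      apply: rn_le.
        apply: (do_reg _ ho2 (sv _ (arrl li_ok)) eli) => // st3 ho3 hf3 r3.
        apply: rn_seq (op_nxt ho3 lU (r3 16 isT)) _ => st4 [ho4 hf4 hs1 hs2 hs3].
        have {}hf4 := fr_trans hf3 hf4.
        apply: (rn_set (arrl ls_ok) (sv _ (arr20 (isT : 14 < 20))) (erefl _)).
        have [h1 h2] := ok_loc (st4 14 0) ho4 ls_ok.
        split=> //; first exact: same_trans (same_trans hf2 hf4.1) h2.
          rewrite !updE /li /ls /lr !eqn_add2l /= -/li -/lr.
          by rewrite (fr_loc hf4 li_ok) (fr_loc hf4 lr_ok).
        rewrite updE !eqxx /=; split.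
        * by case/andP: hs1 => /ltnW.
        * by move/hs2/eqP.
        * move=> k /andP[k1 k2]; case: (l =P k) => [<-|nk]; first exact: hnc.
          by apply: hs3; lia.
      by rewrite /=; lia.
    move=> st3 [ho3 hs3 [eli3 elr3] [s1 s2 s3]].
    apply: (rn_if (bb := st3 ls 0 < r)) => [||hsr|hsr].
    + by split=> //; apply/sv/arrl.
    + by rewrite /= elr3.
    + apply: (inf_split_ok hinv hs3 ho3 _ hr _ s3) => //; first by rewrite s1.
      by apply: s2; apply: ltn_trans hr.
    apply: rn_le.
      apply: (do_reg _ ho3 (sv _ (arrl li_ok)) eli3) => // st4 ho4 hf4 r4.
      have elr4 : st4 lr 0 = r by rewrite (fr_loc hf4).
      apply: (do_reg _ ho4 (sv _ (arrl lr_ok)) elr4) => // st5 ho5 hf5 r5.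
      have {}hf5 := fr_trans hf4 hf5.
      have b1 : l <= r < U by rewrite hlr.
      have e18' : st5 18 0 = l by rewrite r5 // r4.
      apply: rn_weaken (leqnn _) _ (op_infB ho5 b1 e18' (r5 19 isT)) => st6 [ho6 hf6 e14].
      split; first exact: ok_Inv hinv ho6.
        exact: same_trans (same_trans hs3 hf5.1) hf6.1.
      rewrite e14 -(@pr_no_c _ op e c x) // => k /andP[k1 k2]; apply: s3.
      by rewrite k1; apply: leq_trans k2 _; rewrite leqNgt.
    by move: mul_cost => mc /=; lia.
  have climt (t : T) : code t < lim by apply: leq_trans (code_lt t) T_lim.
  apply: (rn_le (rn_set (ex := Cst (code e)) (arr20 (isT : 14 < 20)) (climt e) (erefl _) _)); last first.
    by rewrite /inf_total; move: mul_cost => mc /=; lia.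
  have [h1 h2] := ok_reg (r := 14) (code e) ho2 isT.
  split; first exact: ok_Inv hinv h1.
    exact: same_trans hf2 h2.1.
  by rewrite updE /= pr_nil // leqNgt.
by rewrite /inf_total; move: mul_cost => mc /=; lia.
Qed.

Lemma Inv_spec : comp_spec op e A lim arr H a0 a1 set_prog inf_prog (set_total + inf_total) Inv.
Proof.
case: (a_ok) => i1 i2 i3 i4; split.
- move=> x st st' h [h1 h2 h3 h4 h5]; split=> //.
  + by apply: (OS_same lim_ok os_ok _ h1) => b hb; apply: h; lia.
  + by apply: (cs_frame specB) h2 => b hb; apply: h; lia.
  + by apply: (cs_frame specM) h3 => b hb; apply: h; lia.
- move=> st h0; have ec : (e == c) = false by rewrite eq_sym (negbTE nce).
  split.
  + have -> : is_c c (fun _ : nat => e) = fun=> false.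
      by apply: functional_extensionality => k; apply: ec.
    by apply: (OS0 lim_ok os_ok) => b i hb; apply: h0; lia.
  + have -> : del_c e c (fun _ : nat => e) = fun=> e.
      by apply: functional_extensionality => k; rewrite /del_c ec.
    by apply: (cs_init specB) => b i hb; apply: h0; lia.
  + have -> : gaps op e c (fun _ : nat => e) = fun=> c.
      by apply: functional_extensionality => k; rewrite /gaps ec.
    by apply: (cs_init specM) => b i hb; apply: h0; lia.
  + by move=> k; apply: setU11.
  + by [].
- move=> x st i v hg hI hi hv e1 e2.
  by apply: rn_weaken (leq_addr _ _) _ (set_prog_ok hg hI hi hv e1 e2).
- move=> x st l r hg hI hlr e1 e2.
  by apply: rn_weaken (leq_addl _ _) _ (inf_prog_ok hg hI hlr e1 e2).
Qed.

End Programs.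

(** * The induction on monoid and alphabet *)

Lemma computable_base (T : finType) (op : T -> T -> T) e (A : {set T}) a0 :
  op e e = e -> 20 <= a0 -> A \subset [set e] -> computable op e A a0.
Proof.
move=> hee h20 hA; exists a0, Skip, (SetV 14 (Cst (code e))), 7; split=> // lim arr H lim_ok T_lim harr.
have hval v : v \in e |: A -> v = e.
  by rewrite !inE => /orP[/eqP //|/(subsetP hA)]; rewrite inE => /eqP.
exists (fun x _ => forall k, x k = e); split.
- by [].
- by [].
- move=> x st i v hg hx hi /hval -> _ _.
  apply: (run_weaken (leq0n _) (fun _ h => h)); apply: (@run_wp _ _ Skip); split=> // k.
  by case: eqP.
move=> x st l r hg hx hlr e18 e19.
apply: (run_weaken _ (fun _ h => h) (@run_wp _ _ (SetV 14 (Cst (code e))) _ _ _)).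
  by rewrite leq_pmulr.
have hl : code e < lim by apply: leq_trans (code_lt e) T_lim.
have l0 : 0 < lim by apply: leq_ltn_trans hl.
split=> //; first by apply: leq_trans harr; apply: leq_trans h20.
split=> //.
  by move=> b /= hb k; rewrite updE; case: eqP => // e0; rewrite e0 in hb.
rewrite updE /=; congr code; rewrite /pr; elim: (iota _ _) => //= k s <-.
by rewrite hx hee.
Qed.

(** Lexicographic induction: removing [c] keeps the monoid and shrinks the alphabet, whereas the
    gaps may use the whole local divisor as alphabet, but that is a smaller monoid by [ld_card]. *)
Lemma computable_all n m (T : finType) (E : {set T}) (op : T -> T -> T) e (A : {set T}) a0 :
  #|E| <= n -> #|A :\ e| <= m -> aperiodic_monoid E op e -> A \subset E -> 20 <= a0 ->
  computable op e A a0.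
Proof.
elim: n m E op e A a0 => [|n IHn] m E op e A a0 hE.
  by move=> _ am; have := am_one am; rewrite leqn0 cards_eq0 in hE; rewrite (eqP hE) inE.
elim: m A a0 => [|m IHm] A a0 hA am AE h20.
  apply: computable_base => //; first by rewrite (am_mul1l am) // (am_one am).
  by rewrite -setD_eq0 -cards_eq0 -leqn0.
have [hA0|[c]] := set_0Vmem (A :\ e).
  apply: computable_base => //; first by rewrite (am_mul1l am) // (am_one am).
  by rewrite -setD_eq0 hA0.
rewrite !inE => /andP[nce cA]; have cE := subsetP AE c cA.
have [|||| aB [setB [infB [CB [hB specB]]]]] := IHm (A :\ c) (a0 + 10).
- rewrite -ltnS; apply: leq_trans hA; apply: proper_card; apply/properP; split.
    by apply: setSD; apply: subsetDl.
  by exists c; rewrite !inE ?eqxx ?andbF // nce cA.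
- exact: am.
- by apply: subset_trans AE; apply: subsetDl.
- lia.
have [||||| a1 [setM [infM [CM [hM specM]]]]] :=
  IHn #|ld_set op E c :\ c| (ld_set op E c) (ld_op op E c) c (ld_set op E c) aB.
- by rewrite -ltnS; apply: leq_trans hE; apply: (ld_card am cE nce).
- exact: leqnn.
- exact: (ld_monoid am cE).
- exact: subxx.
- lia.
exists a1, (set_prog op e c a0 setB infB setM), (inf_prog op e a0 infB infM).
exists (set_total op c a0 CB CM + inf_total op a0 CB CM).
split=> [|lim arr H lim_ok T_lim harr]; first lia.
have [|InvB hInvB] := specB lim arr H lim_ok T_lim; first lia.
have [|InvM hInvM] := specM lim arr H lim_ok T_lim; first lia.
eexists; apply: (Inv_spec lim_ok T_lim _ hInvB am cE hInvM nce cA AE (erefl _)).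
by split; lia.
Qed.

(** * Blocks, updates and initialisation *)

Section Blocks.
Variables (T : finType) (op : T -> T -> T) (e : T) (E : {set T}).
Hypothesis am : aperiodic_monoid E op e.

Lemma pr_blocks (s : nat -> T) B m : (forall k, s k \in E) ->
  pr op e (fun j => pr op e s (j * B) (j * B + B)) 0 m = pr op e s 0 (m * B).
Proof.
move=> hs; elim: m => [|m IH]; first by rewrite !pr_nil.
rewrite (pr_recr am) // => [|k]; last exact: (pr_in am).
by rewrite IH mulSn (addnC B) -(pr_cat am) // leq_addr.
Qed.

End Blocks.

Section Top.
Variables (S : finType) (T : finType) (E : {set T}) (op : T -> T -> T) (e : T) (h : S -> T).
Variable F : {set T}.
Hypothesis am : aperiodic_monoid E op e.
Hypothesis hE : forall a, h a \in E.

(* Array 20 holds the word, 0 marking its end; arrays 0 and 1 hold the update and array 2 the answer, 5 the block length, 24 the current block and 25 the length of the word. *)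
Definition symv (w : seq S) k := if onth w k is Some a then (sym_code a).+1 else 0.
Definition sval_of (w : seq S) k := if onth w k is Some a then h a else e.

Definition tabS ev := tabE [seq Cst (code t) | t <- e :: [seq h a | a <- enum S]] 0 ev.
Definition tabF ev := tabE [seq Cst (t \in F) | t <- enum T] 0 ev.

Definition blk_body :=
  Seq (SetV 21 (fun2 op (V 21) (tabS (Ld 20 (V 22))))) (SetV 22 (Bin OAdd (V 22) (Cst 1))).

Definition blk_prog :=
  Seq (Seq (SetV 22 (Bin OMul (V 24) (V 5))) (Seq (SetV 23 (Bin OAdd (V 22) (V 5)))
      (SetV 21 (Cst (code e)))))
  (While (Bin OLt (V 22) (V 23)) blk_body).

Variables (cset cinf : cmd).

Definition blkset_prog := Seq blk_prog (Seq (Seq (SetV 16 (V 24)) (SetV 17 (V 21))) cset).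

Definition query_prog :=
  Seq (Seq (SetV 18 (Cst 0)) (SetV 19 (Bin OSub (V 3) (Cst 1)))) (Seq cinf (SetV 2 (tabF (V 14)))).

Definition upd_prog :=
  Seq (Seq (Asg 20 (V 0) (Bin OAdd (V 1) (Cst 1))) (SetV 24 (Bin ODiv (V 0) (V 5))))
  (Seq blkset_prog query_prog).

(** Relocating the input counts the length cell down to 0, so the length is found again by scanning
    for the first 0, which no stored symbol equals. *)
Definition scan_body := SetV 25 (Bin OAdd (V 25) (Cst 1)).
Definition scan_prog := While (Ld 20 (V 25)) scan_body.

(** Repeated squaring from 2 finds the least [U] above the length together with its logarithm; the
    block length [H + 2] counts the rounds along the way. *)
Definition dims_body :=
  Seq (SetV 3 (Bin OMul (V 3) (V 3)))
 (Seq (SetV 4 (Bin OMul (V 4) (Cst 2))) (SetV 5 (Bin OAdd (V 5) (Cst 1)))).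
Definition dims_prog :=
  Seq (Seq (SetV 3 (Cst 2)) (Seq (SetV 4 (Cst 1)) (SetV 5 (Cst 2))))
      (While (Bin OLt (V 3) (Bin OAdd (V 25) (Cst 1))) dims_body).

Definition fill_prog :=
  While (Bin OLt (Bin OMul (V 24) (V 5)) (V 25))
    (Seq blkset_prog (SetV 24 (Bin OAdd (V 24) (Cst 1)))).

Definition init_prog := Seq scan_prog (Seq dims_prog (Seq fill_prog query_prog)).

Variables (lim arr a1 C : nat).
Hypothesis arr_ok : 30 <= arr.
Hypothesis a1_arr : a1 <= arr.
Hypothesis T_lim : #|T| <= lim.
Hypothesis S_lim : #|S|.+1 <= lim.
Hypothesis lim8 : 8 <= lim.

Lemma safe_reg st r : r < 30 -> safe lim arr st (V r).
Proof. by move=> hr; split=> /=; [apply: leq_trans arr_ok | apply: leq_trans lim8 | apply: leq_trans lim8]. Qed.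

Lemma sval_in w k : sval_of w k \in E.
Proof. by rewrite /sval_of; case: onth => [a|]; [apply: hE | apply: am_one am]. Qed.

Lemma tabS_ok st ev w k : safe lim arr st ev -> eval st ev = symv w k ->
  safe lim arr st (tabS ev) /\ eval st (tabS ev) = code (sval_of w k).
Proof.
move=> hs he; have l0 : 0 < lim by apply: leq_trans lim8.
have szt : size [seq Cst (code t) | t <- e :: [seq h a | a <- enum S]] = #|S|.+1.
  by rewrite size_map /= size_map -cardE.
have [||] := @tabE_ok lim arr st [seq Cst (code t) | t <- e :: [seq h a | a <- enum S]] 0 ev l0 hs.
- move=> i; rewrite size_map => hi; rewrite (nth_map e) //=.
  by have := leq_trans (code_lt (nth e (e :: [seq h a | a <- enum S]) i)) T_lim.
- by rewrite szt.
move=> s1 v1; split=> //; rewrite /tabS v1 szt he add0n subn0 /symv /sval_of.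
case: (onth w k) => [a|] //=.
have ha : sym_code a < #|S| by exact: ltn_ord.
rewrite ltnS ha -map_comp (nth_map a) -?cardE //=.
by rewrite /sym_code nth_enum_rank.
Qed.

Lemma tabF_ok st ev t : safe lim arr st ev -> eval st ev = code t ->
  safe lim arr st (tabF ev) /\ eval st (tabF ev) = (t \in F).
Proof.
move=> hs he; apply: (tab_code T_lim hs he (g := fun t => Cst (t \in F))) => s.
by rewrite /=; split; apply: leq_trans lim8; case: (s \in F).
Qed.

Definition blk w B j := pr op e (sval_of w) (j * B) (j * B + B).

Lemma blk_in w B j : blk w B j \in E. Proof. by apply: (pr_in am) => k; apply: sval_in. Qed.

Definition blk_scr := [pred b | 21 <= b <= 23].

Lemma blk_ok st w B j : st 5 0 = B -> st 24 0 = j -> (forall k, st 20 k = symv w k) ->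
  j * B + B < lim ->
  run lim arr blk_prog st (60 + (B * (cmd_cost blk_body + 20) + 20)) (fun st' =>
    st' 21 0 = code (blk w B j) /\ same blk_scr st st').
Proof.
move=> e5 e24 e20 hlim.
pose st0 := upd2 (upd2 (upd2 st 22 0 (j * B)) 23 0 (j * B + B)) 21 0 (code e).
have l0 : 0 < lim by apply: leq_trans lim8.
have hce : code e < lim by apply: leq_trans T_lim; apply: code_lt.
have arrk k : k < 30 -> k < arr by move=> hk; apply: leq_trans arr_ok.
have hjB : j * B < lim by apply: leq_ltn_trans hlim; apply: leq_addr.
apply: (@run_weaken _ _ _ _ (cmd_cost (Seq (SetV 22 (Bin OMul (V 24) (V 5))) (Seq (SetV 23 (Bin OAdd (V 22) (V 5)))
      (SetV 21 (Cst (code e))))) + (B * (cmd_cost blk_body + 20) + 20)) _ _ _ _ (fun _ h => h)).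
  by rewrite leq_add2r.
apply: (run_seq (Q := _)); apply: run_wp.
have s1 := safe_reg; rewrite [wp _ _ _ _ _]/=.
do ?split; rewrite /= ?updE /= ?e5 ?e24 //; try (by apply: arrk).
pose I n st' := [/\ same blk_scr st st', st' 23 0 = j * B + B &
  exists k, [/\ st' 22 0 = k, k + n = j * B + B, j * B <= k &
    st' 21 0 = code (pr op e (sval_of w) (j * B) k)]].
have ec : expr_cost (Bin OLt (V 22) (V 23)) = 13 by [].
apply: run_weaken (run_while (I := I) (n := B) (tb := cmd_cost blk_body) _ _ _).
- rewrite ec [cmd_cost blk_body]/=; move: (expr_cost (fun2 _ _ _)) => t.
  by apply: leq_add => //; rewrite leq_mul2l; apply/orP; right; clear; lia.
- move=> st' [n [hs e23 [k [e22 ek hk e21]]]]; rewrite /= e22 e23 => hk0.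
  have {hk0} hkB : j * B + B <= k by move: hk0; case: ltnP.
  split=> //; rewrite e21 /blk; congr (code (pr _ _ _ _ _)); lia.
- by move=> n st' _; split=> //; apply: safe_reg.
- move=> n st' [hs e23 [k [e22 ek hk e21]]] hlt.
  have hkl : k < j * B + B by move: hlt; rewrite /= e22 e23; case: ltnP.
  have sL : safe lim arr st' (Ld 20 (V 22)).
    split; [exact: arrk | exact: safe_reg | rewrite /= e22].
    by apply: ltn_trans hlim.
  have eL : eval st' (Ld 20 (V 22)) = symv w k by rewrite /= e22 hs ?e20.
  have [s2 v2] := tabS_ok sL eL.
  have [s3 v3] := fun2_ok T_lim op (safe_reg st' (isT : 21 < 30)) e21 s2 v2.
  apply: run_wp; split; [exact: arrk | exact: l0 | exact: s3 | exact: l0 |].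
  rewrite v3 [eval st' (Cst 0)]/=.
  split; [exact: arrk | exact: l0 | | exact: l0 |].
    do ?split; rewrite /= ?updE /= ?e22; try (by apply: arrk); try exact: l0.
      by apply: leq_trans lim8.
    by rewrite addn1; apply: leq_ltn_trans hlim.
  exists n.-1; first by lia.
  split; first 1 last.
  - by rewrite !updE /=.
  - exists k.+1; rewrite !updE /= !updE /= e22 addn1; split=> //; try lia.
    rewrite (pr_recr am) //; exact: sval_in.
  - move=> b hb i; rewrite !updE -hs //.
    by move: hb => /=; case: eqP => [->|_] //=; case: eqP => [->|_].
split; last 1 first.
- exists (j * B); rewrite !updE /= pr_nil //; split.
- by move=> b hb k; rewrite !updE; move: hb => /=; do 3 (case: eqP => [->|_] //=).
- by rewrite !updE.
Qed.

Variables (H : nat) (Inv : (nat -> T) -> state -> Prop).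
Let U := 2 ^ width H.+1.
Let B := H.+2.
Hypothesis lim_ok : 8 * (U * U) <= lim.
Hypothesis spec : comp_spec op e E lim arr H 30 a1 cset cinf C Inv.

Definition blkset_scr := [pred b | (7 <= b < 20) || (21 <= b <= 23) || (30 <= b < a1)].

Definition blkset_cost := cmd_cost blk_body + C + 200.

Lemma blkset_ok st w x j : glob H st -> st 5 0 = B -> st 24 0 = j ->
  (forall k, st 20 k = symv w k) -> Inv x st -> j < U -> j * B + B < lim ->
  run lim arr blkset_prog st (blkset_cost * B) (fun st' =>
    Inv (fun k => if k == j then blk w B j else x k) st' /\ same blkset_scr st st').
Proof.
move=> hg e5 e24 e20 hI hj hl; rewrite /blkset_prog.
have arrk k : k < 30 -> k < arr by move=> hk; apply: leq_trans arr_ok.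
have l0 : 0 < lim by apply: leq_trans lim8.
apply: (@run_weaken _ _ _ _ ((60 + (B * (cmd_cost blk_body + 20) + 20)) +
  (cmd_cost (Seq (SetV 16 (V 24)) (SetV 17 (V 21))) + C * B)) _ _ _ _ (fun _ h => h)).
  rewrite /blkset_cost [cmd_cost (Seq _ _)]/=; move: (cmd_cost blk_body) => t.
  by rewrite !mulnDl mulnDr mulnC /B; clear; lia.
apply: run_seq; apply: run_weaken (blk_ok e5 e24 e20 hl) => // st1 [e21 hs1].
apply: run_seq; apply: run_wp.
have sr st0 r : r < 30 -> safe lim arr st0 (V r) by apply: safe_reg.
split; [exact: arrk | exact: l0 | exact: sr | exact: l0 |].
split; [exact: arrk | exact: l0 | exact: sr | exact: l0 |].
rewrite [eval _ (Cst 0)]/= [eval _ (V 24)]/= [eval _ (V 21)]/= updE [(21 == 16) && _]/= hs1 // e24 e21.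
set st2 := upd2 _ 17 0 _.
have hs2 b : ~~ ((7 <= b < 20) || (21 <= b <= 23)) -> st2 b =1 st b.
  move=> hb k; rewrite /st2 !updE; case: eqP => [eb|_] /=; first by move: hb; rewrite eb.
  case: eqP => [eb|_] /=; first by move: hb; rewrite eb.
  by apply: hs1; move: hb; rewrite negb_or => /andP[].
have hg2 : glob H st2 by case: hg => g1 g2; split; rewrite hs2.
have hI2 : Inv x st2 by apply: (cs_frame spec) hI => b hb; apply: hs2; lia.
have bin : blk w B j \in e |: E by rewrite inE blk_in orbT.
have e16 : st2 16 0 = j by rewrite /st2 !updE.
have e17 : st2 17 0 = code (blk w B j) by rewrite /st2 !updE.
apply: run_weaken (cs_set spec hg2 hI2 hj bin e16 e17) => // st3 [hI3 hs3].
split=> // b /= hb; have h1 : ~~ ((7 <= b < 20) || (21 <= b <= 23)) by lia.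
by move=> k; rewrite hs3 ?hs2 //=; lia.
Qed.

Definition query_scr := [pred b | (7 <= b < 20) || (b == 2) || (30 <= b < a1)].
Definition query_cost := C + expr_cost (tabF (V 14)) + 100.

Lemma query_ok st x : glob H st -> Inv x st ->
  run lim arr query_prog st (query_cost * B) (fun st' =>
    [/\ Inv x st', same query_scr st st' & st' 2 0 = (pr op e x 0 (U - 1) \in F)]).
Proof.
move=> hg hI; rewrite /query_prog.
have arrk k : k < 30 -> k < arr by move=> hk; apply: leq_trans arr_ok.
have l0 : 0 < lim by apply: leq_trans lim8.
have U0 : 0 < U by rewrite expn_gt0.
apply: (@run_weaken _ _ _ _ (cmd_cost (Seq (SetV 18 (Cst 0)) (SetV 19 (Bin OSub (V 3) (Cst 1)))) +
  (C * B + cmd_cost (SetV 2 (tabF (V 14))))) _ _ _ _ (fun _ h => h)).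
  rewrite /query_cost [cmd_cost (Seq _ _)]/= [cmd_cost (SetV _ _)]/=; move: (expr_cost (tabF _)) => t.
  by rewrite !mulnDl /B; clear; nia.
apply: run_seq; apply: run_wp.
have sr st0 r : r < 30 -> safe lim arr st0 (V r) by apply: safe_reg.
have [g3 g4] := hg.
split; [exact: arrk | exact: l0 | exact: l0 | exact: l0 |].
split; [exact: arrk | exact: l0 | | exact: l0 |].
  split; [exact: sr | exact: leq_trans lim8 | by rewrite /= !updE /= g3].
rewrite [eval _ (Cst 0)]/= [eval _ (Bin _ _ _)]/= updE [(3 == 18) && _]/= g3 -/U.
set st2 := upd2 _ 19 0 _.
have hs2 b : ~~ (7 <= b < 20) -> st2 b =1 st b.
  move=> hb k; rewrite /st2 !updE; case: eqP => [eb|_] /=; first by move: hb; rewrite eb.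
  by case: eqP => [eb|_] //=; move: hb; rewrite eb.
have hg2 : glob H st2 by split; rewrite hs2.
have hI2 : Inv x st2 by apply: (cs_frame spec) hI => b hb; apply: hs2; lia.
have e18 : st2 18 0 = 0 by rewrite /st2 !updE.
have e19 : st2 19 0 = U - 1 by rewrite /st2 !updE.
have hr : 0 <= U - 1 < 2 ^ width H.+1 by rewrite -/U; lia.
apply: run_seq; apply: run_weaken (cs_inf spec hg2 hI2 hr e18 e19) => // st3 [hI3 hs3 e14].
have [s1 v1] := tabF_ok (sr st3 14 isT) e14.
apply: run_wp; split; [exact: arrk | exact: l0 | exact: s1 | exact: l0 |].
rewrite [eval _ (Cst 0)]/= v1; split; last by rewrite updE.
  apply: (cs_frame spec) hI3 => b hb k; rewrite updE; case: eqP => // eb.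
  by rewrite eb in hb.
move=> b /= hb k; rewrite updE; case: eqP => [eb|_] /=; first by rewrite eb in hb.
by rewrite hs3 ?hs2 //=; lia.
Qed.

Definition Top st w := [/\ glob H st, st 5 0 = B, forall k, st 20 k = symv w k &
  Inv (blk w B) st].

Lemma blk_out w j : size w <= j * B -> blk w B j = e.
Proof.
move=> hw; rewrite /blk; have hsv k : sval_of w k \in E by apply: sval_in.
rewrite (pr_unit am (m := j * B)) ?pr_nil ?leqnn ?leq_addr // => k /andP[h1 _].
by rewrite /sval_of onth_default // (leq_trans hw).
Qed.

(** [U - 1] is the largest right end an infix query admits. It suffices because [size w <= U - 1]
    and blocks are nonempty, so the blocks queried cover the word; behind the word all factors are
    the unit. *)
Lemma total_blk w : size w < U ->
  pr op e (blk w B) 0 (U - 1) = foldr (fun a t => op (h a) t) e w.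
Proof.
move=> hw; have hsv k : sval_of w k \in E by apply: sval_in.
rewrite (pr_blocks am) // (pr_unit am (m := size w)) //.
- rewrite /pr subn0.
  have -> : [seq sval_of w k | k <- iota 0 (size w)] = [seq h a | a <- w].
    elim: w {hw hsv} => //= a w IH; congr (_ :: _); rewrite -IH.
    by rewrite -[1]addn0 iotaDl -map_comp; apply: eq_map.
  by elim: w {hw hsv} => //= a w ->.
- apply: (@leq_trans (U - 1)); first by lia.
  by rewrite leq_pmulr.
- by move=> k /andP[h1 _]; rewrite /sval_of onth_default.
Qed.

Lemma onth_set_nth (w : seq S) i a k : i < size w ->
  onth (set_nth a w i a) k = if k == i then Some a else onth w k.
Proof. by elim: w i k => // b w IH [|i] [|k] //= hi; rewrite IH. Qed.

Definition upd_cost := blkset_cost + query_cost + 200.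

Lemma upd_ok st w i a : size w < U -> i < size w -> Top st w ->
  run lim arr upd_prog (upd2 (upd2 st 0 0 i) 1 0 (sym_code a)) (upd_cost * B) (fun st' =>
    let w' := set_nth a w i a in
    Top st' w' /\ st' 2 0 = (foldr (fun b t => op (h b) t) e w' \in F)).
Proof.
move=> hw hi [hg e5 e20 hI]; set w' := set_nth a w i a.
set st0 := upd2 _ 1 0 _.
have arrk k : k < 30 -> k < arr by move=> hk; apply: leq_trans arr_ok.
have l0 : 0 < lim by apply: leq_trans lim8.
have U0 : 0 < U by rewrite expn_gt0.
have Ul : 8 * U <= lim by apply: leq_trans lim_ok; rewrite leq_mul2l leq_pmulr.
have sr st1 r : r < 30 -> safe lim arr st1 (V r) by apply: safe_reg.
have sw : size w' = size w by rewrite size_set_nth; apply/maxn_idPr.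
have BU : B <= U.
  have h1 : H < width H.+1 by rewrite /=; apply: ltn_expl.
  by rewrite /B /U; apply: leq_ltn_trans h1 (ltn_expl _ _).
rewrite /upd_prog.
apply: (@run_weaken _ _ _ _ (cmd_cost (Seq (Asg 20 (V 0) (Bin OAdd (V 1) (Cst 1))) (SetV 24 (Bin ODiv (V 0) (V 5)))) +
  (blkset_cost * B + query_cost * B)) _ _ _ _ (fun _ h => h)).
  rewrite /upd_cost [cmd_cost (Seq _ _)]/= !mulnDl /B; clear; lia.
apply: run_seq; apply: run_wp.
have e0 : st0 0 0 = i by [].
have e1 : st0 1 0 = sym_code a by [].
have ha : sym_code a < #|S| by exact: ltn_ord.
have il : i < lim by lia.
split; [exact: arrk | exact: sr | | by rewrite /= e0 |].
  by split; [exact: sr | exact: leq_trans lim8 | rewrite /= e1 addn1; apply: leq_trans S_lim].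
rewrite [eval st0 (V 0)]/= e0 [eval st0 _]/= e1 addn1; set st1 := upd2 st0 20 i _.
split; [exact: arrk | exact: l0 | by split=> //; apply: sr | exact: l0 |].
rewrite [eval _ (Cst 0)]/= [eval _ (Bin _ _ _)]/=.
have -> : st1 0 0 = i by [].
have -> : st1 5 0 = B by rewrite -e5.
set st2 := upd2 st1 24 0 _.
have hs2 b : ~~ [|| b < 2, b == 20 | b == 24] -> st2 b =1 st b.
  move=> hb k; rewrite /st2 /st1 /st0 !updE.
  do 4 (case: eqP => [eb|_] /=; first by move: hb; rewrite eb).
  by [].
have hg2 : glob H st2 by case: hg => g3 g4; split; rewrite hs2.
have e5' : st2 5 0 = B by rewrite hs2.
have e20' k : st2 20 k = symv w' k.
  rewrite /st2 /st1 /st0 !updE /= e20 /symv onth_set_nth //; by case: (k == i).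
have hI2 : Inv (blk w B) st2 by apply: (cs_frame spec) hI => b hb; apply: hs2; lia.
have e24 : st2 24 0 = i %/ B by rewrite /st2 updE.
have hj : i %/ B < U by apply: leq_ltn_trans (leq_div _ _) (ltn_trans hi hw).
have hl : i %/ B * B + B < lim.
  have := leq_divM i B; lia.
apply: run_seq; apply: run_weaken (blkset_ok hg2 e5' e24 e20' hI2 hj hl) => // st3 [hI3 hs3].
(* A block that sees position [i] is the one with index [i %/ B], so all other products are
   unaffected. *)
have hx : (fun k => if k == i %/ B then blk w' B (i %/ B) else blk w B k) = blk w' B.
  apply: functional_extensionality => k; case: eqP => [-> //|nk].
  rewrite /blk; apply: pr_ext => t ht; rewrite /sval_of /w' onth_set_nth //.
  case: eqP => // et; case: nk; move: ht; rewrite et => /andP[h1 h2].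
  apply/eqP; rewrite eqn_leq leq_divRL // h1 -ltnS ltn_divLR // mulSn addnC h2 //.
rewrite hx in hI3.
have hg3 : glob H st3 by case: hg2 => g3 g4; split; rewrite hs3.
apply: run_weaken (query_ok hg3 hI3) => // st4 [hI4 hs4 e2].
split; last by rewrite e2 total_blk ?sw.
split=> //.
- by case: hg3 => g3 g4; split; rewrite hs4.
- by rewrite hs4 ?hs3.
- by move=> k; rewrite hs4 ?hs3.
Qed.

Lemma scan_ok st w : st 25 0 = 0 -> (forall k, st 20 k = symv w k) -> size w < lim ->
  run lim arr scan_prog st (size w * (expr_cost (Ld 20 (V 25)) + cmd_cost scan_body + 3) +
    (expr_cost (Ld 20 (V 25)) + 1))
    (fun st' => same (pred1 25) st st' /\ st' 25 0 = size w).
Proof.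
move=> e25 e20 hl; have arrk k : k < 30 -> k < arr by move=> hk; apply: leq_trans arr_ok.
have l0 : 0 < lim by apply: leq_trans lim8.
pose I m st' := same (pred1 25) st st' /\ st' 25 0 + m = size w.
have eL m st' : I m st' -> eval st' (Ld 20 (V 25)) = symv w (st' 25 0).
  by case=> hs _; rewrite /= hs ?e20.
apply: run_weaken (run_while (I := I) _ _ _) => //.
- move=> st' [m hI]; rewrite (eL _ _ hI); case: hI => hs hm h0; split=> //.
  move: h0; rewrite /symv; case ek: onth => [//|] _.
  by have := leq_addr m (st' 25 0); rewrite hm leq_eqVlt => /orP[/eqP //|]; rewrite -onthTE ek.
- move=> m st' [hs hm]; split; [exact: arrk | exact: safe_reg | rewrite /=].
  by apply: leq_ltn_trans hl; rewrite -hm leq_addr.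
- move=> m st' hI; rewrite (eL _ _ hI); case: hI => hs hm h0.
  have hlt : st' 25 0 < size w.
    by move: h0; rewrite /symv; case ek: onth => [a|//] _; rewrite -onthTE ek.
  apply: run_wp; split; [exact: arrk | exact: l0 | | exact: l0 |].
    split; [exact: safe_reg | exact: leq_trans lim8 | rewrite /= addn1].
    exact: leq_ltn_trans hl.
  exists m.-1; first by lia.
  split; last by rewrite updE /= addn1; lia.
  by move=> b hb k; rewrite updE -hs //; case: eqP => // eb; rewrite eb in hb.
- by split=> [b _ k //|]; rewrite e25.
Qed.

Lemma dims_ok st n : st 25 0 = n -> n < U -> (forall k, k < H -> 2 ^ (2 ^ k) <= n) ->
  run lim arr dims_prog st ((cmd_cost dims_body + 100) * n.+1) (fun st' =>
    [/\ glob H st', st' 5 0 = B & same [pred b | 3 <= b <= 5] st st']).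
Proof.
move=> e25 hn hmin; have arrk k : k < 30 -> k < arr by move=> hk; apply: leq_trans arr_ok.
have l0 : 0 < lim by apply: leq_trans lim8.
have l1 : 1 < lim by apply: leq_trans lim8.
have U0 : 0 < U by rewrite expn_gt0.
have Ul : 8 * U <= lim by apply: leq_trans lim_ok; rewrite leq_mul2l leq_pmulr.
have HU : 2 ^ H < U by rewrite /U /width ltn_expl.
have HU2 := ltn_expl H (isT : 1 < 2).
(* The number of squarings is at most the length, since [H <= 2 ^ (2 ^ (H - 1)) <= n];
   initialisation stays linear. *)
have Hn : H <= n.
  case: (posnP H) => [->//|H0]; have hp : H.-1 < H by rewrite prednK.
  apply: leq_trans (hmin _ hp); rewrite -{1}(prednK H0).
  exact: leq_ltn_trans (ltnW (ltn_expl _ _)) (ltn_expl _ _).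
pose st0 := upd2 (upd2 (upd2 st 3 0 2) 4 0 1) 5 0 2.
apply: (@run_weaken _ _ _ _ (cmd_cost (Seq (SetV 3 (Cst 2)) (Seq (SetV 4 (Cst 1)) (SetV 5 (Cst 2)))) +
  (H * (expr_cost (Bin OLt (V 3) (Bin OAdd (V 25) (Cst 1))) + cmd_cost dims_body + 3) +
  (expr_cost (Bin OLt (V 3) (Bin OAdd (V 25) (Cst 1))) + 1))) _ _ _ _ (fun _ h => h)).
  rewrite [cmd_cost (Seq (SetV 3 (Cst 2)) _)]/= [expr_cost _]/=.
  move: (cmd_cost dims_body) Hn; clear; nia.
apply: run_seq; apply: run_wp.
split; [exact: arrk | exact: l0 | exact: leq_trans lim8 | exact: l0 |].
split; [exact: arrk | exact: l0 | exact: leq_trans lim8 | exact: l0 |].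
split; [exact: arrk | exact: l0 | exact: leq_trans lim8 | exact: l0 |].
rewrite [eval _ (Cst 0)]/= [eval _ (Cst 1)]/= [eval _ (Cst 2)]/= -/st0.
pose I m st' := same [pred b | 3 <= b <= 5] st st' /\ exists k,
  [/\ k + m = H, st' 3 0 = 2 ^ (2 ^ k), st' 4 0 = 2 ^ k & st' 5 0 = k.+2].
have eL m st' : I m st' ->
    eval st' (Bin OLt (V 3) (Bin OAdd (V 25) (Cst 1))) = (st' 3 0 < n.+1).
  by case=> hs _; rewrite /= (hs 25) // e25 addn1.
apply: run_weaken (run_while (I := I) (n := H) _ _ _) => //.
- move=> st' [m hI]; rewrite (eL _ _ hI); case: hI => hs [k [hk e3 e4 e5]].
  rewrite e3 ltnS; case: leqP => // hlt _.
  have ek : k = H.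
    by have := leq_addr m k; rewrite hk leq_eqVlt => /orP[/eqP //|/hmin]; rewrite leqNgt hlt.
  by subst k; split.
- move=> m st' [hs _]; split; [exact: safe_reg | | by []].
  split; [exact: safe_reg | exact: l1 | rewrite /= hs // e25 addn1]; lia.
- move=> m st' hI; rewrite (eL _ _ hI); case: hI => hs [k [hk e3 e4 e5]].
  rewrite e3 ltnS; case: leqP => // hle _.
  have kH : k < H.
    have := leq_addr m k; rewrite hk leq_eqVlt => /orP[/eqP ek|//].
    by move: hle; rewrite ek leqNgt hn.
  have h1 : 2 ^ 2 ^ k * 2 ^ 2 ^ k = 2 ^ (2 ^ k.+1) by rewrite -expnD addnn -mul2n expnS.
  have h2 : 2 ^ 2 ^ k.+1 <= U by rewrite /U /width leq_exp2l // leq_exp2l.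
  have h3 : 2 ^ k.+1 <= 2 ^ H by rewrite leq_exp2l.
  have h4 : 2 ^ k * 2 = 2 ^ k.+1 by rewrite mulnC expnS.
  apply: run_wp.
  split; [exact: arrk | exact: l0 | | exact: l0 |].
    split; [exact: safe_reg | exact: safe_reg | rewrite /= e3 h1; lia].
  split; [exact: arrk | exact: l0 | | exact: l0 |].
    split; [exact: safe_reg | exact: leq_trans lim8 | rewrite /= !updE /= e4 h4; lia].
  split; [exact: arrk | exact: l0 | | exact: l0 |].
    split; [exact: safe_reg | exact: l1 | rewrite /= !updE /= e5; lia].
  exists m.-1; first by lia.
  split.
    move=> b hb i; rewrite !updE -hs //; move: hb => /=.
    by do 3 (case: eqP => [->|_] //=).
  exists k.+1; rewrite /= ?updE /= ?updE /= e3 e4 e5 h1 h4 addn1; split=> //; lia.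
- split; last by exists 0.
  by move=> b hb i; rewrite /st0 !updE; move: hb => /=; do 3 (case: eqP => [->|_] //=).
Qed.

Definition fill_scr := [pred b | blkset_scr b || (b == 24)].

(** About [size w / B] blocks are set, each at a cost proportional to [B = H + 2]: recomputing a
    block and storing its product are balanced, and the total is linear. *)
Lemma fill_ok st w : glob H st -> st 5 0 = B -> st 24 0 = 0 -> st 25 0 = size w ->
  (forall k, st 20 k = symv w k) -> Inv (fun=> e) st -> size w < U ->
  run lim arr fill_prog st ((blkset_cost + 100) * (size w + 3 * B)) (fun st' =>
    Inv (blk w B) st' /\ same fill_scr st st').
Proof.
move=> hg e5 e24 e25 e20 hI hw.
have arrk k : k < 30 -> k < arr by move=> hk; apply: leq_trans arr_ok.
have l0 : 0 < lim by apply: leq_trans lim8.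
have l1 : 1 < lim by apply: leq_trans lim8.
have U0 : 0 < U by rewrite expn_gt0.
have Ul : 8 * U <= lim by apply: leq_trans lim_ok; rewrite leq_mul2l leq_pmulr.
have BU : B <= U.
  have h1 : H < width H.+1 by rewrite /=; apply: ltn_expl.
  by rewrite /B /U; apply: leq_ltn_trans h1 (ltn_expl _ _).
have nB := leq_divM (size w) B.
pose ex := Bin OLt (Bin OMul (V 24) (V 5)) (V 25).
pose tb := blkset_cost * B + cmd_cost (SetV 24 (Bin OAdd (V 24) (Cst 1))).
pose N := (size w %/ B).+1.
apply: (@run_weaken _ _ _ _ (N * (expr_cost ex + tb + 3) + (expr_cost ex + 1))
  _ _ _ _ (fun _ h => h)).
  have hN : N * B <= size w + B by rewrite /N mulSn; lia.
  have hB : 2 <= B by [].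
  rewrite /tb [expr_cost _]/= [cmd_cost _]/=.
  move: (blkset_cost) hN hB; move: (N) (B) (size w); clear; nia.
pose I m st' := same fill_scr st st' /\ exists j,
  [/\ j + m = N, st' 24 0 = j & Inv (fun k => if k < j then blk w B k else e) st'].
have eL m st' : I m st' -> eval st' ex = (st' 24 0 * B < size w).
  by case=> hs _; rewrite /= (hs 5) // (hs 25) // e5 e25.
have jU j : j <= N -> j * B <= size w + B.
  by move=> hj; apply: leq_trans (_ : N * B <= _); rewrite ?leq_mul2r ?hj ?orbT // /N mulSn; lia.
apply: run_weaken (run_while (I := I) (n := N) _ _ _) => //.
- move=> st' [m hm]; rewrite (eL _ _ hm); case: hm => hs [j [hj ej hIj]].
  rewrite ej; case: ltnP => // hle _; split=> //.
  suff <- : (fun k => if k < j then blk w B k else e) = blk w B by [].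
  apply: functional_extensionality => k; case: ltnP => // hk; rewrite blk_out //.
  by apply: leq_trans hle _; rewrite leq_mul2r hk orbT.
- move=> m st' [hs [j [hj ej hIj]]].
  split; [split; [exact: safe_reg | exact: safe_reg |] | exact: safe_reg | by []].
  rewrite /= ej (hs 5) // e5; have := jU j; lia.
- move=> m st' hm; rewrite (eL _ _ hm); case: hm => hs [j [hj ej hIj]].
  rewrite ej; case: ltnP => // hlt _.
  have hg' : glob H st' by case: hg => g3 g4; split; rewrite hs.
  have e5' : st' 5 0 = B by rewrite hs.
  have e20' k : st' 20 k = symv w k by rewrite hs.
  have hjU : j < U by apply: leq_ltn_trans (leq_trans (leq_pmulr j _) (ltnW hlt)) hw.
  have hjl : j * B + B < lim by lia.
  apply: run_seq; apply: run_weaken (blkset_ok hg' e5' ej e20' hIj hjU hjl) => // st1 [hI1 hs1].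
  have e24' : st1 24 0 = j by rewrite hs1.
  apply: run_wp; split; [exact: arrk | exact: l0 | | exact: l0 |].
    split; [exact: safe_reg | exact: l1 | rewrite /= e24']; lia.
  exists m.-1.
    suff : j < N by lia.
    by rewrite /N ltnS leq_divRL // ltnW.
  split.
    move=> b hb k; rewrite updE; move: hb => /= /norP[h1 h2].
    by rewrite (negbTE h2) /= hs1 // hs //= negb_or h1 h2.
  have jN : j < N by rewrite /N ltnS leq_divRL // ltnW.
  exists j.+1; rewrite updE /= e24' addn1; split=> //; first by lia.
  suff -> : (fun k => if k < j.+1 then blk w B k else e) =
      (fun k => if k == j then blk w B j else if k < j then blk w B k else e).
    apply: (cs_frame spec) hI1 => b hb k; rewrite updE; case: eqP => // eb.
    by rewrite eb in hb.
  apply: functional_extensionality => k; rewrite ltnS leq_eqVlt.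
  by case: eqP => [->|].
- by split=> //; exists 0.
Qed.

Definition init_cost :=
  (expr_cost (Ld 20 (V 25)) + cmd_cost scan_body + 4) + (cmd_cost dims_body + 100) +
  7 * (blkset_cost + 100) + 3 * query_cost.

Lemma init_ok st w : size w < U -> (forall k, k < H -> 2 ^ (2 ^ k) <= size w) ->
  (forall b k, b != 20 -> st b k = 0) -> (forall k, st 20 k = symv w k) ->
  run lim arr init_prog st (init_cost * (size w).+1) (fun st' =>
    Top st' w /\ st' 2 0 = (foldr (fun b t => op (h b) t) e w \in F)).
Proof.
move=> hw hmin st0 e20.
have U0 : 0 < U by rewrite expn_gt0.
have Ul : 8 * U <= lim by apply: leq_trans lim_ok; rewrite leq_mul2l leq_pmulr.
have Hn : H <= size w.
  case: (posnP H) => [->//|H0]; have hp : H.-1 < H by rewrite prednK.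
  apply: leq_trans (hmin _ hp); rewrite -{1}(prednK H0).
  exact: leq_ltn_trans (ltnW (ltn_expl _ _)) (ltn_expl _ _).
rewrite /init_prog.
apply: (@run_weaken _ _ _ _ ((size w * (expr_cost (Ld 20 (V 25)) + cmd_cost scan_body + 3) +
    (expr_cost (Ld 20 (V 25)) + 1)) + ((cmd_cost dims_body + 100) * (size w).+1 +
    ((blkset_cost + 100) * (size w + 3 * B) + query_cost * B))) _ _ _ _ (fun _ h => h)).
  rewrite /init_cost /B; move: (expr_cost (Ld 20 (V 25))) (cmd_cost scan_body) (cmd_cost dims_body)
    (blkset_cost) (query_cost) (size w) Hn; clear; nia.
apply: run_seq; apply: run_weaken (scan_ok _ e20 _) => //; [| by rewrite st0 | by lia].
move=> st1 [hs1 e25].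
apply: run_seq; apply: run_weaken (dims_ok e25 hw hmin) => // st2 [hg e5 hs2].
have z2 b k : ~~ [|| b == 20, b == 25 | 3 <= b <= 5] -> st2 b k = 0.
  by move=> hb; rewrite hs2 ?hs1 ?st0 //=; lia.
have hI2 : Inv (fun=> e) st2 by apply: (cs_init spec) => b i hb; apply: z2; lia.
have e20' k : st2 20 k = symv w k by rewrite hs2 ?hs1.
apply: run_seq; apply: run_weaken (fill_ok hg e5 _ _ e20' hI2 hw) => //.
- move=> st3 [hI3 hs3].
  have hg3 : glob H st3 by case: hg => g3 g4; split; rewrite hs3.
  apply: run_weaken (query_ok hg3 hI3) => // st4 [hI4 hs4 e2].
  split; last by rewrite e2 total_blk.
  split=> //.
  + by case: hg3 => g3 g4; split; rewrite hs4.
  + by rewrite hs4 ?hs3.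
  + by move=> k; rewrite hs4 ?hs3.
- by rewrite z2.
- by rewrite hs2.
Qed.

End Top.

(* Moves the input out of cells [3 .. n+2] into array 20, from the last symbol down. *)
Definition move_prog q : program :=
  [:: IJz 0 20; IConst 1 1; ISub 0 0 1; IConst 1 3; IAdd 1 0 1; ILoad 2 1; IConst 1 1;
      IAdd 2 2 1; IConst 1 q; IMul 0 0 1; IConst 1 20; IAdd 0 0 1; IStore 0 2; IConst 1 q;
      IDiv 0 0 1; IConst 1 3; IAdd 1 0 1; IConst 2 0; IStore 1 2; IJz 2 0; IConst 1 0].

(** * Single machine steps and the relocation of the input *)

Section Steps.
Variables (W : nat) (p : program).

Lemma step_const pc i c m : fetch p pc = IConst i c -> c < 2 ^ W ->
  ram_step W p (pc, m) = (pc.+1, mem_upd m i c).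
Proof. by move=> hf hc; rewrite (step_at W m hf) /= modn_small. Qed.

Lemma step_add pc i j k m x y : fetch p pc = IAdd i j k -> m j = x -> m k = y ->
  x + y < 2 ^ W -> ram_step W p (pc, m) = (pc.+1, mem_upd m i (x + y)).
Proof. by move=> hf <- <- hc; rewrite (step_at W m hf) /= modn_small. Qed.

Lemma step_mul pc i j k m x y : fetch p pc = IMul i j k -> m j = x -> m k = y ->
  x * y < 2 ^ W -> ram_step W p (pc, m) = (pc.+1, mem_upd m i (x * y)).
Proof. by move=> hf <- <- hc; rewrite (step_at W m hf) /= modn_small. Qed.

Lemma step_div pc i j k m x y : fetch p pc = IDiv i j k -> m j = x -> m k = y ->
  x %/ y < 2 ^ W -> ram_step W p (pc, m) = (pc.+1, mem_upd m i (x %/ y)).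
Proof. by move=> hf <- <- hc; rewrite (step_at W m hf) /= modn_small. Qed.

Lemma step_pred pc i j k m x : fetch p pc = ISub i j k -> m j = x.+1 -> m k = 1 ->
  0 < W -> x < 2 ^ W -> ram_step W p (pc, m) = (pc.+1, mem_upd m i x).
Proof.
move=> hf hj hk W0 hx; rewrite (step_at W m hf) /= hj hk.
have h1 : 1 < 2 ^ W by rewrite -{1}(expn0 2) ltn_exp2l.
rewrite (modn_small h1); have -> : x.+1 + (2 ^ W - 1) = x + 2 ^ W by lia.
by rewrite modnDr modn_small.
Qed.

Lemma step_load pc i j m a x : fetch p pc = ILoad i j -> m j = a -> m a = x ->
  x < 2 ^ W -> ram_step W p (pc, m) = (pc.+1, mem_upd m i x).
Proof. by move=> hf <- <- hc; rewrite (step_at W m hf) /= modn_small. Qed.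

Lemma step_store pc i j m a x : fetch p pc = IStore i j -> m i = a -> m j = x ->
  x < 2 ^ W -> ram_step W p (pc, m) = (pc.+1, mem_upd m a x).
Proof. by move=> hf <- <- hc; rewrite (step_at W m hf) /= modn_small. Qed.

Lemma step_jz pc i l m x : fetch p pc = IJz i l -> m i = x ->
  ram_step W p (pc, m) = (if x == 0 then l else pc.+1, m).
Proof. by move=> hf <-; rewrite (step_at W m hf) /=; case: eqP. Qed.

End Steps.

Section Move.
Variables (S : finType) (W lim q : nat) (p : program) (w : seq S).
Hypothesis q_lim : q * lim <= 2 ^ W.
Hypothesis W0 : 0 < W.
Hypothesis q_pow : q < 2 ^ W.
Hypothesis q_20 : 20 < q.
Hypothesis S_lim : #|S|.+1 <= lim.
Hypothesis w_lim : size w < lim.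
Hypothesis p_move : code_at p 0 (move_prog q).

(** The symbols from [i] on have been moved. Targets [q * k + 20] with [k >= i] lie above the cell
    [i + 3], so going downwards no symbol still to be read is overwritten, and clearing a source
    cell hits no target. *)
Definition moved i (m : memory) :=
  [/\ m 0 = i, m 2 = 0, forall k, i <= k -> m (q * k + 20) = symv w k,
      forall x, 3 <= x < i + 3 -> m x = init_mem w x &
      forall x, i + 3 <= x -> (forall k, i <= k -> x <> q * k + 20) -> m x = 0]
  /\ forall x, m x < 2 ^ W.

Lemma move_step i m : i < size w -> moved i.+1 m ->
  exists m', runs W p 20 (0, m) (0, m') /\ moved i m'.
Proof.
move=> hi [[m0 m2 mhi mlo mz] mb].
have q0 : 0 < q by apply: leq_trans q_20.
have b20 : 20 < 2 ^ W by apply: ltn_trans q_20 q_pow.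
have lW : lim <= 2 ^ W by apply: leq_trans q_lim; rewrite leq_pmull.
have bi : i + 3 < 2 ^ W.
  have := q_lim; have : 20 * lim <= q * lim by rewrite leq_mul2r ltnW ?orbT. lia.
have ba : i * q + 20 < 2 ^ W.
  have : q * i.+1 <= q * lim by rewrite leq_mul2l ltnW ?orbT // (leq_ltn_trans hi).
  by rewrite mulnS mulnC; lia.
have [a ha] : exists a, onth w i = Some a.
  by move: hi; rewrite -onthTE; case: onth => // a _; exists a.
have m3 : m (i + 3) = sym_code a.
  rewrite mlo; last by lia.
  by rewrite /init_mem addn_eq0 andbF leq_addl addnC ltn_add2l hi /= addKn ha.
have hs : sym_code a < #|S| by exact: ltn_ord.
have P k : k < 21 -> fetch p k = nth IHalt (move_prog q) k by move=> hk; apply: p_move.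
have i0 : (i + 3 == 0) = false by lia.
have i1 : (i + 3 == 1) = false by lia.
have i2 : (i + 3 == 2) = false by lia.
have a0 : (i * q + 20 == 0) = false by lia.
have a1 : (i * q + 20 == 1) = false by lia.
have a2 : (i * q + 20 == 2) = false by lia.
eexists; split.
  eapply runsS; first by apply: (step_jz _ (P 0 isT)) m0.
  eapply runsS; first by apply: (step_const _ (P 1 isT)); lia.
  eapply runsS; first by apply: (step_pred (x := i) (P 2 isT)) => //; lia.
  eapply runsS; first by apply: (step_const _ (P 3 isT)); lia.
  eapply runsS; first by apply: (step_add (x := i) (y := 3) (P 4 isT)).
  eapply runsS; first by apply: (step_load (a := i + 3) (x := sym_code a) (P 5 isT));
    rewrite ?mem_updE ?i0 ?i1 ?i2 //; lia.
  eapply runsS; first by apply: (step_const _ (P 6 isT)); lia.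
  eapply runsS; first by apply: (step_add (x := sym_code a) (y := 1) (P 7 isT)) => //; lia.
  eapply runsS; first by apply: (step_const _ (P 8 isT)).
  eapply runsS; first by apply: (step_mul (x := i) (y := q) (P 9 isT)) => //; lia.
  eapply runsS; first by apply: (step_const _ (P 10 isT)); lia.
  eapply runsS; first by apply: (step_add (x := i * q) (y := 20) (P 11 isT)).
  eapply runsS; first by apply: (step_store (a := i * q + 20) (x := sym_code a + 1) (P 12 isT)) => //; lia.
  eapply runsS; first by apply: (step_const _ (P 13 isT)).
  eapply runsS.
    apply: (step_div (x := i * q + 20) (y := q) (P 14 isT)); rewrite ?mem_updE ?a0 //=.
      by rewrite eq_sym a0.
    exact: leq_ltn_trans (leq_div _ _) _.
  (* The counter had been overwritten by the target address; as [20 < q], dividing by [q] restores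
     it. Only the cells 0 to 2 are free at this stage. *)
  rewrite divnMDl // (divn_small q_20) addn0.
  eapply runsS; first by apply: (step_const _ (P 15 isT)); lia.
  eapply runsS; first by apply: (step_add (x := i) (y := 3) (P 16 isT)).
  eapply runsS; first by apply: (step_const _ (P 17 isT)); lia.
  eapply runsS; first by apply: (step_store (a := i + 3) (x := 0) (P 18 isT)) => //; lia.
  eapply runsS; first by apply: (step_jz (x := 0) _ (P 19 isT)); rewrite mem_updE eq_sym i2.
  exact: runs0.
split; last by do !apply: bound_upd => //; lia.
have hx x : 2 < x -> [/\ (x == 0) = false, (x == 1) = false & (x == 2) = false] by split; lia.
split.
- by rewrite !mem_updE !(eq_sym 0) i0 /=.
- by rewrite !mem_updE !(eq_sym 2) i2 /=.
- move=> k hk; have [h1 h2 h3] : [/\ (q * k + 20 == 0) = false, (q * k + 20 == 1) = false &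
    (q * k + 20 == 2) = false] by split; lia.
  have h4 : (q * k + 20 == i + 3) = false by nia.
  rewrite !mem_updE h1 h2 h3 h4.
  have [ek|nk] := eqVneq k i.
    by rewrite ek mulnC eqxx /symv ha addn1.
  have -> : (q * k + 20 == i * q + 20) = false.
    by rewrite eqn_add2r mulnC eqn_mul2r (negbTE nk) orbF; apply/eqP; lia.
  by apply: mhi; lia.
- move=> x hxx; have [|h1 h2 h3] := hx x; first by lia.
  have h4 : (x == i + 3) = false by lia.
  have h5 : (x == i * q + 20) = false by nia.
  by rewrite !mem_updE h1 h2 h3 h4 h5 mlo //; lia.
- move=> x hx1 hx2; have [|h1 h2 h3] := hx x; first by lia.
  rewrite !mem_updE h1 h2 h3; case: eqP => // h4; case: eqP => [h5|h5].
    by case: (hx2 i) => //; rewrite h5 mulnC.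
  by apply: mz => [|k hk]; [lia | apply: hx2; lia].
Qed.

Definition moved_state (b k : nat) := if b == 20 then symv w k else 0.

Lemma move_ok arr : 20 < arr -> arr <= q ->
  exists m', runs W p (size w * 20 + 2) (0, init_mem w) (21, m') /\
    agree W arr q m' moved_state.
Proof.
move=> h20 hq.
have b20 : 20 < 2 ^ W by apply: ltn_trans q_20 q_pow.
have lW : lim <= 2 ^ W by apply: leq_trans q_lim; rewrite leq_pmull // (leq_trans _ q_20).
have key i m : i <= size w -> moved i m ->
    exists m', runs W p (i * 20) (0, m) (0, m') /\ moved 0 m'.
  elim: i m => [|i IH] m hi hm; first by exists m.
  have [m1 [r1 hm1]] := move_step hi hm.
  have [m2 [r2 hm2]] := IH _ (ltnW hi) hm1.
  by exists m2; split=> //; rewrite mulSn; apply: runsD r1 r2.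
have symn k : size w <= k -> symv w k = 0 by move=> hk; rewrite /symv onth_default.
have init : moved (size w) (init_mem w).
  split; [split=> // |].
  - move=> k hk; rewrite symn // /init_mem.
    have -> : (q * k + 20 == 0) = false by lia.
    suff -> : (q * k + 20 < 3 + size w) = false by rewrite andbF.
    have : k <= q * k by rewrite leq_pmull // (leq_trans _ q_20).
    by clear -hk; lia.
  - move=> x hx _; rewrite /init_mem; have -> : (x == 0) = false by lia.
    suff -> : (x < 3 + size w) = false by rewrite andbF.
    by clear -hx; lia.
  move=> x; rewrite /init_mem; case: eqP => _; first by lia.
  case: ifP => _; last by lia.
  case: onth => [a|]; last by lia.
  by have hs : sym_code a < #|S| := ltn_ord _; lia.
have [m1 [r1 [[m0 m2 mhi mlo mz] mb]]] := key _ _ (leqnn _) init.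
exists (mem_upd m1 1 0); split.
  apply: runsD r1 _; apply: runsS (step_jz _ (p_move (isT : 0 < 21)) m0) _.
  apply: runsS (runs0 _ _ _); apply: (step_const _ (p_move (isT : 20 < 21))); lia.
split; last by apply: bound_upd => //; lia.
move=> b k hb; rewrite mem_updE /moved_state.
have q0 : 0 < q by apply: leq_trans q_20.
have [-> |nb] := eqVneq b 20; first by rewrite mhi //; case: eqP => //; lia.
case: eqP => // n1.
have [e0|n0] := eqVneq (q * k + b) 0; first by rewrite e0.
have [e2|n2] := eqVneq (q * k + b) 2; first by rewrite e2.
apply: mz => [|k' _ ek]; first by lia.
(* A cell of an array other than 20 is no target, by its residue modulo [q]. *)
have : (q * k + b) %% q = (q * k' + 20) %% q by rewrite ek.
rewrite ![q * _]mulnC !modnMDl !modn_small //; first by move=> eb; rewrite eb in nb.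
exact: leq_trans hq.
Qed.

End Move.

(** * Assembling the data structure *)

Lemma halts_run W lim arr q p pos c n st (Q : state -> Prop) m m' t :
  q * lim <= 2 ^ W -> 0 < W -> q < 2 ^ W -> arr + cmd_depth c <= q -> arr.+1 < q ->
  runs W p n (0, m) (pos, m') -> code_at p pos (comp arr q c pos) ->
  size p = pos + size (comp arr q c pos) -> agree W arr q m' st ->
  run lim arr c st t Q ->
  exists mf stf, [/\ halts_within W p m (n + t) mf, agree W arr q mf stf & Q stf].
Proof.
move=> hl W0 hq hd ha hr hc hs hm [u [stf [hu he hQ]]].
have [mf [hr' hm']] := comp_ok hl W0 hq he hc hd ha hm.
exists mf, stf; split=> //; exists (n + u); rewrite leq_add2l; split=> //.
(* The program counter has run off the end of the program, where [fetch] defaults to [IHalt]. *)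
by rewrite (runsD hr hr') /is_halted /fetch nth_default // hs.
Qed.

Lemma answers_bool (S : Type) (L : seq S -> Prop) w (m : memory) (b : bool) :
  (L w <-> b) -> m 2 = b -> answers L w m.
Proof.
rewrite /answers => h ->; case: b h => -[h1 h2]; split=> // h3; last by move: (h1 h3).
by case: h3; apply: h2.
Qed.

(** [H] is chosen minimal. If it is positive, the next smaller candidate is at most [n]: squaring it
    bounds the universe, and taking logarithms twice gives [H - 1 <= loglog n]. The factor 3 and the
    shifts by one cover the small cases. *)
Lemma dims_exist n : exists H, [/\ n < 2 ^ width H.+1, forall k, k < H -> 2 ^ (2 ^ k) <= n,
  2 ^ width H.+1 <= (n + 2) ^ 2 & H.+2 <= 3 * (loglog n).+1].
Proof.
have ex : exists H, n < 2 ^ (2 ^ H).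
  by exists n; apply: ltn_trans (ltn_expl n _) (ltn_expl _ _).
case: (ex_minnP ex) => H hH hmin; exists H; split=> //.
- by move=> k hk; rewrite leqNgt; apply/negP => /hmin; rewrite leqNgt hk.
- case: H hH hmin => [|h] _ hmin; first by rewrite addn2.
  have hh : 2 ^ (2 ^ h) <= n by rewrite leqNgt; apply/negP => /hmin; rewrite ltnn.
  rewrite /width expnS mulnC expnM leq_exp2r //; exact: leq_trans hh (leq_addr _ _).
case: H hH hmin => [|h] _ hmin; first by lia.
have hh : 2 ^ (2 ^ h) <= n by rewrite leqNgt; apply/negP => /hmin; rewrite ltnn.
suff : h <= loglog n by lia.
by rewrite /loglog; do 2 apply: trunc_log_max => //.
Qed.

(** The universe is at most [(n + 2) ^ 2], so [lim] has to exceed [8 * (n + 2) ^ 4]. With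
    [x = s + n + 2] it is at most [(t + 17) * x ^ 4], where 17 collects 1, 8 and 8; the constant
    [q * (t + 17)] is below its own power of [x >= 2], which explains the exponent. *)
Lemma word_size q t s n W : 0 < q ->
  (s + n + 2) ^ (q * (t + 17) + 4) <= 2 ^ W ->
  let lim := t + s.+1 + 8 + 8 * (n + 2) ^ 4 in
  [/\ q * lim <= 2 ^ W, 0 < W & q < 2 ^ W].
Proof.
move=> q0 hW lim; set x := s + n + 2 in hW.
have x4 : x <= x ^ 4 by rewrite -{1}(expn1 x) leq_pexp2l // /x addn2.
have hx : (n + 2) ^ 4 <= x ^ 4 by rewrite leq_exp2r // /x; lia.
have hl : lim <= (t + 17) * x ^ 4.
  rewrite /lim !mulnDl; have : t <= t * x ^ 4 by rewrite leq_pmulr // (leq_trans _ x4) // /x addn2.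
  move: x4 hx; rewrite {1}/x; set y := x ^ 4; set z := (n + 2) ^ 4; clear; lia.
have h1 : q * lim <= 2 ^ W.
  apply: leq_trans hW; rewrite expnD; apply: leq_trans (_ : q * ((t + 17) * x ^ 4) <= _).
    by rewrite leq_mul2l hl orbT.
  rewrite mulnA leq_mul2r; apply/orP; right; apply: leq_trans (ltnW (ltn_expl _ (isT : 1 < 2))) _.
  by rewrite leq_exp2r ?muln_gt0 ?q0 ?addn_gt0 ?orbT // /x leq_addl.
have l8 : 8 <= lim by rewrite /lim; lia.
have h2 : q * 8 <= 2 ^ W by apply: leq_trans h1; rewrite leq_mul2l l8 orbT.
by split=> //; [case: W {hW h1} h2 => //; rewrite expn0; lia | lia].
Qed.

Theorem theorem2 (Sigma : finType) (L : seq Sigma -> Prop) (hL : FO_definable L) :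
  exists (Pinit Pupd : program) (k C : nat),
    forall (W : nat) (w : seq Sigma),
      (#|Sigma| + size w + 2) ^ k <= 2 ^ W ->
      exists m0 : memory,
        halts_within W Pinit (init_mem w) (C * (size w).+1) m0 /\
        answers L w m0 /\
        forall us : seq (nat * Sigma),
          all (fun u => u.1 < size w) us ->
          updates_ok L W Pupd (C * (loglog (size w)).+1) w m0 us.
Proof.
have [T [E [op [e [h [F [am hE hLF]]]]]]] := FO_recognized hL.
have [a1 [cset [cinf [C [a1_ge Hcomp]]]]] : computable op e E 30.
  exact: (computable_all (leqnn _) (leqnn _) am (subxx _)).
pose arr := maxn a1 30.
pose ci := init_prog op e h F cset cinf; pose cu := upd_prog op e h F cset cinf.
(* A row has room for all arrays and for the temporaries of either program. *)
pose q := arr + 2 + cmd_depth ci + cmd_depth cu.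
pose Pinit := move_prog q ++ comp arr q ci 21.
pose Pupd := comp arr q cu 0.
pose Ci := init_cost op e h F C; pose Cu := upd_cost op e h F C.
(* 22 pays for relocation, 20 instructions per symbol and 2 more; the factor 3 comes from
   [H + 2 <= 3 * (loglog n + 1)]. *)
exists Pinit, Pupd, (q * (#|T| + 17) + 4), (22 + Ci + 3 * Cu) => W w hW.
have arr30 : 30 <= arr by apply: leq_maxr.
have arr_q : arr.+1 < q by rewrite /q; lia.
have q0 : 0 < q by lia.
pose lim := #|T| + #|Sigma|.+1 + 8 + 8 * (size w + 2) ^ 4.
have [q_lim W0 q_pow] : [/\ q * lim <= 2 ^ W, 0 < W & q < 2 ^ W] := word_size q0 hW.
have [H [hn hmin hU hB]] := dims_exist (size w).
have lim_ok : 8 * (2 ^ width H.+1 * 2 ^ width H.+1) <= lim.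
  apply: leq_trans (leq_addl _ _); rewrite leq_mul2l /=.
  by rewrite -[4]/(2 * 2) expnM mulnn leq_exp2r.
have T_lim : #|T| <= lim by rewrite /lim; lia.
have S_lim : #|Sigma|.+1 <= lim by rewrite /lim; lia.
have lim8 : 8 <= lim by rewrite /lim; lia.
have w_lim : size w < lim by nia.
have a1_arr : a1 <= arr by apply: leq_maxl.
have [Inv spec] := Hcomp lim arr H lim_ok T_lim a1_arr.
have code_init : code_at Pinit 0 (move_prog q ++ comp arr q ci 21) by [].
have [code_mv code_ci] := (code_at_cat _ _ _ _).1 code_init.
have [m1 [r1 g1]] : exists m', runs W Pinit (size w * 20 + 2) (0, init_mem w) (21, m') /\
    agree W arr q m' (moved_state w).
  by apply: (move_ok q_lim W0 q_pow _ S_lim w_lim code_mv); lia.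
have run1 : run lim arr ci (moved_state w) (Ci * (size w).+1) (fun st' =>
    Top op e h H Inv st' w /\ st' 2 0 = (foldr (fun b t => op (h b) t) e w \in F)).
  apply: (init_ok F am hE arr30 a1_arr T_lim S_lim lim8 lim_ok spec hn hmin) => // b k hb.
  by rewrite /moved_state (negbTE hb).
have di : arr + cmd_depth ci <= q by rewrite /q; lia.
have du : arr + cmd_depth cu <= q by rewrite /q; lia.
have [m0 [st0 [h0 g0 [top0 e0]]]] := halts_run q_lim W0 q_pow di arr_q r1 code_ci
  (size_cat _ _) g1 run1.
have m2 m st : agree W arr q m st -> m 2 = st 2 0.
  by case=> ha _; rewrite -ha ?muln0 //; lia.
exists m0; split.
  case: h0 => s [hs h0]; exists s; split=> //; apply: leq_trans hs _.
  by move: (size w) (Ci) (Cu); clear; nia.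
split; first by apply: (answers_bool (hLF w)); rewrite (m2 _ _ g0).
(* Between updates only the invariant and the length persist, so the induction runs over arbitrary
   words of that length. *)
clear r1 g1 run1; suff key us w1 m st : size w1 = size w -> Top op e h H Inv st w1 -> agree W arr q m st ->
    all (fun u => u.1 < size w) us ->
    updates_ok L W Pupd ((22 + Ci + 3 * Cu) * (loglog (size w)).+1) w1 m us.
  by move=> us; apply: key top0 g0.
elim: us w1 m st => [//|[i a] us IH] w1 m st sw top1 g1 /= /andP[hi hus].
rewrite -sw in hi hn.
(* The update is delivered in the memory cells 0 and 1, which are cells 0 of the arrays 0 and 1 in
   row 0. *)
have g2 : agree W arr q (upd_mem m i a) (upd2 (upd2 st 0 0 i) 1 0 (sym_code a)).
  have hs : sym_code a < #|Sigma| := ltn_ord _.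
  have lW : lim <= 2 ^ W by apply: leq_trans q_lim; rewrite leq_pmull.
  have -> : upd_mem m i a = mem_upd (mem_upd m (q * 0 + 0) i) (q * 0 + 1) (sym_code a).
    by rewrite muln0.
  have iW : i < 2 ^ W by rewrite sw in hi; lia.
  by apply: agree_store; [apply: agree_store g1 _ _ iW | | |]; lia.
have run2 := upd_ok F am hE arr30 a1_arr T_lim S_lim lim8 lim_ok spec a hn hi top1.
have code_cu : code_at Pupd 0 (comp arr q cu 0) by [].
have [m' [st' [h3 g3 [top3 e3]]]] := halts_run q_lim W0 q_pow du arr_q (runs0 _ _ _) code_cu
  erefl g2 run2.
exists m'; split.
  case: h3 => s [hs h3]; exists s; split=> //; apply: leq_trans hs _.
  apply: (@leq_trans (Cu * (3 * (loglog (size w)).+1))); first by rewrite leq_mul2l hB orbT.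
  by rewrite mulnA (mulnC Cu) leq_mul2r leq_addl orbT.
split; first by apply: (answers_bool (hLF _)); rewrite (m2 _ _ g3).
apply: IH top3 g3 hus.
by rewrite size_set_nth -sw; apply/maxn_idPr.
Qed.
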